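(* Let $p\ge 1$ be any positive integer. For any $u_0\in C^1(\mathbb{T})$ the Cauchy problem $$\partial_t u+u^p\,\partial_x u=\tfrac12\,\partial_x^{-1}\big(\partial_x(u^p)\,\partial_x u\big),\qquad u(x,0)=u_0(x),\quad x\in\mathbb{T},$$ has a unique solution $$u\in C^0([0,T),C^1(\mathbb{T}))\cap C^1([0,T),L^\infty(\mathbb{T}))$$ for some $T>0$, and the solution depends continuously on the initial data.
   Context: $\mathbb{T}\simeq\mathbb{R}/\mathbb{Z}$ is the circle, $t$ is a real time variable, and $C^1(\mathbb{T})$ is the space of continuously differentiable functions on $\mathbb{T}$. The equation is the modified Hunter-Saxton equation, written in nonlocal form. The operator $\partial_x^{-1}$ is defined, for some fixed $x_0\in\mathbb{T}$, by $$\partial_x^{-1}f(x):=\int_{x_0}^{x}f(y)\,dy-\int_{\mathbb{T}}\int_{x_0}^{z}f(y)\,dy\,dz.$$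
   Formalization: Here ∂_x^{-1}f means the displayed formula applied to f minus its mean over 𝕋: for f of nonzero mean that formula is not single-valued on 𝕋, and read on one branch it admits no solution, e.g. for p=1 and nonconstant u_0. *)

(* Defs.v *)
From HB Require Import structures.
From mathcomp Require Import all_boot all_order all_algebra.
From mathcomp Require Import all_classical all_reals all_analysis.
Set Implicit Arguments.
Unset Strict Implicit.
Unset Printing Implicit Defensive.
Import Order.TTheory GRing.Theory Num.Theory.
Import numFieldNormedType.Exports.
Local Open Scope classical_set_scope.
Local Open Scope ring_scope.

(* Functions on the circle R/Z are functions on R: elements of C^1 are
   1-periodic, and elements of L^oo are tested only through the Lebesgue measure
   of the fundamental domain [0, 1[. *)

Definition circle_measure (R : realType) :
    {measure set (measurableTypeR R) -> \bar R} :=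
  mrestr (@lebesgue_measure R) (measurable_itv `[0%R, 1%R[).

Definition Linfty_norm (R : realType) (g : R -> R) : \bar R :=
  Lnorm (circle_measure R) +oo%E (EFin \o g).

Definition Linfty (R : realType) (g : R -> R) : Prop :=
  (g : measurableTypeR R -> R) \in Lfun (circle_measure R) +oo%E.

Definition C1 (R : realType) (f : R -> R) : Prop :=
  [/\ periodic f 1, forall x : R, derivable f x 1 & continuous (derive1 f)].

Definition C1_norm (R : realType) (f : R -> R) : R :=
  sup (range (fun x => `|f x|)) + sup (range (fun x => `|derive1 f x|)).

Definition oriented_integral (R : realType) (a b : R) (f : R -> R) : R :=
  if a <= b then \int[lebesgue_measure]_(y in `[a, b]) f y
  else - \int[lebesgue_measure]_(y in `[b, a]) f y.

Definition circle_mean (R : realType) (f : R -> R) : R :=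
  \int[lebesgue_measure]_(y in `[0, 1]) f y.

Definition mean_zero_primitive (R : realType) (x0 : R) (f : R -> R) (x : R) : R :=
  oriented_integral x0 x f - circle_mean (fun z => oriented_integral x0 z f).

(* The integral of f from x0 to x depends on the path chosen in R/Z (it is not
   1-periodic in x) unless f has zero mean, so f is first projected onto functions
   of zero mean.  Without the projection the equation below would equate a
   function continuous on the circle with one that jumps by half the mean of
   (u ^ p)' u', which is positive for odd p and nonconstant u. *)
Definition dx_inv (R : realType) (x0 : R) (f : R -> R) : R -> R :=
  mean_zero_primitive x0 (fun y => f y - circle_mean f).

Lemma dx_invE (R : realType) (x0 : R) (f : R -> R) :
  circle_mean f = 0 -> dx_inv x0 f = mean_zero_primitive x0 f.
Proof.
by move=> f0; congr mean_zero_primitive; apply/funext => y; rewrite f0 subr0.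
Qed.

Definition C0_C1 (R : realType) (T : R) (u : R -> R -> R) : Prop :=
  forall t : R, t \in `[0, T[ ->
    C1 (u t) /\
    C1_norm (u s \- u t) @[s --> within `[0, T[ (nbhs t)] --> (0 : R).

(* u is in C^1([0, T), L^oo) with derivative ut; at t = 0 the derivative is
   one-sided. *)
Definition C1_Linfty (R : realType) (T : R) (u ut : R -> R -> R) : Prop :=
  forall t : R, t \in `[0, T[ ->
    [/\ Linfty (u t), Linfty (ut t),
        Linfty_norm (fun x => (s - t)^-1 * (u s x - u t x) - ut t x)
          @[s --> within `[0, T[ t^'] --> 0%E &
        Linfty_norm (ut s \- ut t) @[s --> within `[0, T[ (nbhs t)] --> 0%E].

(* The equation is an identity in L^oo for every t, hence "almost every x". *)
Definition mHS_solution (R : realType) (p : nat) (x0 T : R) (u0 : R -> R)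
    (u ut : R -> R -> R) : Prop :=
  [/\ C0_C1 T u, C1_Linfty T u ut,
      forall t : R, t \in `[0, T[ ->
        {ae circle_measure R, forall x : R,
          ut t x + u t x ^+ p * derive1 (u t) x =
          2^-1 * dx_inv x0
            (fun y => derive1 (fun z => u t z ^+ p) y * derive1 (u t) y) x} &
      u 0 =1 u0].

(* Main.v *)
Require Import Defs.
From HB Require Import structures.
From mathcomp Require Import all_boot all_order all_algebra.
From mathcomp Require Import all_classical all_reals all_analysis.
From mathcomp Require Import ess_sup_inf measurable_realfun ring lra.
Set Implicit Arguments.
Unset Strict Implicit.
Unset Printing Implicit Defensive.
Import Order.TTheory GRing.Theory Num.Theory.
Import numFieldNormedType.Exports.
Local Open Scope classical_set_scope.
Local Open Scope ring_scope.

(** In the variables of the circle the problem loses a derivative: the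
    equation for u_x - v_x, where u and v are two solutions, contains
    (u^p - v^p) v_xx.  The proof removes the loss by passing to the flow eta of
    the velocity u^p, eta_t = u^p(eta).  Differentiating the equation in x gives

      u_xt + u^p u_xx = - (1/2) p u^(p-1) u_x^2 - m / 2,

    where m is the mean of (u^p)_x u_x.  Put U = u(eta), k = p U^(p-1),
    J = eta_x, Q = u_x(eta) J = U_x and E = u_x(eta)^2 J.  Then

      Q' = (k E - m J) / 2,   J' = k Q,   E' = - m Q,   m = integral of k E,

    while b = eta(0) and a = U(0) satisfy b' = a^p and a' = the right hand side
    of the problem at eta(0), which integrals of k E - m J and J express.  As
    U = a + primitive of Q and eta = b + primitive of J, this system for
    (b, a, Q, J, E) is closed.  Its right hand side is polynomial up to
    integrations in x, hence Lipschitz in the sup norm on bounded sets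
    (lagN_constant), and it preserves periodicity, the mean 0 of Q and the mean 1
    of J (adm_step).
    Picard iteration solves it for a time that depends only on a bound of the
    data (lag_exists), during which J is at least 1/2, and a Gronwall estimate
    gives Lipschitz dependence on the data (lag_stable).

    Existence: eta(t, .) is a diffeomorphism of the circle, E J = Q^2 is
    conserved, and u = U(eta^-1), u_x = (Q / J)(eta^-1) solve the equation
    (dx_inv_source, u_time_derivative, eulerian_mHS).

    Uniqueness: a solution w in the sense of the theorem is classical, because
    its difference quotients are continuous in x and converge in L^oo to a
    continuous function (is_derive_frozen_dt).  Its flow exists, is differentiable in the
    label although w^p is only C^1 (is_derive_eta), and the quantities
    (b, a, Q, J, E) formed from w solve the system (lag_of_sol).  They are
    therefore determined by the initial value, and so is w (mHS_eulerian).

    Continuous dependence: u, u_x and u_t are the compositions with eta^-1 of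
    functions that are Lipschitz in the Lagrangian state; the moduli of
    continuity of the fields of one fixed solution control the effect of
    exchanging one flow for the other (eulerian_close). *)

(** * Derivatives through difference estimates *)

Section derivatives.
Context {R : realType}.
Implicit Types (f g h : R -> R) (a b c d e t x y : R).

Lemma nearRP x (P : R -> Prop) : (\forall y \near x, P y) <->
  exists2 d : R, 0 < d & forall y, `|y - x| < d -> P y.
Proof.
split=> [[d d0 dP]|[d d0 dP]]; exists d => //= y.
  by rewrite distrC => /dP.
by rewrite /ball_/= distrC => /dP.
Qed.

Lemma continuousRP f x : {for x, continuous f} <->
  forall e, 0 < e -> exists2 d : R, 0 < d & forall y, `|y - x| < d -> `|f y - f x| <= e.
Proof.
split=> [/cvgrPdist_le fx e e0|fx].
  have /nearRP[d d0 dP] := fx e e0; exists d => // y /dP.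
  by rewrite distrC.
apply/cvgrPdist_le => e e0; apply/nearRP.
by have [d d0 dP] := fx e e0; exists d => // y /dP; rewrite distrC.
Qed.

Lemma is_derive_continuous f x d : is_derive x 1 f d -> {for x, continuous f}.
Proof.
by move=> fd; apply: differentiable_continuous; apply/derivable1_diffP.
Qed.

(** The form without division: it needs no case y = x and is stable under sums
    and products of estimates. *)
Lemma is_derive_epsP f x d : is_derive x 1 f d <->
  forall e, 0 < e -> exists2 del : R, 0 < del & forall y, `|y - x| < del ->
    `|f y - f x - (y - x) * d| <= e * `|y - x|.
Proof.
have quot y : y != x -> `|d - (y - x)^-1 *: (f ((y - x) *: 1 + x) - f x)| =
    `|f y - f x - (y - x) * d| / `|y - x|.
  move=> yx; have yx0 : y - x != 0 by rewrite subr_eq0.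
  rewrite distrC [(y - x) *: 1]mulr1 subrK -[in RHS](normfV (y - x)) -normrM.
  congr `| _ |; rewrite [_ *: _]mulrC [in RHS]mulrBl; congr (_ - _).
  by rewrite [(y - x) * d]mulrC mulfK.
split.
  move=> fd; have [fx fE] := fd; move: fx; rewrite /derivable.
  move=> /cvg_ex [/= l fl] e e0.
  have ld : l = d by rewrite -fE; apply/esym/cvg_lim.
  move: fl; rewrite ld => /cvgrPdist_le /(_ e e0) [del del0 delP].
  exists del => // y yx; have [->|ynx] := eqVneq y x.
    by rewrite !subrr mul0r subr0 normr0 mulr0.
  have yx0 : 0 < `|y - x| by rewrite normr_gt0 subr_eq0.
  rewrite -ler_pdivrMr // -quot //; apply: delP; last by rewrite subr_eq0.
  by rewrite /ball_/= sub0r normrN.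
move=> H; suff C : (fun k : R => k^-1 *: (f (k *: 1 + x) - f x)) @ 0^' --> d.
  by apply: DeriveDef; [apply/cvg_ex; exists d|apply/cvg_lim].
apply/cvgrPdist_le => e e0; have [del del0 delP] := H e e0.
exists del => //= k; rewrite /ball_/= sub0r normrN => kd k0.
have yx : k + x - x = k by rewrite addrK.
have := @quot (k + x); rewrite yx => -> //; last first.
  by rewrite -subr_eq0 yx.
rewrite ler_pdivrMr ?normr_gt0 //; have := delP (k + x); rewrite yx; exact.
Qed.

Lemma mvt_le f g df dg a b : a <= b ->
  (forall x, a < x < b -> is_derive x 1 f (df x)) ->
  (forall x, a < x < b -> is_derive x 1 g (dg x)) ->
  (forall x, a <= x <= b -> {for x, continuous f}) ->
  (forall x, a <= x <= b -> {for x, continuous g}) ->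
  (forall x, a < x < b -> df x <= dg x) -> f b - f a <= g b - g a.
Proof.
move=> ab fd gd fc gc dfg.
have [eab|nab] := eqVneq a b; first by rewrite eab !subrr.
have {nab}ab' : a < b by rewrite lt_neqAle nab.
have [x|x|c cab] := @MVT R (fun x => g x - f x) (fun x => dg x - df x) a b ab'.
- rewrite in_itv => /= xab.
  have := fd x xab; have := gd x xab => ? ?; exact: is_deriveB.
- apply: continuous_in_subspaceT => y; rewrite inE /= in_itv /= => yab.
  by apply: continuousB; [exact: gc|exact: fc].
- move=> E; have : 0 <= (dg c - df c) * (b - a).
    by rewrite mulr_ge0 ?subr_ge0 ?(ltW ab') // dfg // -in_itv.
  by rewrite -E; lra.
Qed.

Lemma mean_value f df a b :
  (forall x, is_derive x 1 f (df x)) ->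
  exists2 c, `|c - a| <= `|b - a| & f b - f a = df c * (b - a).
Proof.
move=> fd.
have W x y : x <= y -> exists2 c, x <= c <= y & f y - f x = df c * (y - x).
  move=> xy; have fc : {within `[x, y], continuous f}.
    by apply: continuous_subspaceT => z; exact: is_derive_continuous.
  have [c] := @MVT_segment R f df x y xy (fun z _ => fd z) fc.
  by rewrite in_itv /= => ? ?; exists c.
have [ab|/ltW ba] := leP a b.
  have [c /andP[ac cb] E] := W _ _ ab; exists c => //.
  by rewrite !ger0_norm ?subr_ge0 ?lerB.
have [c /andP[ac cb] E] := W _ _ ba; exists c; last by rewrite -[RHS]opprK; lra.
by rewrite !ler0_norm ?subr_le0 //; lra.
Qed.

End derivatives.

(** * Primitives of continuous functions *)

Section primitive.
Context {R : realType}.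
Implicit Types (f g h F G : R -> R) (a b c d e s t x y T M : R).
Local Notation mu := lebesgue_measure.

Definition prim f x := oriented_integral 0 x f.

Let cont_int f a b : continuous f -> mu.-integrable `[a, b] (EFin \o f).
Proof.
move=> fc; apply: continuous_compact_integrable; first exact: segment_compact.
exact: continuous_subspaceT.
Qed.

Let itvB f a b c : continuous f -> a <= b -> b <= c ->
  \int[mu]_(y in `[b, c]) f y =
  \int[mu]_(y in `[a, c]) f y - \int[mu]_(y in `[a, b]) f y.
Proof.
move=> fc ab bc; rewrite Rintegral_itvB ?bnd_simp //; last exact: cont_int.
rewrite Rintegral_itv_obnd_cbnd //.
apply: (@integrableS _ _ _ mu `[b, c]) => //; first exact: subset_itv_oc_cc.
exact: cont_int.
Qed.

(** A base point a to the left of both bounds removes the case distinction on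
    their order. *)
Lemma oriented_integralE f a b c : continuous f -> a <= b -> a <= c ->
  oriented_integral b c f =
  \int[mu]_(y in `[a, c]) f y - \int[mu]_(y in `[a, b]) f y.
Proof.
move=> fc ab ac; rewrite /oriented_integral; case: ifPn => bc.
  by rewrite (@itvB f a).
by rewrite -ltNge in bc; rewrite (@itvB f a) ?opprB // ltW.
Qed.

Lemma oriented_integral_prim f a b : continuous f ->
  oriented_integral a b f = prim f b - prim f a.
Proof.
move=> fc; pose c := Num.min 0 (Num.min a b).
have [c0 [ca cb]] : c <= 0 /\ c <= a /\ c <= b.
  by rewrite /c; split; last split; rewrite !ge_min lexx ?orbT.
by rewrite /prim !(@oriented_integralE _ c) //; lra.
Qed.

Lemma prim0 f : prim f 0 = 0.
Proof. by rewrite /prim /oriented_integral lexx set_itv1 Rintegral_set1. Qed.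

Lemma is_derive_prim f x : continuous f -> is_derive x 1 (prim f) (f x).
Proof.
move=> fc; pose a := Num.min 0 x - 1.
have [a0 ax] : a < 0 /\ a < x.
  have : Num.min 0 x <= 0 by rewrite ge_min lexx.
  have : Num.min 0 x <= x by rewrite ge_min lexx orbT.
  by rewrite /a; split; lra.
have [||||H1 H2] := @continuous_FTC1_closed R f a x (x + 1).
- by rewrite ltrDl.
- exact: cont_int.
- exact: ax.
- exact: fc.
pose H z := \int[mu]_(t in `[a, z]) f t.
have HD : is_derive x 1 H (f x).
  exact: DeriveDef H1 (etrans (esym (derive1E H x)) H2).
suff : is_derive x 1 (fun z => H z - H 0) (f x).
  apply: near_eq_is_derive; apply/nearRP; exists (x - a); first by rewrite subr_gt0.
  move=> y yx; rewrite /prim (@oriented_integralE f a) //; first exact: ltW.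
  by move: yx; rewrite ltr_norml => /andP[+ _]; lra.
have -> : f x = f x - 0 by rewrite subr0.
exact: is_deriveB.
Qed.

Lemma prim_unique f F x : continuous f -> (forall y, is_derive y 1 F (f y)) ->
  F x = F 0 + prim f x.
Proof.
move=> fc FD; suff : F x - prim f x = F 0 - prim f 0 by rewrite prim0; lra.
apply: (@is_derive_0_is_cst R (fun z => F z - prim f z)) => y.
rewrite -(subrr (f y)).
have ? := FD y; have ? := @is_derive_prim f y fc; exact: is_deriveB.
Qed.

Lemma circle_mean_prim f : circle_mean f = prim f 1.
Proof. by rewrite /prim /oriented_integral ler01. Qed.

End primitive.

Section continuity.
Context {R : realType} {T : topologicalType}.
Implicit Types f g : T -> R.

Lemma ctsC (c : R) : continuous (fun _ : T => c).
Proof. by move=> x; exact: cvg_cst. Qed.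

Lemma ctsD f g : continuous f -> continuous g -> continuous (fun x => f x + g x).
Proof. by move=> fc gc x; apply: continuousD; [exact: fc|exact: gc]. Qed.

Lemma ctsN f : continuous f -> continuous (fun x => - f x).
Proof. by move=> fc x; apply: continuousN; exact: fc. Qed.

Lemma ctsB f g : continuous f -> continuous g -> continuous (fun x => f x - g x).
Proof. by move=> fc gc; apply: ctsD => //; exact: ctsN. Qed.

Lemma ctsM f g : continuous f -> continuous g -> continuous (fun x => f x * g x).
Proof. by move=> fc gc x; apply: continuousM; [exact: fc|exact: gc]. Qed.

Lemma ctsX f n : continuous f -> continuous (fun x => f x ^+ n).
Proof.
move=> fc; elim: n => [|n IH]; first exact: ctsC.
have -> : (fun x => f x ^+ n.+1) = (fun x => f x * f x ^+ n).
  by apply/funext => x; rewrite exprS.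
exact: ctsM.
Qed.

Lemma ctsF (U : topologicalType) (h : R -> U) f :
  continuous h -> continuous f -> continuous (fun x => h (f x)).
Proof. by move=> hc fc x; apply: continuous_comp; [exact: fc|exact: hc]. Qed.

End continuity.

Section primitive_theory.
Context {R : realType}.
Implicit Types (f g h F G : R -> R) (a b c d e s t x y T M : R).

Lemma continuous_prim f : continuous f -> continuous (prim f).
Proof. by move=> fc x; apply: is_derive_continuous; exact: is_derive_prim. Qed.

Lemma primD f g x : continuous f -> continuous g ->
  prim (fun y => f y + g y) x = prim f x + prim g x.
Proof.
move=> fc gc; apply/esym.
have := @prim_unique R (fun y => f y + g y) (fun y => prim f y + prim g y) x.
rewrite !prim0 !add0r; apply; first exact: ctsD.
by move=> y; apply: is_deriveD; exact: is_derive_prim.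
Qed.

Lemma primZ f c x : continuous f -> prim (fun y => c * f y) x = c * prim f x.
Proof.
move=> fc; apply/esym.
have := @prim_unique R (fun y => c * f y) (fun y => c * prim f y) x.
rewrite !prim0 mulr0 !add0r; apply.
  exact: ctsM (@ctsC _ _ c) fc.
by move=> y; have ? := @is_derive_prim _ f y fc; apply: is_deriveZ.
Qed.

Lemma primB f g x : continuous f -> continuous g ->
  prim (fun y => f y - g y) x = prim f x - prim g x.
Proof.
move=> fc gc; have -> : (fun y => f y - g y) = (fun y => f y + (-1) * g y).
  by apply/funext => y; rewrite mulN1r.
rewrite primD ?primZ ?mulN1r //; exact: ctsM (@ctsC _ _ (-1)) gc.
Qed.

Lemma is_derive_pow f x d n : is_derive x 1 f d ->
  is_derive x 1 (fun y => f y ^+ n.+1) (n.+1%:R * f x ^+ n * d).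
Proof.
move=> fd; have -> : (fun y => f y ^+ n.+1) = f ^+ n.+1.
  by apply/funext => y; rewrite exprfctE.
by apply: is_derive_eq; rewrite /GRing.scale /=; ring.
Qed.

Lemma is_derive_mul f g a b x : is_derive x 1 f a -> is_derive x 1 g b ->
  is_derive x 1 (fun y => f y * g y) (a * g x + f x * b).
Proof.
move=> fd gd; apply: is_derive_eq.
by rewrite /GRing.scale /=; ring.
Qed.

Lemma prim_cst c x : prim (fun=> c) x = c * x.
Proof.
apply/esym; have := @prim_unique R (fun=> c) (fun y => c * y) x.
rewrite mulr0 add0r; apply; first exact: ctsC.
by move=> y; rewrite -[X in is_derive _ _ _ X]mulr1; exact: is_deriveZ.
Qed.

(** The derivative is only required inside the interval: functions that are
    frozen outside [0, T] have none at its ends. *)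
Lemma prim_itv f h T t : continuous f -> continuous h ->
  (forall s, 0 < s < T -> is_derive s 1 f (h s)) -> 0 <= t <= T ->
  f t = f 0 + prim h t.
Proof.
move=> fc hc fd /andP[t0 tT].
have fc' x : 0 <= x <= t -> {for x, continuous f} by move=> _; exact: fc.
have hc' x : 0 <= x <= t -> {for x, continuous (prim h)}.
  by move=> _; exact: continuous_prim.
have fd' x : 0 < x < t -> is_derive x 1 f (h x).
  by move=> /andP[? ?]; apply: fd; lra.
have hd' x : 0 < x < t -> is_derive x 1 (prim h) (h x).
  by move=> _; exact: is_derive_prim.
have := mvt_le t0 fd' hd' fc' hc' (fun _ _ => lexx _).
have := mvt_le t0 hd' fd' hc' fc' (fun _ _ => lexx _).
by rewrite prim0; lra.
Qed.

Lemma is_derive_itv f h T t : continuous h ->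
  (forall s, 0 <= s <= T -> f s = f 0 + prim h s) -> 0 < t < T ->
  is_derive t 1 f (h t).
Proof.
move=> hc fE /andP[t0 tT].
have D : is_derive t 1 (fun s => f 0 + prim h s) (h t).
  rewrite -[h t]add0r; have ? := @is_derive_prim _ h t hc; exact: is_deriveD.
apply: near_eq_is_derive D; apply/nearRP; exists (Num.min t (T - t)).
  by rewrite lt_min subr_gt0 t0.
move=> s; rewrite lt_min !ltr_norml => /andP[/andP[? ?] /andP[? ?]].
by rewrite [RHS]fE //; apply/andP; split; lra.
Qed.

Lemma prim_le_itv f g G t : continuous f -> (forall s, is_derive s 1 G (g s)) ->
  0 <= t -> (forall s, 0 <= s <= t -> `|f s| <= g s) -> `|prim f t| <= G t - G 0.
Proof.
move=> fc Gd t0 fg.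
have Gc : continuous G by move=> x; exact: is_derive_continuous (Gd x).
have fd x : is_derive x 1 (prim f) (f x) by exact: is_derive_prim.
have pc := continuous_prim fc.
have Nd x : is_derive x 1 (fun y => - G y) (- g x) by exact: is_deriveN.
have Nc : continuous (fun y => - G y) := ctsN Gc.
have b s : 0 < s < t -> - g s <= f s <= g s.
  by move=> /andP[? ?]; rewrite -ler_norml; apply: fg; lra.
have b1 s : 0 < s < t -> - g s <= f s by move=> /b /andP[].
have b2 s : 0 < s < t -> f s <= g s by move=> /b /andP[].
have := mvt_le t0 (fun x _ => Nd x) (fun x _ => fd x) (fun x _ => Nc x)
  (fun x _ => pc x) b1.
have := mvt_le t0 (fun x _ => fd x) (fun x _ => Gd x) (fun x _ => pc x)
  (fun x _ => Gc x) b2.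
by rewrite prim0 ler_norml; lra.
Qed.

Lemma eq_prim_itv f g t : continuous f -> continuous g -> 0 <= t ->
  (forall s, 0 <= s <= t -> f s = g s) -> prim f t = prim g t.
Proof.
move=> fc gc t0 fg; apply/eqP; rewrite -subr_eq0 -primB // -normr_eq0 eq_le normr_ge0.
rewrite andbT; have := @prim_le_itv (fun y => f y - g y) (fun=> 0) (fun=> 0) t.
rewrite subrr; apply => //.
  exact: ctsB.
by move=> s /fg ->; rewrite subrr normr0.
Qed.

Lemma prim_lip f M x y : continuous f ->
  (forall s, `|s - x| <= `|y - x| -> `|f s| <= M) ->
  `|prim f y - prim f x| <= M * `|y - x|.
Proof.
move=> fc fM.
have [c cx ->] := @mean_value R (prim f) f x y (fun s => @is_derive_prim _ f s fc).
by rewrite normrM ler_wpM2r // fM.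
Qed.

Lemma prim_bound f M x : continuous f ->
  (forall s, `|s| <= `|x| -> `|f s| <= M) -> `|prim f x| <= M * `|x|.
Proof.
move=> fc fM; have := @prim_lip f M 0 x fc; rewrite prim0 !subr0; apply => s.
by rewrite subr0; exact: fM.
Qed.

Lemma prim_mul_deriv f g h x : continuous f -> continuous h ->
  (forall y, is_derive y 1 g (h y)) ->
  prim (fun y => f (g y) * h y) x = prim f (g x) - prim f (g 0).
Proof.
move=> fc hc gd; have gc : continuous g.
  by move=> y; exact: is_derive_continuous (gd y).
have fgc : continuous (fun y => f (g y) * h y).
  apply: ctsM => //; exact: ctsF.
have := @prim_unique R (fun y => f (g y) * h y) (fun y => prim f (g y)) x fgc.
have D y : is_derive y 1 (fun y => prim f (g y)) (f (g y) * h y).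
  have ? := @is_derive_prim _ f (g y) fc; have ? := gd y.
  exact: (@is_derive1_comp R (prim f) g).
by move=> /(_ D) ->; rewrite addrC addKr.
Qed.

Section periodic.
Variable f : R -> R.
Hypotheses (fc : continuous f) (fp : periodic f 1).

Lemma prim_periodic x : prim f (x + 1) = prim f x + prim f 1.
Proof.
have := @prim_mul_deriv f (fun y => y + 1) (fun=> 1) x fc.
rewrite add0r => H; suff <- : prim (fun y => f (y + 1) * 1) x = prim f x.
  have D y : is_derive y 1 (fun y : R => y + 1) 1.
    by rewrite -[X in is_derive _ _ _ X]addr0; exact: is_deriveD.
  by rewrite (H (@ctsC _ _ 1) D) subrK.
by congr prim; apply/funext => y; rewrite fp mulr1.
Qed.

End periodic.

Lemma periodicZ f (n : int) x : periodic f 1 -> f (x + n%:~R) = f x.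
Proof.
move=> fp; have P (k : nat) y : f (y + k%:R) = f y by exact: periodicn.
by case: n => n; [exact: P|rewrite NegzE mulrNz -[in RHS](subrK n.+1%:R x) P].
Qed.

Lemma periodic_repr x : exists n : int, 0 <= x + n%:~R < 1.
Proof.
exists (- Num.floor x); rewrite mulrNz.
have /andP[h1 h2] := floor_itv x.
by rewrite subr_ge0 h1 /=; move: h2; rewrite intrD; lra.
Qed.

(** Such a primitive is itself 1-periodic, so that |x| can be replaced by 1 in
    the trivial bound. *)
Lemma prim_mean0_bound f M x : continuous f -> periodic f 1 -> prim f 1 = 0 ->
  (forall y, `|f y| <= M) -> `|prim f x| <= M.
Proof.
move=> fc fp f0 fM; have [n /andP[n0 n1]] := periodic_repr x.
have pp : periodic (prim f) 1 by move=> y; rewrite prim_periodic // f0 addr0.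
rewrite -(periodicZ n x pp); apply: le_trans (prim_bound fc (fun s _ => fM s)) _.
rewrite ler_piMr ?(le_trans _ (fM 0)) // ger0_norm //; exact: ltW.
Qed.

End primitive_theory.

(** * Jointly continuous functions *)

Section joint_continuity.
Context {R : realType}.
Implicit Types (f g h : R -> R -> R) (a b c d e s t x y T M : R).

Definition jcont f := continuous (fun z : R * R => f z.1 z.2).

Lemma jcontP f : jcont f <-> forall t x e, 0 < e -> exists2 d : R, 0 < d &
  forall s y, `|s - t| < d -> `|y - x| < d -> `|f s y - f t x| <= e.
Proof.
split=> [fc t x e e0|fc [t x]].
  have /cvgrPdist_le /(_ e e0) := fc (t, x).
  case=> [[A B]] /= [/nearRP[d1 d10 A1] /nearRP[d2 d20 B2]] AB.
  exists (Num.min d1 d2) => [|s y]; first by rewrite lt_min d10.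
  rewrite !lt_min => /andP[sd1 _] /andP[_ yd2].
  by rewrite distrC; apply: (AB (s, y)); split; [exact: A1|exact: B2].
apply/cvgrPdist_le => e e0; have [d d0 dP] := fc t x e e0.
exists (ball t d, ball x d); first by split; exact: nbhsx_ballx.
move=> [s y] /= []; rewrite /ball /= ![`|_ - s|]distrC ![`|_ - y|]distrC => ? ?.
by rewrite distrC; exact: dP.
Qed.

Lemma jcont_comp (U : topologicalType) f (g k : U -> R) : jcont f ->
  continuous g -> continuous k -> continuous (fun u => f (g u) (k u)).
Proof.
move=> fc gc kc u.
have pc : continuous (fun u => (g u, k u)).
  by move=> v; exact: (cvg_pair (gc v) (kc v)).
exact: (@continuous_comp _ _ _ (fun u => (g u, k u)) (fun z => f z.1 z.2) u (pc u)
  (fc _)).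
Qed.

Lemma cts_id {U : topologicalType} : continuous (fun u : U => u).
Proof. by move=> u; exact: cvg_id. Qed.

Lemma jcont1 f x : jcont f -> continuous (f^~ x).
Proof. by move=> fc; apply: jcont_comp => //; [exact: cts_id|exact: ctsC]. Qed.

Lemma jcont2 f t : jcont f -> continuous (f t).
Proof. by move=> fc; apply: jcont_comp => //; [exact: ctsC|exact: cts_id]. Qed.

Arguments jcont1 {f} x _ _.
Arguments jcont2 {f} t _ _.

Lemma cts_fst : continuous (fun z : R * R => z.1).
Proof. by move=> z; exact: cvg_fst. Qed.

Lemma cts_snd : continuous (fun z : R * R => z.2).
Proof. by move=> z; exact: cvg_snd. Qed.

Lemma jcont_swap f : jcont f -> jcont (fun t x => f x t).
Proof. by move=> fc; exact: (jcont_comp fc cts_snd cts_fst). Qed.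

Lemma jcont_comp2 f g : jcont f -> jcont g -> jcont (fun t x => f t (g t x)).
Proof. by move=> fc gc; exact: (jcont_comp fc cts_fst gc). Qed.

Lemma jcont_compl f (k : R -> R) : jcont f -> continuous k ->
  jcont (fun t x => f (k t) x).
Proof.
move=> fc kc; exact: (jcont_comp fc (ctsF kc cts_fst) cts_snd).
Qed.

Lemma jcont_t (k : R -> R) : continuous k -> jcont (fun t _ => k t).
Proof. by move=> kc; exact: ctsF kc cts_fst. Qed.

Lemma jcont_x (k : R -> R) : continuous k -> jcont (fun _ x => k x).
Proof. by move=> kc; exact: ctsF kc cts_snd. Qed.

(** Compactness of a rectangle: local radii have a common positive lower bound.
    The Lebesgue number, uniform continuity and boundedness are instances. *)
Lemma rectangle_radius a b a' b' (P : R -> R -> R -> Prop) :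
  (forall t x, a <= t <= b -> a' <= x <= b' -> exists2 d : R, 0 < d &
    forall s y e, `|s - t| < d -> `|y - x| < d -> 0 < e < d -> P e s y) ->
  exists2 d : R, 0 < d & forall t x, a <= t <= b -> a' <= x <= b' -> P d t x.
Proof.
move=> loc; have cpt := compact_setX (@segment_compact R a b) (@segment_compact R a' b').
move/compact_near_coveringP/near_covering_withinP : cpt.
move=> /(_ R (0 : R)^'+ (fun e z => P e z.1 z.2) _).
case.
  move=> [t x] [/=]; rewrite !in_itv /= => tab xab.
  have [d d0 dP] := loc t x tab xab.
  exists (ball (t, x) d, [set e | 0 < e < d]); first split.
  - exact: nbhsx_ballx.
  - near=> e; apply/andP; split; near: e; first exact: nbhs_right_gt.
    exact: nbhs_right_lt.
  move=> [[s y] e] /= [[]]; rewrite /ball /= => ts xy ed _.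
  by apply: dP => //; rewrite distrC.
move=> e /= e0 eP; exists (e / 2); first lra.
move=> t x tab xab; apply: (eP (e / 2) _ _ (t, x)); rewrite /ball_/=.
- by rewrite sub0r normrN gtr0_norm; lra.
- by lra.
- by split; rewrite /= in_itv.
Unshelve. all: by end_near. Qed.

Lemma jcont_unif2 f a b a' b' e : jcont f -> 0 < e -> exists2 d : R, 0 < d &
  forall t x, a <= t <= b -> a' <= x <= b' -> forall s y, `|s - t| < d ->
  `|y - x| < d -> `|f s y - f t x| <= e.
Proof.
move=> fc e0.
have [t0 x0 tab xab|d d0 dP] := @rectangle_radius a b a' b' (fun d t x =>
  forall s y, `|s - t| < d -> `|y - x| < d -> `|f s y - f t x| <= e).
  have e20 : 0 < e / 2 by lra.
  have [d d0 dP] := (jcontP f).1 fc t0 x0 (e / 2) e20.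
  exists (d / 2); first lra.
  move=> t x r tt xx /andP[r0 rd] s y st yx.
  have D (u v w : R) : `|u - v| < d / 2 -> `|w - u| < r -> `|w - v| < d.
    by rewrite !ltr_norml => /andP[? ?] /andP[? ?]; apply/andP; split; lra.
  have := dP s y (D _ _ _ tt st) (D _ _ _ xx yx).
  have d2 : d / 2 < d by lra.
  have := dP t x (lt_trans tt d2) (lt_trans xx d2).
  by rewrite !ler_norml => /andP[? ?] /andP[? ?]; apply/andP; split; lra.
by exists d.
Qed.

Lemma jcont_near1 f t a b e : jcont f -> 0 < e -> exists2 d : R, 0 < d &
  forall s x, `|s - t| < d -> a <= x <= b -> `|f s x - f t x| <= e.
Proof.
move=> fc e0; have [d d0 dP] := @jcont_unif2 f t t a b e fc e0.
exists d => // s x st xab; apply: dP => //; first by rewrite !lexx.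
by rewrite subrr normr0.
Qed.

Lemma jcont_bounded f a b a' b' : jcont f -> exists2 M : R, 0 < M &
  forall t x, a <= t <= b -> a' <= x <= b' -> `|f t x| <= M.
Proof.
move=> fc.
have [t0 x0 tab xab|d d0 dP] := @rectangle_radius a b a' b' (fun d t x => `|f t x| <= d^-1).
  have [d d0 dP] := (jcontP f).1 fc t0 x0 1 ltr01.
  pose M := `|f t0 x0| + 1; have M0 : 0 < M by rewrite /M ltr_wpDl.
  exists (Num.min d M^-1); first by rewrite lt_min d0 invr_gt0.
  move=> s y e; rewrite !lt_min => /andP[st _] /andP[yx _] /andP[e0 /andP[_ eM]].
  apply: (@le_trans _ _ M); last by rewrite -(invrK M) lef_pV2 ?posrE ?invr_gt0 ?ltW.
  have := dP s y st yx; have := ler_normD (f s y - f t0 x0) (f t0 x0).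
  by rewrite subrK /M; lra.
by exists d^-1; rewrite ?invr_gt0.
Qed.

Definition xperiodic f := forall t, periodic (f t) 1.

Lemma jcont_near1_per f t e : jcont f -> xperiodic f -> 0 < e ->
  exists2 d : R, 0 < d & forall s x, `|s - t| < d -> `|f s x - f t x| <= e.
Proof.
move=> fc fp e0; have [d d0 dP] := @jcont_near1 f t 0 1 e fc e0.
exists d => // s x st; have [n /andP[n0 n1]] := periodic_repr x.
rewrite -(periodicZ n x (fp s)) -(periodicZ n x (fp t)).
by apply: dP => //; rewrite n0 ltW.
Qed.

Lemma jcont_unif2_per f a b e : jcont f -> xperiodic f -> 0 < e ->
  exists2 d : R, 0 < d & forall t x y, a <= t <= b -> `|y - x| < d ->
  `|f t y - f t x| <= e.
Proof.
move=> fc fp e0; have [d d0 dP] := @jcont_unif2 f a b 0 1 e fc e0.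
exists d => // t x y tab yx; have [n /andP[n0 n1]] := periodic_repr x.
rewrite -(periodicZ n x (fp t)) -(periodicZ n y (fp t)).
apply: dP => //; first by rewrite n0 ltW.
  by rewrite subrr normr0.
by rewrite opprD addrACA subrr addr0.
Qed.

Lemma jcont_bounded_per f a b : jcont f -> xperiodic f -> exists2 M : R, 0 < M &
  forall t x, a <= t <= b -> `|f t x| <= M.
Proof.
move=> fc fp; have [M M0 MP] := @jcont_bounded f a b 0 1 fc.
exists M => // t x tab; have [n /andP[n0 n1]] := periodic_repr x.
by rewrite -(periodicZ n x (fp t)); apply: MP => //; rewrite n0 ltW.
Qed.

Lemma jcont_lip f M : (forall t, continuous (f t)) ->
  (forall s t x, `|f s x - f t x| <= M * `|s - t|) -> jcont f.
Proof.
move=> fc fM; apply/jcontP => t x e e0.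
have e20 : 0 < e / 2 by lra.
have [d d0 dP] := (continuousRP (f t) x).1 (fc t x) (e / 2) e20.
pose M' := `|M| + 1; have M0 : 0 < M' by rewrite /M' ltr_wpDl.
exists (Num.min d (e / 2 / M')); first by rewrite lt_min d0 divr_gt0.
move=> s y; rewrite !lt_min => /andP[_ st] /andP[yx _].
have := dP y yx; have := fM s t y; have := ler_normD (f s y - f t y) (f t y - f t x).
rewrite addrA subrK => H1 H2 H3.
suff : M * `|s - t| <= e / 2 by lra.
apply: (@le_trans _ _ (M' * `|s - t|)).
  by rewrite ler_wpM2r // (le_trans (ler_norm _)) // /M' lerDl.
by rewrite mulrC -ler_pdivlMr // ltW.
Qed.

Lemma jcont_prim f : jcont f -> jcont (fun t x => prim (f t) x).
Proof.
move=> fc; apply/jcontP => t x e e0.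
have e20 : 0 < e / 2 by lra.
have pc := continuous_prim (jcont2 t fc).
have [d d0 dP] := (continuousRP (prim (f t)) x).1 (pc x) (e / 2) e20.
pose r := `|x| + 1; have r0 : 0 < r by rewrite /r ltr_wpDl.
have e' : 0 < e / 2 / r by rewrite divr_gt0.
have [d' d'0 d'P] := @jcont_near1 f t (- r) r _ fc e'.
exists (Num.min 1 (Num.min d d')); first by rewrite !lt_min ltr01 d0.
move=> s y; rewrite !lt_min => /andP[_ /andP[_ st]] /andP[yx1 /andP[yx _]].
have yr : `|y| <= r.
  by have := ler_normD (y - x) x; rewrite subrK /r; lra.
have H1 := dP y yx.
have H2 : `|prim (f s) y - prim (f t) y| <= e / 2.
  have fsc := jcont2 s fc; have ftc := jcont2 t fc.
  rewrite -primB //; apply: le_trans (_ : e / 2 / r * `|y| <= _); last first.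
    rewrite -[leRHS](@divfK _ r) ?gt_eqF // ler_wpM2l //; exact: ltW.
  apply: prim_bound; first exact: ctsB.
  by move=> z zy; apply: d'P => //; rewrite -ler_norml; exact: le_trans yr.
have := ler_normD (prim (f s) y - prim (f t) y) (prim (f t) y - prim (f t) x).
by rewrite addrA subrK; lra.
Qed.

Lemma jcont_prim_t f : jcont f -> jcont (fun t x => prim (f^~ x) t).
Proof. by move=> fc; exact: jcont_swap (jcont_prim (jcont_swap fc)). Qed.

(** Differentiation under the integral sign gives the exchange of the order of
    integration, the form in which it composes with integral equations. *)
Lemma prim_exchange h t x : jcont h ->
  prim (fun y => prim (h^~ y) t) x = prim (fun s => prim (h s) x) t.
Proof.
move=> hc; have pc := jcont1 x (jcont_prim hc).
have ptc s : continuous (fun y => prim (h^~ y) s).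
  exact: jcont2 (jcont_prim_t hc).
have E := @prim_unique R (fun s => prim (h s) x)
  (fun s => prim (fun y => prim (h^~ y) s) x) t pc.
have Z : prim (fun y => prim (h^~ y) 0) x = 0.
  have -> : (fun y => prim (h^~ y) 0) = (fun=> 0) by apply/funext => y; rewrite prim0.
  by rewrite prim_cst mul0r.
rewrite Z add0r in E; apply: E => {}t; apply/is_derive_epsP => e e0.
pose r := `|x| + 1; have r0 : 0 < r by rewrite /r ltr_wpDl.
have e' : 0 < e / r by rewrite divr_gt0.
have [d d0 dP] := @jcont_near1 h t (- `|x|) `|x| _ hc e'.
exists d => // s st.
have c1 := ptc s; have c2 := ptc t; have c3 := jcont2 t hc.
have c4 : continuous (fun y => (s - t) * h t y) := ctsM (@ctsC _ _ (s - t)) c3.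
rewrite -primB // -primZ // -primB //; last exact: ctsB.
apply: (@le_trans _ _ (e / r * `|s - t| * `|x|)); last first.
  rewrite mulrAC ler_wpM2r // mulrAC ler_pdivrMr // ler_wpM2l ?ltW //.
  by rewrite /r ltrDl.
apply: prim_bound; first by apply: ctsB => //; exact: ctsB.
move=> y yx.
have c5 := jcont1 y hc.
have [c cs ->] := @mean_value R (prim (h^~ y)) (h^~ y) t s
  (fun s => @is_derive_prim _ _ s c5).
rewrite mulrC -mulrBr normrM mulrC ler_wpM2r //.
apply: dP; first exact: le_lt_trans st.
by rewrite -ler_norml.
Qed.

(** The increment of w along the curve is a space increment at time s, to which
    the mean value theorem and the joint continuity of wx apply, plus a time
    increment at the fixed point eta t. *)
Lemma is_derive_along (w wx : R -> R -> R) (eta : R -> R) t d e : jcont wx ->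
  (forall s x, is_derive x 1 (w s) (wx s x)) ->
  is_derive t 1 (w^~ (eta t)) d -> is_derive t 1 eta e ->
  is_derive t 1 (fun s => w s (eta s)) (d + wx t (eta t) * e).
Proof.
move=> wxc wd d1 d2; apply/is_derive_epsP => r r0.
(* The error splits into three terms, each bounded by r / 3 times |s - t|;
   q and k bound the factors wx and eta' in the first two. *)
have r1 : 0 < r / 3 by lra.
pose q := `|wx t (eta t)| + 1; have q0 : 0 < q by rewrite /q ltr_wpDl.
pose k := `|e| + 1; have k0 : 0 < k by rewrite /k ltr_wpDl.
have [a a0 aP] := (is_derive_epsP (w^~ (eta t)) t d).1 d1 (r / 3) r1.
have rk : 0 < Num.min 1 (r / 3 / k) by rewrite lt_min ltr01 divr_gt0.
have rq : 0 < Num.min 1 (r / 3 / q) by rewrite lt_min ltr01 divr_gt0.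
have [b b0 bP] := (is_derive_epsP eta t e).1 d2 (Num.min 1 (r / 3 / q)) rq.
have [c c0 cP] := (jcontP wx).1 wxc t (eta t) _ rk.
have [g g0 gP] := (continuousRP eta t).1 (is_derive_continuous d2) (c / 2) ltac:(lra).
exists (Num.min (Num.min a b) (Num.min c g)); first by rewrite !lt_min a0 b0 c0.
move=> s; rewrite !lt_min => /andP[/andP[sa sb] /andP[sc sg]].
have [z zs zE] := @mean_value R (w s) (wx s) (eta t) (eta s) (wd s).
have H1 := aP s sa; have H2 := bP s sb; have H3 := gP s sg.
have H4 : `|wx s z - wx t (eta t)| <= Num.min 1 (r / 3 / k).
  have c2 : c / 2 < c by lra.
  by apply: cP => //; apply: le_lt_trans zs (le_lt_trans H3 c2).
have {H2}[H2 H2'] : `|eta s - eta t - (s - t) * e| <= `|s - t| /\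
    `|eta s - eta t - (s - t) * e| <= r / 3 / q * `|s - t|.
  by split; apply: le_trans H2 _; rewrite ?ler_piMl // ?ler_wpM2r // ge_min lexx ?orbT.
have H5 : `|eta s - eta t| <= k * `|s - t|.
  have := ler_normD (eta s - eta t - (s - t) * e) ((s - t) * e).
  by rewrite subrK normrM /k; lra.
have -> : w s (eta s) - w t (eta t) - (s - t) * (d + wx t (eta t) * e) =
  (wx s z - wx t (eta t)) * (eta s - eta t) +
  wx t (eta t) * (eta s - eta t - (s - t) * e) +
  (w s (eta t) - w t (eta t) - (s - t) * d).
  have -> : w s (eta s) = w s (eta t) + wx s z * (eta s - eta t) by rewrite -zE; lra.
  by ring.
have T1 : `|(wx s z - wx t (eta t)) * (eta s - eta t)| <= r / 3 * `|s - t|.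
  rewrite normrM; apply: le_trans (ler_pM _ _ H4 H5) _ => //.
  rewrite mulrA ler_wpM2r // -ler_pdivlMr // ge_min lexx orbT //.
have T2 : `|wx t (eta t) * (eta s - eta t - (s - t) * e)| <= r / 3 * `|s - t|.
  rewrite normrM; apply: (@le_trans _ _ (q * (r / 3 / q * `|s - t|))).
    by apply: ler_pM => //; rewrite /q lerDl.
  by rewrite mulrA mulrC [q * _]mulrC divfK ?gt_eqF // mulrC.
apply: le_trans (ler_normD _ _) _.
have := ler_normD ((wx s z - wx t (eta t)) * (eta s - eta t))
  (wx t (eta t) * (eta s - eta t - (s - t) * e)).
by lra.
Qed.

End joint_continuity.
Arguments jcont1 {R f} x _ _.
Arguments jcont2 {R f} t _ _.

(** * Gronwall inequality and Picard iteration *)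

Section gronwall_picard.
Context {R : realType}.
Implicit Types (a b c d e s t x T M L : R).

Lemma pow2_small (a e : R) : 0 < e -> exists n, a / 2 ^+ n <= e.
Proof.
move=> e0; have [n nP] : exists n : nat, `|a| / e < n%:R.
  by exists (Num.bound (`|a| / e)); apply: archi_boundP; rewrite divr_ge0 // ltW.
have n2 : (n%:R : R) <= 2 ^+ n.
  by rewrite -natrX ler_nat; apply: ltnW; exact: ltn_expl.
exists n; rewrite ler_pdivrMr ?exprn_gt0 //; apply: le_trans (ler_norm a) _.
move: nP; rewrite ltr_pdivrMr // => nP; apply/ltW/(lt_le_trans nP).
by rewrite mulrC ler_wpM2l // ltW.
Qed.

Lemma le_geometric (x y a : R) : (forall n, x <= y + a / 2 ^+ n) -> x <= y.
Proof.
move=> H; rewrite leNgt; apply/negP => yx.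
have xy : 0 < (x - y) / 2 by lra.
have [n nP] := pow2_small a xy; have := H n; lra.
Qed.

Definition weight L t : R := expR (2 * L * t).

Lemma weight_ge1 L t : 0 <= L -> 0 <= t -> 1 <= weight L t.
Proof.
move=> L0 t0; rewrite /weight -expR0 ler_expR; by rewrite !mulr_ge0.
Qed.

Lemma weight_le L s t : 0 <= L -> s <= t -> weight L s <= weight L t.
Proof. by move=> L0 st; rewrite /weight ler_expR ler_wpM2l // mulr_ge0. Qed.

(** The weight absorbs the length of the time interval: integrating
    L * weight gains a factor one half. *)
Lemma prim_weight (f : R -> R) A L c t : continuous f -> 0 <= A -> 0 <= t ->
  (forall s, 0 <= s <= t -> `|f s| <= L * (A * weight L s) + c) ->
  `|prim f t| <= A / 2 * weight L t + c * t.
Proof.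
move=> fc A0 t0 fb.
have D s : is_derive s 1 (fun s => A / 2 * weight L s + c * s)
    (L * (A * weight L s) + c).
  have D1 : is_derive s 1 (fun s : R => 2 * L * s) (2 * L).
    by rewrite -[X in is_derive _ _ _ X]mulr1; exact: is_deriveZ.
  have D2 : is_derive s 1 (weight L) (weight L s * (2 * L)).
    exact: (@is_derive1_comp R expR (fun s => 2 * L * s)).
  have -> : L * (A * weight L s) + c = A / 2 * (weight L s * (2 * L)) + c * 1.
    by rewrite mulr1; field.
  by apply: is_deriveD; exact: is_deriveZ.
apply: le_trans (prim_le_itv fc D t0 fb) _.
have w0 : 0 <= weight L 0 := expR_ge0 _.
have : 0 <= A / 2 * weight L 0 by rewrite mulr_ge0 // divr_ge0.
by lra.
Qed.

(** A bound A * weight L t improves to (d0 + c T + A / 2) * weight L t by the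
    integral equation; iterating leads to the fixed point A = 2 (d0 + c T). *)
Lemma gronwall (I : Type) (f h : R -> I -> R) L c d0 A0 T : 0 <= L -> 0 <= c ->
  0 <= d0 ->
  (forall t i, 0 <= t <= T -> `|f t i| <= A0) ->
  (forall i, continuous (h^~ i)) ->
  (forall t i, 0 <= t <= T -> f t i = f 0 i + prim (h^~ i) t) ->
  (forall i, `|f 0 i| <= d0) ->
  (forall t d, 0 <= t <= T -> (forall j, `|f t j| <= d) ->
     forall i, `|h t i| <= L * d + c) ->
  forall t i, 0 <= t <= T -> `|f t i| <= 2 * (d0 + c * T) * weight L t.
Proof.
move=> L0 c0 d00 fA hc fE f0 hf t i tT.
have T0 : 0 <= T by case/andP: tT; lra.
have cT0 : 0 <= c * T by rewrite mulr_ge0.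
have fA0 t' i' : 0 <= t' <= T -> `|f t' i'| <= `|A0|.
  by move=> t'T; apply: le_trans (fA _ _ t'T) (ler_norm _).
have A n : forall t i, 0 <= t <= T ->
    `|f t i| <= (2 * (d0 + c * T) + `|A0| / 2 ^+ n) * weight L t.
  elim: n => [|n IH] {}t {}i {}tT; have /andP[t0 tT'] := tT.
    rewrite expr0 divr1; have := fA0 t i tT; have := weight_ge1 L0 t0 => w1 h1.
    apply: le_trans h1 _; apply: le_trans (_ : (2 * (d0 + c * T) + `|A0|) * 1 <= _).
      by rewrite mulr1 lerDr; lra.
    by rewrite ler_wpM2l // addr_ge0 //; lra.
  set An := 2 * (d0 + c * T) + `|A0| / 2 ^+ n.
  have An0 : 0 <= An by rewrite addr_ge0 // ?divr_ge0 ?exprn_ge0 //; lra.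
  have H : `|prim (h^~ i) t| <= An / 2 * weight L t + c * t.
    apply: prim_weight => // s /andP[s0 st].
    have sT : 0 <= s <= T by rewrite s0 (le_trans st).
    by apply: hf => // j; exact: IH.
  rewrite fE //; apply: le_trans (ler_normD _ _) _; have := f0 i.
  have -> : 2 * (d0 + c * T) + `|A0| / 2 ^+ n.+1 = (d0 + c * T) + An / 2.
    by rewrite /An exprS; field; rewrite expf_neq0.
  have : c * t <= c * T by rewrite ler_wpM2l.
  have : (d0 + c * T) * 1 <= (d0 + c * T) * weight L t.
    by rewrite ler_wpM2l ?weight_ge1 //; lra.
  by rewrite mulrDl; lra.
apply: (@le_geometric _ _ (`|A0| * weight L t)) => n.
by have := A n t i tT; rewrite mulrDl [`|A0| / _ * _]mulrAC.
Qed.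

Definition clamp T t : R := Num.max 0 (Num.min T t).

Lemma clamp_itv T t : 0 <= T -> 0 <= clamp T t <= T.
Proof.
by move=> T0; rewrite /clamp le_max lexx /= ge_max T0 ge_min lexx.
Qed.

Lemma clamp_id T t : 0 <= t <= T -> clamp T t = t.
Proof. by move=> /andP[t0 tT]; rewrite /clamp min_r // max_r. Qed.

Lemma clamp_lip T s t : `|clamp T s - clamp T t| <= `|s - t|.
Proof.
have := ler_norm (s - t); have := ler_norm (t - s); rewrite [`|t - s|]distrC.
rewrite ler_norml /clamp /Num.max /Num.min; move: `|s - t| => r.
by (repeat case: ifPn); rewrite -?leNgt => *; apply/andP; split; lra.
Qed.

Lemma continuous_clamp T : continuous (clamp T).
Proof.
move=> t; apply/continuousRP => e e0; exists e => // s st.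
exact: le_trans (clamp_lip T s t) (ltW st).
Qed.

(** The intervals of centre u n and radius 2 C / 2 ^ n are nested. *)
Lemma geometric_limit (u : nat -> R) C :
  (forall n, `|u n.+1 - u n| <= C / 2 ^+ n) ->
  {l | forall n, `|u n - l| <= 2 * C / 2 ^+ n}.
Proof.
move=> uC; pose r n : R := 2 * C / 2 ^+ n.
have rS n : r n.+1 = r n - C / 2 ^+ n.
  by rewrite /r exprS; field; rewrite expf_neq0.
pose lo n := u n - r n; pose up n := u n + r n.
have loS n : lo n <= lo n.+1.
  by rewrite /lo rS; have := uC n; rewrite ler_norml; lra.
have upS n : up n.+1 <= up n.
  by rewrite /up rS; have := uC n; rewrite ler_norml; lra.
have loM m n : (m <= n)%N -> lo m <= lo n.
  exact: (@homo_leq _ lo (fun a b => a <= b) (@lexx _ _) (@le_trans _ _) loS).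
have upM m n : (m <= n)%N -> up n <= up m.
  have tr : transitive (fun a b : R => b <= a) by move=> a b c ba cb; exact: le_trans ba.
  exact: (@homo_leq _ up (fun a b => b <= a) (@lexx _ _) tr upS).
have r0 n : 0 <= r n.
  have := uC 0; rewrite expr0 divr1 => /(le_trans (normr_ge0 _)) C0.
  by rewrite /r !mulr_ge0 // invr_ge0 exprn_ge0.
have lu m n : lo m <= up n.
  apply: le_trans (loM _ _ (leq_maxl m n)) (le_trans _ (upM _ _ (leq_maxr m n))).
  by rewrite /lo /up; have := r0 (maxn m n); lra.
have hs : has_sup (range lo).
  by split; [exists (lo 0), 0|exists (up 0) => _ [n _ <-]].
exists (sup (range lo)) => n; rewrite -/(r n).
have h1 : lo n <= sup (range lo) by apply: ub_le_sup; [case: hs|exists n].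
have h2 : sup (range lo) <= up n.
  by apply: ge_sup; [case: hs|move=> _ [m _ <-]].
by move: h1 h2; rewrite /lo /up ler_norml; lra.
Qed.

Section picard.
Variables (I : Type) (N : R -> (I -> R) -> I -> R) (B : set (I -> R)).
Variables (y0 : I -> R) (M L T : R).
Hypotheses (M0 : 0 <= M) (L0 : 0 <= L) (T0 : 0 <= T).

(** Curves live on the whole line, which keeps one-sided limits out of the
    continuity hypotheses; the iteration freezes them outside [0, T]. *)
Definition curve_in (y : R -> I -> R) :=
  (forall t, B (y t)) /\ (forall s t i, `|y s i - y t i| <= M * `|s - t|).

Hypothesis B0 : B y0.
Hypothesis Ncont : forall y, curve_in y -> forall i, continuous (fun s => N s (y s) i).
Hypothesis Nbound : forall t y i, B y -> `|N t y i| <= M.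
Hypothesis Nlip : forall t y z d, B y -> B z ->
  (forall j, `|y j - z j| <= d) -> forall i, `|N t y i - N t z i| <= L * d.
Hypothesis Binv : forall y t, curve_in y -> 0 <= t <= T ->
  B (fun i => y0 i + prim (fun s => N s (y s) i) t).
Hypothesis Bclosed : forall (z : nat -> I -> R) zl, (forall n, B (z n)) ->
  (forall e, 0 < e -> exists n, forall i, `|z n i - zl i| <= e) -> B zl.

Let step (y : R -> I -> R) t i := y0 i + prim (fun s => N s (y s) i) (clamp T t).
Let z n := iter n step (fun _ => y0).

Let cI t : 0 <= clamp T t <= T := clamp_itv t T0.

Let step_curve y : curve_in y -> curve_in (step y).
Proof.
move=> yc; split=> [t|s t i]; first exact: Binv.
rewrite /step opprD addrACA subrr add0r.
have := @prim_lip R _ M (clamp T t) (clamp T s) (@Ncont _ yc i).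
move=> H; apply: le_trans (H _) _; first by move=> r _; apply: Nbound; case: yc.
by rewrite ler_wpM2l // clamp_lip.
Qed.

Let z_curve n : curve_in (z n).
Proof.
elim: n => [|n IH]; first by split=> // s t i; rewrite subrr normr0 mulr_ge0.
exact: step_curve.
Qed.

Let step_contract y1 y2 A : 0 <= A -> curve_in y1 -> curve_in y2 ->
  (forall t i, `|y1 t i - y2 t i| <= A * weight L (clamp T t)) ->
  forall t i, `|step y1 t i - step y2 t i| <= A / 2 * weight L (clamp T t).
Proof.
move=> A0 c1 c2 y12 t i; rewrite /step opprD addrACA subrr add0r.
have N1 := @Ncont _ c1 i; have N2 := @Ncont _ c2 i.
have /andP[t0 tT] := cI t.
rewrite -primB //; have := @prim_weight (fun s => N s (y1 s) i - N s (y2 s) i)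
  A L 0 (clamp T t).
rewrite mul0r addr0; apply => //; first exact: ctsB.
move=> s /andP[s0 st]; rewrite addr0; apply: Nlip; [by case: c1|by case: c2|].
by move=> j; have := y12 s j; rewrite clamp_id // s0 (le_trans st).
Qed.

Let C := M * T * weight L T.

Let z_cauchy n t i : `|z n.+1 t i - z n t i| <= C / 2 ^+ n.
Proof.
have H : forall t i, `|z n.+1 t i - z n t i| <= M * T / 2 ^+ n * weight L (clamp T t).
  elim: n => [|n IH] {}t {}i.
    rewrite expr0 divr1 /z /= /step addrAC subrr add0r.
    have /andP[t0 tT] := cI t.
    apply: le_trans (_ : M * `|clamp T t| <= _).
      apply: prim_bound; first exact: (@Ncont _ (z_curve 0) i).
      by move=> s _; exact: Nbound.
    rewrite ger0_norm // -[leLHS]mulr1; apply: ler_pM; rewrite ?mulr_ge0 //.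
      by rewrite ler_wpM2l.
    exact: weight_ge1.
  have -> : M * T / 2 ^+ n.+1 = M * T / 2 ^+ n / 2.
    by rewrite exprS; field; rewrite expf_neq0.
  apply: (step_contract _ (z_curve n.+1) (z_curve n) IH).
  by rewrite divr_ge0 ?mulr_ge0 // exprn_ge0.
apply: le_trans (H t i) _; rewrite /C mulrAC ler_wpM2r ?invr_ge0 ?exprn_ge0 //.
by rewrite ler_wpM2l ?mulr_ge0 // weight_le //; case/andP: (cI t).
Qed.

(** In the norm weighted by weight L one step is a contraction with factor one
    half, whatever the length of the interval: a restriction on T can only come
    from the invariance of B. *)
Theorem picard : exists2 y, curve_in y & forall t i, 0 <= t <= T ->
  y t i = y0 i + prim (fun s => N s (y s) i) t.
Proof.
pose y t i := sval (geometric_limit (fun n => z_cauchy n t i)).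
have yz n t i : `|z n t i - y t i| <= 2 * C / 2 ^+ n.
  exact: (svalP (geometric_limit (fun n => z_cauchy n t i))).
have yc : curve_in y.
  split=> [t|s t i].
    apply: (@Bclosed (fun n => z n t)) => [n|e e0]; first by case: (z_curve n).
    have [n nP] := pow2_small (2 * C) e0; exists n => i; exact: le_trans nP.
  apply: (@le_geometric _ _ (4 * C)) => n.
  have [_ /(_ s t i) H] := z_curve n; have H1 := yz n s i; have H2 := yz n t i.
  have -> : 4 * C / 2 ^+ n = 2 * C / 2 ^+ n + 2 * C / 2 ^+ n by lra.
  by move: H H1 H2; rewrite !ler_norml => /andP[? ?] /andP[? ?] /andP[? ?];
    apply/andP; split; lra.
exists y => // t i tT.
suff : `|y t i - step y t i| <= 0.
  by rewrite normr_le0 subr_eq0 /step clamp_id // => /eqP.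
have C0 : 0 <= C by rewrite /C !mulr_ge0 // expR_ge0.
apply: (@le_geometric _ _ (2 * C / 2 + C * weight L T)) => n; rewrite add0r.
have A0 : 0 <= 2 * C / 2 ^+ n.
  by apply: divr_ge0; [exact: mulr_ge0|exact: exprn_ge0].
have H1 := yz n.+1 t i.
have H2 : `|step (z n) t i - step y t i| <= 2 * C / 2 ^+ n / 2 * weight L (clamp T t).
  apply: step_contract => // {}t' j; apply: le_trans (yz n t' j) _.
  rewrite -[leLHS]mulr1 ler_wpM2l // weight_ge1 //.
  by case/andP: (cI t').
have H3 : weight L (clamp T t) <= weight L T.
  by rewrite weight_le //; case/andP: (cI t).
have {}H2 : `|z n.+1 t i - step y t i| <= C / 2 ^+ n * weight L T.
  apply: le_trans H2 _; have -> : 2 * C / 2 ^+ n / 2 = C / 2 ^+ n by lra.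
  by rewrite ler_wpM2l // divr_ge0 // exprn_ge0.
have -> : (2 * C / 2 + C * weight L T) / 2 ^+ n =
  2 * C / 2 ^+ n.+1 + C / 2 ^+ n * weight L T.
  by rewrite exprS; field; rewrite expf_neq0.
rewrite distrC in H1.
apply: le_trans (lerD H1 H2); rewrite -[X in `|X| <= _](subrKA (z n.+1 t i)).
exact: ler_normD.
Qed.

End picard.
End gronwall_picard.

(** * The Lagrangian system *)

Section lagrangian_system.
Context {R : realType}.
Variable q : nat.
Implicit Types (a b c d e s t x T M L K C : R).

(** For a velocity u on the circle and its flow map eta of the field u ^ p, where
    p = q.+1, the coordinates of a state are b = eta(0), a = u(eta(0)) and, at
    each label x, J = eta_x, Q = u_x(eta) J and E = u_x(eta) ^ 2 J.  A single
    index type makes the sup norm of a state a supremum over one family. *)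
Inductive coord := Lb | La | LQ of R | LJ of R | LE of R.
Definition state := coord -> R.
Implicit Types (y z : state).

(** U_x = u_x(eta) eta_x = Q: the velocity need not be a coordinate, and it is
    differentiable in the label by construction. *)
Definition lagU y x := y La + prim (fun x => y (LQ x)) x.
Definition lagk y x := q.+1%:R * lagU y x ^+ q.
Definition lagm y := prim (fun x => lagk y x * y (LE x)) 1.
Definition lagg y x := lagk y x * y (LE x) - lagm y * y (LJ x).
Definition lagG y x := prim (lagg y) x.
(** Half of the zero-mean primitive of (u ^ p)_x u_x at eta(x): zero mean on the
    circle means zero mean for the density J in labels. *)
Definition lagV y x := 2^-1 * (lagG y x - prim (fun x => lagG y x * y (LJ x)) 1).

Definition lagN y i := match i with
  | Lb => y La ^+ q.+1
  | La => lagV y 0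
  | LQ x => 2^-1 * lagg y x
  | LJ x => lagk y x * y (LQ x)
  | LE x => - (lagm y * y (LQ x))
  end.

(** The last two conditions make U periodic and eta a map of degree one. *)
Record adm K y : Prop := Adm {
  adm_le : forall i, `|y i| <= K;
  adm_cQ : continuous (fun x => y (LQ x));
  adm_cJ : continuous (fun x => y (LJ x));
  adm_cE : continuous (fun x => y (LE x));
  adm_pQ : periodic (fun x => y (LQ x)) 1;
  adm_pJ : periodic (fun x => y (LJ x)) 1;
  adm_pE : periodic (fun x => y (LE x)) 1;
  adm_mQ : prim (fun x => y (LQ x)) 1 = 0;
  adm_mJ : prim (fun x => y (LJ x)) 1 = 1 }.

(** All the coefficients of the system are built from coordinates by operations
    that preserve this property, so that no constant is ever computed.  The same
    C serves as bound and as Lipschitz constant for brevity. *)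
Record tame K (f : state -> R -> R) C : Prop := Tame {
  tame_ge0 : 0 <= C;
  tame_cts : forall y, adm K y -> continuous (f y);
  tame_per : forall y, adm K y -> periodic (f y) 1;
  tame_le : forall y, adm K y -> forall x, `|f y x| <= C;
  tame_lip : forall y z d, adm K y -> adm K z -> (forall i, `|y i - z i| <= d) ->
    forall x, `|f y x - f z x| <= C * d }.

Lemma tame_cst K c : tame K (fun _ _ => c) `|c|.
Proof.
split=> // [y _|y z d _ _ yz x]; first exact: ctsC.
by rewrite subrr normr0 mulr_ge0 // (le_trans _ (yz La)).
Qed.

Lemma tame_coord K (g : R -> coord) : 0 <= K ->
  (forall y, adm K y -> continuous (fun x => y (g x))) ->
  (forall y, adm K y -> periodic (fun x => y (g x)) 1) ->
  tame K (fun y x => y (g x)) (K + 1).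
Proof.
move=> K0 gc gp; split=> // [|y yK x|y z d yK zK yz x]; first lra.
  by have := adm_le yK (g x); lra.
have d0 : 0 <= d by apply: le_trans (yz La).
apply: le_trans (yz _) _; nra.
Qed.

Lemma tameD K f g Cf Cg : tame K f Cf -> tame K g Cg ->
  tame K (fun y x => f y x + g y x) (Cf + Cg).
Proof.
move=> [f0 fc fp fb fl] [g0 gc gp gb gl]; split=> [|y yK|y yK x|y yK x|y z d yK zK yz x].
- exact: addr_ge0.
- by apply: ctsD; [exact: fc|exact: gc].
- by rewrite fp // gp.
- by apply: le_trans (ler_normD _ _) _; rewrite lerD // ?fb ?gb.
- rewrite opprD addrACA mulrDl; apply: le_trans (ler_normD _ _) _.
  by rewrite lerD // ?fl ?gl.
Qed.

Lemma tameM K f g Cf Cg : tame K f Cf -> tame K g Cg ->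
  tame K (fun y x => f y x * g y x) (2 * (Cf * Cg)).
Proof.
move=> [f0 fc fp fb fl] [g0 gc gp gb gl].
have fg0 : 0 <= Cf * Cg by rewrite mulr_ge0.
split=> [|y yK|y yK x|y yK x|y z d yK zK yz x].
- exact: mulr_ge0.
- by apply: ctsM; [exact: fc|exact: gc].
- by rewrite fp // gp.
- rewrite normrM; apply: (@le_trans _ _ (Cf * Cg)); last lra.
  by rewrite ler_pM // ?fb ?gb.
- have -> : f y x * g y x - f z x * g z x =
    (f y x - f z x) * g y x + f z x * (g y x - g z x) by ring.
  apply: le_trans (ler_normD _ _) _; rewrite !normrM.
  have -> : 2 * (Cf * Cg) * d = Cf * d * Cg + Cf * (Cg * d) by ring.
  by rewrite lerD // ler_pM // ?fl ?gb ?fb ?gl.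
Qed.

Lemma tameX K f C n : tame K f C -> exists C', tame K (fun y x => f y x ^+ n) C'.
Proof.
move=> fT; elim: n => [|n [C' IH]].
  by exists `|1|; exact: (tame_cst K 1).
exists (2 * (C * C')); have := tameM fT IH.
by congr tame; apply/funext => y; apply/funext => x; rewrite exprS.
Qed.

Lemma tame_mean K f C : tame K f C -> tame K (fun y _ => prim (f y) 1) C.
Proof.
move=> [f0 fc fp fb fl]; split=> // [y yK|y yK x|y z d yK zK yz x].
- exact: ctsC.
- have := @prim_bound _ (f y) C 1 (fc y yK) (fun s _ => fb y yK s).
  by rewrite normr1 mulr1.
- have c1 := fc y yK; have c2 := fc z zK.
  rewrite -primB //; have := @prim_bound _ (fun s => f y s - f z s) (C * d) 1.
  by rewrite normr1 mulr1; apply; [exact: ctsB|move=> s _; exact: fl].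
Qed.

Lemma tame_prim K f C : (forall y, adm K y -> prim (f y) 1 = 0) ->
  tame K f C -> tame K (fun y x => prim (f y) x) C.
Proof.
move=> fm [f0 fc fp fb fl]; split=> // [y yK|y yK x|y yK x|y z d yK zK yz x].
- exact/continuous_prim/fc.
- by rewrite prim_periodic ?fm ?addr0 //; [exact: fc|exact: fp].
- by apply: prim_mean0_bound; [exact: fc|exact: fp|exact: fm|exact: fb].
- have c1 := fc y yK; have c2 := fc z zK.
  rewrite -primB //; apply: (@prim_mean0_bound _ (fun s => f y s - f z s)).
  + exact: ctsB.
  + by move=> s; rewrite fp // fp.
  + by rewrite primB // !fm // subrr.
  + by move=> s; exact: fl.
Qed.

Section coefficients.
Variable K : R.
Hypothesis K0 : 0 <= K.

Lemma tame_a : tame K (fun y _ => y La) (K + 1).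
Proof. by apply: (@tame_coord K (fun=> La)) => // y _; exact: ctsC. Qed.

Lemma tame_Q : tame K (fun y x => y (LQ x)) (K + 1).
Proof. by apply: tame_coord => // y yK; [exact: (adm_cQ yK)|exact: (adm_pQ yK)]. Qed.

Lemma tame_J : tame K (fun y x => y (LJ x)) (K + 1).
Proof. by apply: tame_coord => // y yK; [exact: (adm_cJ yK)|exact: (adm_pJ yK)]. Qed.

Lemma tame_E : tame K (fun y x => y (LE x)) (K + 1).
Proof. by apply: tame_coord => // y yK; [exact: (adm_cE yK)|exact: (adm_pE yK)]. Qed.

Lemma tame_U : exists C, tame K lagU C.
Proof.
eexists; apply: tameD tame_a (tame_prim _ tame_Q) => y yK; exact: adm_mQ yK.
Qed.

Lemma tame_k : exists C, tame K lagk C.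
Proof.
have [C UC] := tame_U; have [C' UC'] := tameX q UC.
by eexists; exact: tameM (tame_cst K _) UC'.
Qed.

Lemma tame_m : exists C, tame K (fun y _ => lagm y) C.
Proof. by have [C kC] := tame_k; eexists; exact: tame_mean (tameM kC tame_E). Qed.

Lemma tameZ f c : (exists C, tame K f C) -> exists C, tame K (fun y x => c * f y x) C.
Proof. by move=> [C fC]; eexists; exact: tameM (tame_cst K c) fC. Qed.

Lemma tameN f : (exists C, tame K f C) -> exists C, tame K (fun y x => - f y x) C.
Proof.
move=> /(tameZ (-1)) [C fC]; exists C; move: fC.
by congr tame; apply/funext => y; apply/funext => x; rewrite mulN1r.
Qed.

Lemma tame_g : exists C, tame K lagg C.
Proof.
have [C kC] := tame_k; have [C' mC] := tame_m.
have [C2 mJ] := tameN (ex_intro _ _ (tameM mC tame_J)).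
by eexists; exact: tameD (tameM kC tame_E) mJ.
Qed.

Lemma prim_lagg y : adm K y -> prim (lagg y) 1 = 0.
Proof.
move=> yK; have [C kC] := tame_k.
have kEc : continuous (fun x => lagk y x * y (LE x)).
  by apply: ctsM; [exact: tame_cts kC _ yK|exact: adm_cE yK].
have Jc := adm_cJ yK.
rewrite /lagg primB //; last exact: ctsM (@ctsC _ _ (lagm y)) Jc.
by rewrite primZ // (adm_mJ yK) mulr1 subrr.
Qed.

Lemma tame_G : exists C, tame K lagG C.
Proof. by have [C gC] := tame_g; eexists; exact: tame_prim prim_lagg gC. Qed.

Lemma tame_V : exists C, tame K lagV C.
Proof.
have [C GC] := tame_G.
have [C2 GJ] := tameN (ex_intro _ _ (tame_mean (tameM GC tame_J))).
exact: tameZ (ex_intro _ _ (tameD GC GJ)).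
Qed.

Lemma is_derive_lagU y x : adm K y -> is_derive x 1 (lagU y) (y (LQ x)).
Proof.
move=> yK; rewrite -[y (LQ x)]add0r; have := @is_derive_prim _ _ x (adm_cQ yK).
by move=> ?; exact: is_deriveD.
Qed.

Lemma is_derive_lagUX y x : adm K y ->
  is_derive x 1 (fun x => lagU y x ^+ q.+1) (lagk y x * y (LQ x)).
Proof.
by move=> yK; exact: is_derive_pow (is_derive_lagU x yK).
Qed.

Lemma lagU_periodic y : adm K y -> periodic (lagU y) 1.
Proof. by move=> yK; have [C UC] := tame_U; exact: tame_per UC _ yK. Qed.

Lemma prim_kQ y x : adm K y ->
  lagU y x ^+ q.+1 = lagU y 0 ^+ q.+1 + prim (fun x => lagk y x * y (LQ x)) x.
Proof.
move=> yK; have [C kC] := tame_k.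
apply: (@prim_unique _ _ (fun x => lagU y x ^+ q.+1)) => [|s].
  by apply: ctsM; [exact: tame_cts kC _ yK|exact: adm_cQ yK].
exact: is_derive_lagUX.
Qed.

Lemma prim_kQ1 y : adm K y -> prim (fun x => lagk y x * y (LQ x)) 1 = 0.
Proof.
move=> yK; have := prim_kQ 1 yK.
by rewrite -[X in lagU y X ^+ _ = _]add0r lagU_periodic //; lra.
Qed.

Lemma tameW f C C' : C <= C' -> tame K f C -> tame K f C'.
Proof.
move=> CC' [f0 fc fp fb fl]; split=> // [|y yK x|y z d yK zK yz x].
- exact: le_trans CC'.
- exact: le_trans (fb y yK x) CC'.
- apply: le_trans (fl y z d yK zK yz x) _; rewrite ler_wpM2r //.
  exact: le_trans (yz La).
Qed.

Lemma tame_lagN (g : R -> coord) : ((g = fun=> Lb) \/ (g = fun=> La)) \/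
  (g = LQ \/ g = LJ \/ g = LE) -> exists C, tame K (fun y x => lagN y (g x)) C.
Proof.
have [Ck kC] := tame_k; have [Cg gC] := tame_g; have [Cm mC] := tame_m.
move=> [[]|[|[]]] ->.
- exact: tameX tame_a.
- have [C VC] := tame_V; exists C; case: VC => V0 Vc Vp Vb Vl.
  split=> [|y yK|y yK x|y yK x|y z d yK zK yz x].
  - exact: V0.
  - exact: ctsC.
  - by [].
  - exact: Vb.
  - exact: Vl.
- exact: tameZ (ex_intro _ _ gC).
- by eexists; exact: tameM kC tame_Q.
- exact: tameN (ex_intro _ _ (tameM mC tame_Q)).
Qed.

(** This is all that Picard iteration and the Gronwall estimate use of the
    vector field, and the constant depends on K and q alone. *)
Lemma lagN_constant : exists C, [/\ 0 <= C,
  forall y i, adm K y -> `|lagN y i| <= C &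
  forall y z d, adm K y -> adm K z -> (forall i, `|y i - z i| <= d) ->
    forall i, `|lagN y i - lagN z i| <= C * d].
Proof.
have [C1 T1] := @tame_lagN (fun=> Lb) (or_introl (or_introl erefl)).
have [C2 T2] := @tame_lagN (fun=> La) (or_introl (or_intror erefl)).
have [C3 T3] := @tame_lagN LQ (or_intror (or_introl erefl)).
have [C4 T4] := @tame_lagN LJ (or_intror (or_intror (or_introl erefl))).
have [C5 T5] := @tame_lagN LE (or_intror (or_intror (or_intror erefl))).
have p1 := tame_ge0 T1; have p2 := tame_ge0 T2; have p3 := tame_ge0 T3.
have p4 := tame_ge0 T4; have p5 := tame_ge0 T5.
pose C := C1 + C2 + C3 + C4 + C5.
have l1 : C1 <= C by rewrite /C; lra.
have {}T1 := tameW l1 T1.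
have l2 : C2 <= C by rewrite /C; lra.
have {}T2 := tameW l2 T2.
have l3 : C3 <= C by rewrite /C; lra.
have {}T3 := tameW l3 T3.
have l4 : C4 <= C by rewrite /C; lra.
have {}T4 := tameW l4 T4.
have l5 : C5 <= C by rewrite /C; lra.
have {}T5 := tameW l5 T5.
exists C; split=> [|y i yK|y z d yK zK yz i]; first by rewrite /C; lra.
  case: i => [||x|x|x].
  - exact: (tame_le T1 yK 0).
  - exact: (tame_le T2 yK 0).
  - exact: (tame_le T3 yK x).
  - exact: (tame_le T4 yK x).
  - exact: (tame_le T5 yK x).
case: i => [||x|x|x].
- exact: (tame_lip T1 yK zK yz 0).
- exact: (tame_lip T2 yK zK yz 0).
- exact: (tame_lip T3 yK zK yz x).
- exact: (tame_lip T4 yK zK yz x).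
- exact: (tame_lip T5 yK zK yz x).
Qed.

Lemma tame_jcont f M (y : R -> state) : (exists C, tame K f C) ->
  (forall t, adm K (y t)) -> (forall s t i, `|y s i - y t i| <= M * `|s - t|) ->
  jcont (fun t x => f (y t) x).
Proof.
move=> [C fC] yK yM; apply: (@jcont_lip _ _ (C * M)) => [t|s t x].
  exact: tame_cts fC _ (yK t).
by rewrite -mulrA; apply: (tame_lip fC) => // i; exact: yM.
Qed.

End coefficients.

End lagrangian_system.

(** * Solutions of the Lagrangian system *)

Section lagrangian_flow.
Context {R : realType}.
Variable q : nat.
Implicit Types (a b c d e s t x T M L K C : R) (y z : state (R := R)).
Local Notation lagN := (@lagN R q).

Record lag_sol K T (y : R -> state (R := R)) : Prop := LagSol {
  lag_adm : forall t, adm K (y t);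
  lag_lip : exists M, forall s t i, `|y s i - y t i| <= M * `|s - t|;
  lag_eq : forall t i, 0 <= t <= T -> y t i = y 0 i + prim (fun s => lagN (y s) i) t }.

Lemma adm_closed K (z : nat -> state) y : (forall n, adm K (z n)) ->
  (forall e, 0 < e -> exists n, forall i, `|z n i - y i| <= e) -> adm K y.
Proof.
move=> zK zy.
have cts (g : R -> coord) : (forall n, continuous (fun x => z n (g x))) ->
    continuous (fun x => y (g x)).
  move=> zc x; apply/continuousRP => e e0; have e3 : 0 < e / 3 by lra.
  have [n nP] := zy _ e3; have [d d0 dP] := (continuousRP _ x).1 (zc n x) _ e3.
  exists d => // x' x'd; move: (dP x' x'd) (nP (g x)) (nP (g x')).
  by rewrite !ler_norml => /andP[? ?] /andP[? ?] /andP[? ?]; apply/andP; split; lra.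
have small (u v : R) : (forall e, 0 < e -> `|u - v| <= e) -> u = v.
  move=> H; apply/eqP; rewrite -subr_eq0 -normr_le0; apply/ler_addgt0Pl => e e0.
  by rewrite addr0; exact: H.
have per (g : R -> coord) : (forall n, periodic (fun x => z n (g x)) 1) ->
    periodic (fun x => y (g x)) 1.
  move=> zp x; apply: small => e e0; have e2 : 0 < e / 2 by lra.
  have [n nP] := zy _ e2; have := nP (g x); have := nP (g (x + 1)).
  rewrite zp !ler_norml => /andP[? ?] /andP[? ?].
  by apply/andP; split; lra.
have mean (g : R -> coord) c : (forall n, continuous (fun x => z n (g x))) ->
    (forall n, prim (fun x => z n (g x)) 1 = c) -> prim (fun x => y (g x)) 1 = c.
  move=> zc zm; apply: small => e e0; have [n nP] := zy _ e0.
  have yc := cts g zc; have znc := zc n.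
  rewrite -(zm n) distrC -primB //.
  have := @prim_bound _ (fun x => z n (g x) - y (g x)) e 1; rewrite normr1 mulr1.
  by apply; [exact: ctsB|move=> s _; exact: nP].
have cQ n := adm_cQ (zK n); have cJ n := adm_cJ (zK n); have cE n := adm_cE (zK n).
split.
- move=> i; apply/ler_addgt0Pl => e e0; have [n nP] := zy e e0.
  have := nP i; have := adm_le (zK n) i; rewrite !ler_norml.
  by move=> /andP[? ?] /andP[? ?]; apply/andP; split; lra.
- exact: cts.
- exact: cts.
- exact: cts.
- by apply: per => n; exact: adm_pQ (zK n).
- by apply: per => n; exact: adm_pJ (zK n).
- by apply: per => n; exact: adm_pE (zK n).
- by apply: mean => // n; exact: adm_mQ (zK n).
- by apply: mean => // n; exact: adm_mJ (zK n).
Qed.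

Section curve.
Variables (K M : R) (y : R -> state (R := R)).
Hypotheses (K0 : 0 <= K) (yK : forall t, adm K (y t)).
Hypothesis yM : forall s t i, `|y s i - y t i| <= M * `|s - t|.

Lemma jcont_lagN (g : R -> coord) : ((g = fun=> Lb) \/ (g = fun=> La)) \/
  (g = LQ \/ g = LJ \/ g = LE) -> jcont (fun t x => lagN (y t) (g x)).
Proof. by move=> gP; exact: tame_jcont (tame_lagN q K0 gP) yK yM. Qed.

Lemma continuous_lagN i : continuous (fun t => lagN (y t) i).
Proof.
case: i => [||x|x|x].
- exact: jcont1 0 (jcont_lagN (or_introl (or_introl erefl))).
- exact: jcont1 0 (jcont_lagN (or_introl (or_intror erefl))).
- exact: jcont1 x (jcont_lagN (or_intror (or_introl erefl))).
- exact: jcont1 x (jcont_lagN (or_intror (or_intror (or_introl erefl)))).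
- exact: jcont1 x (jcont_lagN (or_intror (or_intror (or_intror erefl)))).
Qed.

(** The vector field is tangent to the linear constraints of admissible states. *)
Lemma adm_step y0 K' t : adm K' y0 ->
  (forall i, `|y0 i + prim (fun s => lagN (y s) i) t| <= K) ->
  adm K (fun i => y0 i + prim (fun s => lagN (y s) i) t).
Proof.
move=> y0K yb.
have jQ := jcont_lagN (or_intror (or_introl erefl)).
have jJ := jcont_lagN (or_intror (or_intror (or_introl erefl))).
have jE := jcont_lagN (or_intror (or_intror (or_intror erefl))).
have cQ := jcont2 t (jcont_prim_t jQ); have cJ := jcont2 t (jcont_prim_t jJ).
have cE := jcont2 t (jcont_prim_t jE).
have k_per s x : lagk q (y s) (x + 1) = lagk q (y s) x.
  by rewrite /lagk (lagU_periodic K0 (yK s)).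
have mean (g : R -> coord) c : continuous (fun x => y0 (g x)) ->
    jcont (fun t x => lagN (y t) (g x)) ->
    prim (fun x => y0 (g x)) 1 = c -> (forall s, prim (fun x => lagN (y s) (g x)) 1 = 0) ->
    prim (fun x => y0 (g x) + prim (fun s => lagN (y s) (g x)) t) 1 = c.
  move=> c0 jg <- H; have jt := jcont2 t (jcont_prim_t jg).
  rewrite primD // (prim_exchange t 1 jg).
  have -> : (fun s => prim (fun x => lagN (y s) (g x)) 1) = (fun=> 0).
    by apply/funext => s; exact: H.
  by rewrite prim_cst mul0r addr0.
split=> //.
- exact: ctsD (adm_cQ y0K) cQ.
- exact: ctsD (adm_cJ y0K) cJ.
- exact: ctsD (adm_cE y0K) cE.
- move=> x; rewrite (adm_pQ y0K); congr (_ + prim _ _); apply/funext => s /=.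
  by rewrite /lagg k_per (adm_pE (yK s)) (adm_pJ (yK s)).
- move=> x; rewrite (adm_pJ y0K); congr (_ + prim _ _); apply/funext => s /=.
  by rewrite k_per (adm_pQ (yK s)).
- move=> x; rewrite (adm_pE y0K); congr (_ + prim _ _); apply/funext => s /=.
  by rewrite (adm_pQ (yK s)).
- apply: mean => //; [exact: adm_cQ y0K|exact: adm_mQ y0K|move=> s].
  have [C gC] := tame_g q K0.
  have gc : continuous (lagg q (y s)) := tame_cts gC (yK s).
  by rewrite (primZ 2^-1 1 gc) (prim_lagg q K0 (yK s)) mulr0.
- apply: mean => //; [exact: adm_cJ y0K|exact: adm_mJ y0K|move=> s].
  exact: (prim_kQ1 q K0 (yK s)).
Qed.

End curve.

(** On [0, T] no coordinate moves by more than 1/2, since T times the bound of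
    the vector field is at most 1/2.  Hence J stays above 1/2, and T depends on
    the initial state through the bound K0 only. *)
Theorem lag_exists K0 : 0 <= K0 -> exists T K, [/\ 0 < T, 0 <= K &
  forall y0, adm K0 y0 -> (forall x, y0 (LJ x) = 1) ->
  exists y : R -> state, [/\ lag_sol K T y, y 0 = y0 & forall t x, 2^-1 <= y t (LJ x)]].
Proof.
move=> K00; pose K := K0 + 1; have Kge0 : 0 <= K by rewrite /K; lra.
have [C [C0 Cb Cl]] := lagN_constant q Kge0.
pose T := 2^-1 / (C + 1); have T0 : 0 < T by rewrite /T divr_gt0 //; lra.
have CT : C * T <= 2^-1.
  by rewrite /T mulrA ler_pdivrMr; lra.
exists T, K; split=> // y0 y0K y0J.
have y0K' : adm K y0.
  by case: y0K => H *; split=> // i; rewrite (le_trans (H i)) // /K; lra.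
pose B := [set y | adm K y /\ forall i, `|y i - y0 i| <= 2^-1].
have [||||||y [yB yM] yE] := @picard R coord (fun _ => lagN) B y0 C C T C0 C0 (ltW T0).
- by split=> // i; rewrite subrr normr0 invr_ge0.
- by move=> y [yB yM] i; apply: (continuous_lagN Kge0 _ yM) => t; case: (yB t).
- by move=> _ y i [yK _]; exact: Cb.
- by move=> _ y z d [yK _] [zK _]; exact: Cl.
- move=> y t [yB yM] /andP[t0 tT]; have yK s : adm K (y s) by case: (yB s).
  have H i : `|prim (fun s => lagN (y s) i) t| <= 2^-1.
    apply: le_trans CT; apply: (@le_trans _ _ (C * `|t|)).
      apply: prim_bound; first exact: (continuous_lagN Kge0 yK yM).
      by move=> s _; exact: Cb.
    by rewrite ger0_norm // ler_wpM2l.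
  split; last by move=> i; rewrite addrAC subrr add0r.
  apply: (adm_step Kge0 yK yM y0K) => i; apply: le_trans (ler_normD _ _) _.
  by have := H i; have := adm_le y0K i; rewrite /K; lra.
- move=> z zl zB zzl; split; first by apply: adm_closed zzl => n; case: (zB n).
  move=> i; apply/ler_addgt0Pl => e e0; have [n nP] := zzl e e0.
  case: (zB n) => _ /(_ i); have := nP i; rewrite !ler_norml.
  by move=> /andP[? ?] /andP[? ?]; apply/andP; split; lra.
have y00 : y 0 = y0.
  by apply/funext => i; rewrite yE ?prim0 ?addr0 // lexx ltW.
exists y; split=> //.
- split; first by move=> t; case: (yB t).
    by exists C.
  by move=> t i tT; rewrite y00 yE.
- move=> t x; case: (yB t) => _ /(_ (LJ x)); rewrite y0J ler_norml; lra.
Qed.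

Theorem lag_stable K T : 0 <= K -> 0 <= T -> exists2 C : R, 0 <= C &
  forall (y z : R -> state) d T', T' <= T -> lag_sol K T' y -> lag_sol K T' z -> 0 <= d ->
  (forall i, `|y 0 i - z 0 i| <= d) ->
  forall t i, 0 <= t <= T' -> `|y t i - z t i| <= C * d.
Proof.
move=> K0 T0; have [L [L0 _ Ll]] := lagN_constant q K0.
exists (2 * weight L T) => [|y z d T' TT yS zS d0 yz t i tT].
  by rewrite mulr_ge0 // expR_ge0.
have [yK [My yM] yE] := yS; have [zK [Mz zM] zE] := zS.
have cy j : continuous (fun s => lagN (y s) j) := continuous_lagN K0 yK yM (i:=j).
have cz j : continuous (fun s => lagN (z s) j) := continuous_lagN K0 zK zM (i:=j).
have := @gronwall R coord (fun t i => y t i - z t i)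
  (fun t i => lagN (y t) i - lagN (z t) i) L 0 d (K + K) T' L0 (lexx 0) d0.
move=> H; have {}H : `|y t i - z t i| <= 2 * (d + 0 * T') * weight L t.
  apply: H => //.
  - move=> s j _; apply: le_trans (ler_normB _ _) _.
    by rewrite lerD // adm_le.
  - by move=> j; exact: ctsB.
  - by move=> s j sT; rewrite yE // zE // primB //; lra.
  - by move=> s e sT H j; rewrite addr0; exact: Ll.
apply: le_trans H _; rewrite mul0r addr0 mulrAC ler_wpM2r // ler_wpM2l //.
by rewrite weight_le //; case/andP: tT => _ /le_trans; exact.
Qed.

End lagrangian_flow.

(** * The zero-mean primitive *)

Section zero_mean_primitive.
Context {R : realType}.
Implicit Types (f D : R -> R) (x : R).

(** The base point x0 shifts the primitive by a constant, which the projection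
    onto zero mean removes. *)
Lemma dx_inv_prim x0 f x : continuous f -> dx_inv x0 f x =
  prim (fun y => f y - prim f 1) x - prim (prim (fun y => f y - prim f 1)) 1.
Proof.
move=> fc; rewrite /dx_inv /mean_zero_primitive circle_mean_prim.
set g := fun y => f y - prim f 1.
have gc : continuous g := ctsB fc (@ctsC _ _ (prim f 1)).
have -> : (fun z => oriented_integral x0 z g) = (fun z => prim g z - prim g x0).
  by apply/funext => z; exact: oriented_integral_prim.
rewrite circle_mean_prim oriented_integral_prim //.
have gp := continuous_prim gc; rewrite primB //; last exact: ctsC.
by rewrite prim_cst; lra.
Qed.

Lemma is_derive_dx_inv x0 f x : continuous f ->
  is_derive x 1 (dx_inv x0 f) (f x - prim f 1).
Proof.
move=> fc; have -> : dx_inv x0 f = (fun x => prim (fun y => f y - prim f 1) x -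
    prim (prim (fun y => f y - prim f 1)) 1).
  by apply/funext => z; exact: dx_inv_prim.
rewrite -[X in is_derive _ _ _ X]subr0.
have gc : continuous (fun y => f y - prim f 1) := ctsB fc (@ctsC _ _ (prim f 1)).
by have ? := @is_derive_prim _ _ x gc; exact: is_deriveB.
Qed.

Lemma prim_dx_inv x0 f : continuous f -> prim (dx_inv x0 f) 1 = 0.
Proof.
move=> fc; have -> : dx_inv x0 f = (fun x => prim (fun y => f y - prim f 1) x -
    prim (prim (fun y => f y - prim f 1)) 1).
  by apply/funext => z; exact: dx_inv_prim.
have gc : continuous (fun y => f y - prim f 1) := ctsB fc (@ctsC _ _ (prim f 1)).
have gp := continuous_prim gc; rewrite primB //; last exact: ctsC.
by rewrite prim_cst mulr1 subrr.
Qed.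

Lemma dx_inv_unique x0 f D x : continuous f ->
  (forall y : R, is_derive y 1 D (f y - prim f 1)) -> prim D 1 = 0 -> dx_inv x0 f x = D x.
Proof.
move=> fc Dd Dm; rewrite dx_inv_prim //.
have gc : continuous (fun y => f y - prim f 1) := ctsB fc (@ctsC _ _ (prim f 1)).
have gp := continuous_prim gc.
have E := prim_unique _ gc Dd.
have D0 : D 0 = - prim (prim (fun y => f y - prim f 1)) 1.
  have : prim (fun y => D 0 + prim (fun z => f z - prim f 1) y) 1 = 0.
    by rewrite -{}[RHS]Dm; congr prim; apply/funext => y; rewrite -E.
  rewrite primD //; last exact: ctsC.
  by rewrite prim_cst; lra.
by rewrite (E x) D0; lra.
Qed.

Lemma dx_inv_periodic x0 f : continuous f -> periodic f 1 -> periodic (dx_inv x0 f) 1.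
Proof.
move=> fc fp x; rewrite !dx_inv_prim //; congr (_ - _).
have gc : continuous (fun y => f y - prim f 1) := ctsB fc (@ctsC _ _ (prim f 1)).
rewrite prim_periodic //; last by move=> y; rewrite fp.
rewrite [X in _ + X]primB //; last exact: ctsC.
by rewrite prim_cst mulr1 subrr addr0.
Qed.

Lemma prim_circle_map f (g h : R -> R) : continuous f -> periodic f 1 -> continuous h ->
  (forall y : R, is_derive y 1 g (h y)) -> g 1 = g 0 + 1 ->
  prim (fun y => f (g y) * h y) 1 = prim f 1.
Proof.
move=> fc fp hc gd g1; rewrite (prim_mul_deriv 1 fc hc gd) g1 prim_periodic //.
lra.
Qed.

Lemma ctsV {T : topologicalType} (f : T -> R) : continuous f ->
  (forall z, f z != 0) -> continuous (fun z => (f z)^-1).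
Proof. by move=> fc f0 z; apply: cvgV; [exact: f0|exact: fc]. Qed.

End zero_mean_primitive.

(** * From the Lagrangian system to the circle *)

Section reconstruction.
Context {R : realType}.
Variables (q : nat) (K T : R) (y : R -> state (R := R)).
Hypotheses (K0 : 0 <= K) (yS : lag_sol q K T y).
Hypothesis yJ : forall t x, 2^-1 <= y t (LJ x).
Hypothesis yE0 : forall x, y 0 (LE x) * y 0 (LJ x) = y 0 (LQ x) ^+ 2.
Implicit Types (d e s t x M : R).
Local Notation Q t x := (y t (LQ x)).
Local Notation J t x := (y t (LJ x)).
Local Notation E t x := (y t (LE x)).
Local Notation U t := (lagU (y t)).
Local Notation V t := (lagV q (y t)).

Definition flow t x := y t Lb + prim (fun x => J t x) x.

Let yK := lag_adm yS.
Let J_gt0 t x : 0 < J t x. Proof. by apply: lt_le_trans (yJ t x); rewrite invr_gt0. Qed.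
Let J_neq0 t x : J t x != 0. Proof. by rewrite gt_eqF. Qed.

Let jQ : jcont (fun t x => Q t x).
Proof. by case: (lag_lip yS) => M; exact: tame_jcont (ex_intro _ _ (tame_Q K0)) yK. Qed.
Let jJ : jcont (fun t x => J t x).
Proof. by case: (lag_lip yS) => M; exact: tame_jcont (ex_intro _ _ (tame_J K0)) yK. Qed.
Let jU : jcont (fun t x => U t x).
Proof. by case: (lag_lip yS) => M; exact: tame_jcont (tame_U K0) yK. Qed.
Let jV : jcont (fun t x => V t x).
Proof. by case: (lag_lip yS) => M; exact: tame_jcont (tame_V q K0) yK. Qed.
Let jN i : continuous (fun t => lagN q (y t) i).
Proof. by case: (lag_lip yS) => M yM; exact: (continuous_lagN K0 yK yM). Qed.

Let derive_y t i : 0 < t < T -> is_derive t 1 (y^~ i) (lagN q (y t) i).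
Proof.
move=> tT; apply: (@is_derive_itv _ (y^~ i) (fun t => lagN q (y t) i) T) => //.
by move=> s sT; exact: (lag_eq yS).
Qed.

Let cy i : continuous (y^~ i).
Proof.
case: (lag_lip yS) => M yM t; apply/continuousRP => e e0.
exists (e / (`|M| + 1)); first by rewrite divr_gt0 // ltr_wpDl.
move=> s st; apply: le_trans (yM s t i) _; apply: (@le_trans _ _ ((`|M| + 1) * `|s - t|)).
  by rewrite ler_wpM2r // (le_trans (ler_norm _)) // lerDl.
by rewrite mulrC -ler_pdivlMr ?ltr_wpDl // ltW.
Qed.

(** E J - Q ^ 2 is conserved; its vanishing is what identifies E with
    u_x(eta) ^ 2 J. *)
Lemma lag_EJ t x : 0 <= t <= T -> E t x * J t x = Q t x ^+ 2.
Proof.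
move=> tT; apply/eqP; rewrite -subr_eq0.
pose f t := E t x * J t x - Q t x * Q t x.
have fc : continuous f.
  exact: ctsB (ctsM (@cy (LE x)) (@cy (LJ x))) (ctsM (@cy (LQ x)) (@cy (LQ x))).
have fd s : 0 < s < T -> is_derive s 1 f 0.
  move=> sT; have dE := derive_y (LE x) sT; have dJ := derive_y (LJ x) sT.
  have dQ := derive_y (LQ x) sT; apply: is_derive_eq.
  by rewrite /GRing.scale /= /lagg; field.
have := prim_itv fc (@ctsC _ _ 0) fd tT.
by rewrite prim_cst mul0r addr0 /f !expr2 => ->; rewrite yE0 expr2 subrr.
Qed.

Lemma lagU_eq t x : 0 <= t <= T -> U t x = U 0 x + prim (fun s => V s x) t.
Proof.
move=> tT; have [M yM] := lag_lip yS.
have jQ' : jcont (fun t x => lagN q (y t) (LQ x)).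
  exact: (jcont_lagN K0 yK yM (or_intror (or_introl erefl))).
rewrite /lagU (lag_eq yS La tT).
have -> : prim (fun x => Q t x) x =
    prim (fun x => Q 0 x + prim (fun s => lagN q (y s) (LQ x)) t) x.
  by congr prim; apply/funext => z; exact: (lag_eq yS).
have c0 := jcont2 0 jQ; have c1 := jcont2 t (jcont_prim_t jQ').
rewrite primD // (prim_exchange t x jQ') addrACA -primD; last 2 first.
- exact: jN.
- exact: jcont1 x (jcont_prim jQ').
congr (_ + prim _ _); apply/funext => s; rewrite /= primZ; last first.
  by have [C gC] := tame_g q K0; exact: (tame_cts gC (yK s)).
by rewrite /lagV /lagG prim0; ring.
Qed.

Lemma flow_eq t x : 0 <= t <= T ->
  flow t x = flow 0 x + prim (fun s => U s x ^+ q.+1) t.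
Proof.
move=> tT; have [M yM] := lag_lip yS.
have jJ' : jcont (fun t x => lagN q (y t) (LJ x)).
  exact: (jcont_lagN K0 yK yM (or_intror (or_intror (or_introl erefl)))).
rewrite /flow (lag_eq yS Lb tT).
have -> : prim (fun x => J t x) x =
    prim (fun x => J 0 x + prim (fun s => lagN q (y s) (LJ x)) t) x.
  by congr prim; apply/funext => z; exact: (lag_eq yS).
have c0 := jcont2 0 jJ; have c1 := jcont2 t (jcont_prim_t jJ').
rewrite primD // (prim_exchange t x jJ') addrACA -primD; last 2 first.
- exact: jN.
- exact: jcont1 x (jcont_prim jJ').
congr (_ + prim _ _); apply/funext => s; rewrite (prim_kQ q K0 x (yK s)) /=.
by have -> : U s 0 = y s La by rewrite /lagU prim0 addr0.
Qed.

Lemma is_derive_flow t x : is_derive x 1 (flow t) (J t x).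
Proof.
rewrite -[J t x]add0r; have ? := @is_derive_prim _ _ x (jcont2 t jJ).
exact: is_deriveD.
Qed.

Lemma flow1 t x : flow t (x + 1) = flow t x + 1.
Proof.
rewrite /flow prim_periodic ?(adm_mJ (yK t)) ?addrA //; first exact: (jcont2 t jJ).
exact: adm_pJ (yK t).
Qed.

Lemma flow_expand t x x' : `|x' - x| <= 2 * `|flow t x' - flow t x|.
Proof.
have [c _ ->] := mean_value x x' (is_derive_flow t).
have Jc := yJ t c; rewrite normrM (ger0_norm (ltW (J_gt0 t c))).
by rewrite mulrA ler_peMl //; lra.
Qed.

Lemma flow_inj t : injective (flow t).
Proof.
move=> x x' e; apply/eqP; rewrite eq_sym -subr_eq0 -normr_le0.
by have := flow_expand t x x'; rewrite e subrr normr0 mulr0.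
Qed.

Lemma jcont_flow : jcont flow.
Proof. exact: ctsD (jcont_t (@cy Lb)) (jcont_prim jJ). Qed.

Lemma flow_surj t x : exists x', flow t x' = x.
Proof.
pose r := 2 * `|x - flow t 0|; have r0 : 0 <= r by rewrite mulr_ge0.
have fc := jcont2 t jcont_flow.
have step a b : a <= b -> 2^-1 * (b - a) <= flow t b - flow t a.
  move=> ab; have [c _ ->] := mean_value a b (is_derive_flow t).
  by rewrite ler_wpM2r ?subr_ge0.
have h1 := step _ _ r0; have h2 := step (- r) 0 ltac:(lra).
have [n1 n2] := (ler_norm (x - flow t 0), ler_norm (- (x - flow t 0))).
rewrite normrN in n2.
have [c _ cx] : exists2 c, c \in `[- r, r] & flow t c = x.
  apply: IVT; [lra|exact: continuous_subspaceT|].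
  rewrite ge_min le_max; apply/andP; split; apply/orP; [left|right]; move: h1 h2 n1 n2;
    rewrite /r; lra.
by exists c.
Qed.

Definition label t x := sval (cid (flow_surj t x)).

Lemma flowK t x : flow t (label t x) = x.
Proof. exact: svalP (cid (flow_surj t x)). Qed.

Lemma labelK t x : label t (flow t x) = x.
Proof. by apply: (@flow_inj t); rewrite flowK. Qed.

Lemma label1 t x : label t (x + 1) = label t x + 1.
Proof. by apply: (@flow_inj t); rewrite flow1 !flowK. Qed.

Lemma jcont_label : jcont label.
Proof.
apply/jcontP => t x e e0; have e4 : 0 < e / 4 by lra.
have [d d0 dP] := (jcontP _).1 jcont_flow t (label t x) _ e4.
exists (Num.min d (e / 4)) => [|s x']; first by rewrite lt_min d0.
rewrite !lt_min => /andP[sd _] /andP[_ xe].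
apply: le_trans (flow_expand s _ _) _; rewrite flowK.
have := dP s (label t x) sd; rewrite subrr normr0 => /(_ d0); rewrite flowK => H.
have := ler_normD (x' - x) (x - flow s (label t x)).
by rewrite addrA subrK [`|x - _|]distrC; lra.
Qed.

Lemma is_derive_label t x : is_derive x 1 (label t) (J t (label t x))^-1.
Proof.
rewrite -{1}(flowK t x); apply: is_derive_inverse => //.
- by near=> z; exact: labelK.
- by near=> z; exact: (jcont2 t jcont_flow).
- exact: is_derive_flow.
Unshelve. all: by end_near. Qed.

Definition lagW t x := Q t x / J t x.

(** The time derivative of u at a fixed point of the circle, read in labels. *)
Definition lagA t x := V t x - U t x ^+ q.+1 * lagW t x.

Definition eulerian (H : R -> R -> R) t x := H t (label t x).

Lemma jcont_eulerian H : jcont H -> jcont (eulerian H).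
Proof. by move=> Hc; exact: jcont_comp2 Hc jcont_label. Qed.

Lemma eulerian_periodic H : xperiodic H -> xperiodic (eulerian H).
Proof. by move=> Hp t x; rewrite /eulerian label1 Hp. Qed.

Lemma jcont_W : jcont lagW.
Proof. by apply: ctsM jQ _; apply: (ctsV jJ) => z; exact: J_neq0. Qed.

Lemma W_periodic : xperiodic lagW.
Proof. by move=> t x; rewrite /lagW (adm_pQ (yK t)) (adm_pJ (yK t)). Qed.

Lemma V_periodic t : periodic (V t) 1.
Proof. by have [C VC] := tame_V q K0; exact: (tame_per VC (yK t)). Qed.

Lemma jcont_A : jcont lagA.
Proof.
have jUp : jcont (fun t x => U t x ^+ q.+1) := ctsX (n:=q.+1) jU.
exact: (ctsB jV (ctsM jUp jcont_W)).
Qed.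

Lemma A_periodic : xperiodic lagA.
Proof. by move=> t x; rewrite /lagA V_periodic W_periodic (lagU_periodic K0 (yK t)). Qed.

Local Notation u := (eulerian (fun t => U t)).
Local Notation ux := (eulerian lagW).
Local Notation ut := (eulerian lagA).

Lemma jcont_u : jcont u. Proof. exact: jcont_eulerian jU. Qed.
Lemma jcont_ux : jcont ux. Proof. exact: jcont_eulerian jcont_W. Qed.
Lemma jcont_ut : jcont ut. Proof. exact: jcont_eulerian jcont_A. Qed.

Lemma u_periodic : xperiodic u.
Proof. by apply: eulerian_periodic => t; exact: (lagU_periodic K0 (yK t)). Qed.
Lemma ux_periodic : xperiodic ux. Proof. exact: eulerian_periodic W_periodic. Qed.
Lemma ut_periodic : xperiodic ut. Proof. exact: eulerian_periodic A_periodic. Qed.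

Lemma is_derive_u t x : is_derive x 1 (u t) (ux t x).
Proof.
have d1 := is_derive_lagU (label t x) (yK t); have d2 := is_derive_label t x.
exact: (@is_derive1_comp R (U t) (label t)).
Qed.

Definition source t x := q.+1%:R * u t x ^+ q * ux t x ^+ 2.

Lemma source_continuous t : continuous (source t).
Proof.
have uc := jcont2 t jcont_u; have uxc := jcont2 t jcont_ux.
exact: ctsM (ctsM (@ctsC _ _ _) (ctsX (n:=q) uc)) (ctsX (n:=2) uxc).
Qed.

Lemma source_periodic t : periodic (source t) 1.
Proof. by move=> x; rewrite /source u_periodic ux_periodic. Qed.

Lemma source_flow t x : 0 <= t <= T -> source t (flow t x) * J t x = lagk q (y t) x * E t x.
Proof.
move=> tT; rewrite /source /eulerian labelK /lagW /lagk.
have := lag_EJ x tT; have := J_neq0 t x; move: (J t x) => j j0 EJ.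
have -> : E t x = Q t x ^+ 2 / j by rewrite -EJ mulfK.
by field.
Qed.

Let flow0 t : flow t 1 = flow t 0 + 1. Proof. by rewrite -flow1 add0r. Qed.

Lemma prim_source t : 0 <= t <= T -> prim (source t) 1 = lagm q (y t).
Proof.
move=> tT; rewrite -(prim_circle_map (@source_continuous t) (@source_periodic t)
  (jcont2 t jJ) (fun z => is_derive_flow t z) (flow0 t)).
by congr prim; apply/funext => x; exact: source_flow.
Qed.

(** Both sides have derivative source - mean and zero mean over the circle. *)
Lemma dx_inv_source x0 t x : 0 <= t <= T ->
  dx_inv x0 (source t) x = 2 * eulerian (fun t => V t) t x.
Proof.
move=> tT; apply: (@dx_inv_unique _ _ _ (fun x => 2 * V t (label t x))).
- exact: source_continuous.
- move=> {}x; rewrite (prim_source tT).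
  have [C gC] := tame_g q K0; have gc : continuous (lagg q (y t)) := tame_cts gC (yK t).
  pose c := prim (fun x => lagG q (y t) x * J t x) 1.
  have dV (z : R) : is_derive z 1 (V t) (2^-1 * (lagg q (y t) z - 0)).
    rewrite /lagV -/c; have ? := @is_derive_prim _ _ z gc.
    by apply: is_deriveZ; exact: is_deriveB.
  have d1 := dV (label t x); have d2 := is_derive_label t x.
  have -> : source t x - lagm q (y t) =
      2 * (2^-1 * (lagg q (y t) (label t x) - 0) * (J t (label t x))^-1).
    rewrite -[in source t x](flowK t x); apply: (@mulIf _ (J t (label t x))) => //.
    by rewrite mulrBl source_flow // /lagg; field.
  by apply: is_deriveZ; exact: (@is_derive1_comp R (V t) (label t)).
- have Vc := jcont2 t (jcont_eulerian jV); have Vp := eulerian_periodic V_periodic t.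
  have Jc := jcont2 t jJ.
  rewrite primZ // -(prim_circle_map Vc Vp Jc (fun z => is_derive_flow t z) (flow0 t)).
  have [C GC] := tame_G q K0; have Gc : continuous (lagG q (y t)) := tame_cts GC (yK t).
  have -> : (fun x => eulerian (fun t => V t) t (flow t x) * J t x) = (fun x => 2^-1 *
      (lagG q (y t) x * J t x - prim (fun x => lagG q (y t) x * J t x) 1 * J t x)).
    by apply/funext => z; rewrite /eulerian labelK /lagV; ring.
  have GJ : continuous (fun x => lagG q (y t) x * J t x) := ctsM Gc Jc.
  have cJ : continuous (fun z => prim (fun x => lagG q (y t) x * J t x) 1 * J t z).
    exact: ctsM (@ctsC _ _ _) Jc.
  rewrite primZ ?primB // ?primZ // ?(adm_mJ (yK t)) ?mulr1 ?subrr ?mulr0 //.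
  exact: ctsB.
Qed.

Lemma eulerian_equation x0 t x : 0 <= t <= T ->
  ut t x + u t x ^+ q.+1 * ux t x = 2^-1 * dx_inv x0 (source t) x.
Proof.
by move=> tT; rewrite dx_inv_source // /eulerian /lagA; field.
Qed.

(** Uniform in x, as the norm of L^oo requires.  The label map is not
    differentiated in time: with X the label of x at time t, u s x - u t x is
    the sum of u s x - u s (flow s X), which is a space increment, and of
    U s X - U t X. *)
Lemma u_time_derivative t e : 0 <= t <= T -> 0 < e -> exists2 d : R, 0 < d &
  forall s x, 0 <= s <= T -> `|s - t| < d ->
    `|u s x - u t x - (s - t) * ut t x| <= e * `|s - t|.
Proof.
move=> tT e0.
have jUp : jcont (fun t x => U t x ^+ q.+1) := ctsX (n:=q.+1) jU.
have pUp : xperiodic (fun t x => U t x ^+ q.+1).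
  by move=> s x; rewrite (lagU_periodic K0 (yK s)).
have pU s : periodic (U s) 1 := lagU_periodic K0 (yK s).
(* M and N turn distances in time into distances in space; each of the three
   terms of E1 below gets at most e / 2 times |s - t|. *)
have [M M0 MP] := @jcont_bounded_per _ _ (t - 1) (t + 1) jUp pUp.
have [N N0 NP] := @jcont_bounded_per _ _ t t jcont_ux ux_periodic.
have e4 : 0 < e / 4 by lra.
have [d1 d10 P1] := @jcont_near1_per _ _ t _ jV V_periodic e4.
have eM : 0 < e / 4 / M by rewrite divr_gt0.
have [d2 d20 P2] := @jcont_near1_per _ _ t _ jcont_ux ux_periodic eM.
have [d3 d30 P3] := @jcont_unif2_per _ _ t t _ jcont_ux ux_periodic eM.
have eN : 0 < e / 4 / N by rewrite divr_gt0.
have [d4 d40 P4] := @jcont_near1_per _ _ t _ jUp pUp eN.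
exists (Num.min (Num.min 1 (Num.min d1 d2)) (Num.min (d3 / M) d4)).
  by rewrite !lt_min ltr01 d10 d20 d40 divr_gt0.
move=> s x sT; rewrite !lt_min => /andP[/andP[st1 /andP[sd1 sd2]] /andP[sd3 sd4]].
pose X := label t x.
have VE (r : R) : is_derive r 1 (prim (fun s => V s X)) (V r X).
  exact: (is_derive_prim _ (jcont1 X jV)).
have UE (r : R) : is_derive r 1 (prim (fun s => U s X ^+ q.+1)) (U r X ^+ q.+1).
  exact: (is_derive_prim _ (jcont1 X jUp)).
have [r rs rE] := mean_value t s VE; have [r' rs' rE'] := mean_value t s UE.
have Ust : U s X - U t X = V r X * (s - t).
  by rewrite (lagU_eq X sT) (lagU_eq X tT) -rE; lra.
have Fst : flow s X - flow t X = U r' X ^+ q.+1 * (s - t).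
  by rewrite (flow_eq X sT) (flow_eq X tT) -rE'; lra.
have [z zx zE] := mean_value x (flow s X) (is_derive_u s).
have fX : flow t X = x := flowK t x.
have us : u s (flow s X) = U s X by rewrite /eulerian labelK.
have ut' : ut t x = V t X - U t X ^+ q.+1 * ux t x by [].
have xF : flow s X - x = U r' X ^+ q.+1 * (s - t) by rewrite -Fst fX.
have ux_t : u t x = U t X by [].
have E1 : u s x - u t x - (s - t) * ut t x =
  (V r X - V t X) * (s - t) - (ux s z - ux t x) * (U r' X ^+ q.+1 * (s - t))
  - ux t x * ((U r' X ^+ q.+1 - U t X ^+ q.+1) * (s - t)).
  have -> : u s x = U s X - ux s z * (U r' X ^+ q.+1 * (s - t)).
    by rewrite -xF -zE us; lra.
  have -> : U s X = U t X + V r X * (s - t) by rewrite -Ust; lra.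
  by rewrite ut' ux_t; ring.
have rb : `|U r' X ^+ q.+1| <= M.
  by apply: MP; rewrite -ler_distl; exact: ltW (le_lt_trans rs' st1).
have zb : `|z - x| < d3.
  apply: le_lt_trans zx _.
  rewrite xF normrM; apply: (@le_lt_trans _ _ (M * `|s - t|)).
    by rewrite ler_wpM2r.
  by rewrite mulrC -ltr_pdivlMr.
have b1 : `|(V r X - V t X) * (s - t)| <= e / 4 * `|s - t|.
  by rewrite normrM ler_wpM2r // P1 // (le_lt_trans rs).
have b2 : `|(ux s z - ux t x) * (U r' X ^+ q.+1 * (s - t))| <= e / 2 * `|s - t|.
  rewrite !normrM mulrA ler_wpM2r //; apply: (@le_trans _ _ (2 * (e / 4 / M) * M)).
    apply: ler_pM => //.
    have h1 := P2 s z sd2; have h2 := P3 t x z (introT andP (conj (lexx t) (lexx t))) zb.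
    have := ler_normD (ux s z - ux t z) (ux t z - ux t x).
    by rewrite addrA subrK; lra.
  by rewrite -mulrA divfK ?gt_eqF //; lra.
have b3 : `|ux t x * ((U r' X ^+ q.+1 - U t X ^+ q.+1) * (s - t))| <= e / 4 * `|s - t|.
  rewrite (normrM (ux t x)) (normrM (_ - _)) mulrA ler_wpM2r //.
  apply: (@le_trans _ _ (N * (e / 4 / N))).
    have h1 : `|ux t x| <= N by apply: NP; rewrite !lexx.
    have h2 : `|U r' X ^+ q.+1 - U t X ^+ q.+1| <= e / 4 / N.
      by apply: P4; exact: le_lt_trans rs' _.
    exact: ler_pM.
  by rewrite mulrC divfK ?gt_eqF.
rewrite E1; apply: le_trans (ler_normB _ _) _.
have := ler_normB ((V r X - V t X) * (s - t)) ((ux s z - ux t x) * (U r' X ^+ q.+1 * (s - t))).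
lra.
Qed.

End reconstruction.

(** * Norms of functions on the circle *)

Section norms.
Context {R : realType}.
Implicit Types (f g : R -> R) (a b d e s t x T M : R).
Local Notation mu := (circle_measure R).

Lemma circle_measureE (A : set R) : mu A = lebesgue_measure (A `&` `[0, 1[).
Proof. by []. Qed.

Lemma circle_measure_gt0 : (0 < mu [set: R])%E.
Proof.
rewrite circle_measureE setTI lebesgue_measure_itv /= lte_fin ltr01.
by rewrite sube0 lte_fin ltr01.
Qed.

Lemma Linfty_normP g e : (Linfty_norm g <= e%:E)%E <->
  {ae mu, forall x, `|g x| <= e}.
Proof.
rewrite /Linfty_norm unlock circle_measure_gt0.
have S (P P' : R -> Prop) : (forall x, P x -> P' x) ->
    {ae mu, forall x, P x} -> {ae mu, forall x, P' x}.
  by move=> PP'; exact: (@filterS _ _ (ae_filter_ringOfSetsType mu)).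
split=> [/ess_supP|H]; last (apply/ess_supP; move: H);
  by apply: S => x /=; rewrite lee_fin.
Qed.

(** A violation at z in [0, 1[ persists on an interval to the right of z, which
    has positive measure. *)
Lemma ae_continuous_le g e : continuous g -> periodic g 1 ->
  {ae mu, forall x, `|g x| <= e} -> forall x, `|g x| <= e.
Proof.
move=> gc gp [A [mA A0 gA]] x; have [n /andP[]] := periodic_repr x.
rewrite -(periodicZ n x gp); move: (x + _) => z z0 z1.
rewrite leNgt; apply/negP => ez.
have d0 : 0 < (`|g z| - e) / 2 by lra.
have [d dp dP] := (continuousRP g z).1 (gc z) _ d0.
pose r := Num.min (d / 2) (1 - z).
have r0 : 0 < r by rewrite lt_min; apply/andP; split; lra.
have rd : r <= d / 2 by rewrite ge_min lexx.
have rz : r <= 1 - z by rewrite ge_min lexx orbT.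
pose B : set R := `[z, z + r[%classic.
have sub : B `<=` A.
  move=> w; rewrite /B /= in_itv /= => /andP[zw wz]; apply: gA => /= H.
  have wd : `|w - z| < d by rewrite ger0_norm; lra.
  have := dP w wd; have := ler_normD (g w) (g z - g w); rewrite addrC subrK distrC.
  by move: H; lra.
have : (mu B <= mu A)%E.
  by apply: le_measure => //; rewrite inE //; exact: measurable_itv.
rewrite A0 circle_measureE.
have -> : B `&` `[0, 1[%classic = B.
  apply/setIidPl => w; rewrite /B /= !in_itv /= => /andP[? ?]; apply/andP; split; lra.
rewrite lebesgue_measure_itv /= lte_fin ltrDl r0 -EFinB lee_fin; lra.
Qed.

Lemma Linfty_norm_le g e : (forall x, `|g x| <= e) -> (Linfty_norm g <= e%:E)%E.
Proof. by move=> ge; apply/Linfty_normP; exact: aeW. Qed.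

Lemma Linfty_norm_ge0 g : (0 <= Linfty_norm g)%E.
Proof. exact: Lnorm_ge0. Qed.

Lemma periodic_bounded f : continuous f -> periodic f 1 ->
  exists2 M : R, 0 < M & forall x, `|f x| <= M.
Proof.
move=> fc fp; have [M M0 MP] := @jcont_bounded_per R (fun=> f) 0 0 (jcont_x fc) (fun=> fp).
by exists M => // x; apply: (MP 0); rewrite lexx.
Qed.

Lemma Linfty_continuous g : continuous g -> periodic g 1 -> Linfty g.
Proof.
move=> gc gp; rewrite /Linfty; apply/andP; split.
  by rewrite inE /=; exact: continuous_measurable_fun.
rewrite inE /= /finite_norm; have [M M0 MP] := periodic_bounded gc gp.
exact: le_lt_trans (Linfty_norm_le MP) (ltry _).
Qed.

Lemma C1_continuous f : C1 f -> continuous f.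
Proof.
by move=> [_ fd _] x; apply: differentiable_continuous; apply/derivable1_diffP.
Qed.

Lemma C1_is_derive f x : C1 f -> is_derive x 1 f (derive1 f x).
Proof. by move=> [_ fd _]; rewrite derive1E; apply: DeriveDef. Qed.

Lemma is_derive_derive1 f df : (forall x, is_derive x 1 f (df x)) -> derive1 f = df.
Proof. by move=> fd; apply/funext => x; rewrite derive1E; have [_ ->] := fd x. Qed.

Lemma derive1_periodic f : C1 f -> periodic (derive1 f) 1.
Proof.
move=> fC x; have := C1_is_derive (x + 1) fC; case: (fC) => fp _ _ d1.
have d2 : is_derive x 1 (fun y : R => y + 1) 1.
  by rewrite -[X in is_derive _ _ _ X]addr0; exact: is_deriveD.
have := @is_derive1_comp R f (fun y => y + 1) x _ _ d1 d2.
rewrite (_ : f \o _ = f); last by apply/funext => y; exact: fp.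
by rewrite mulr1 => -[_ <-]; rewrite derive1E.
Qed.

Lemma C1_build f df : periodic f 1 -> continuous df ->
  (forall x, is_derive x 1 f (df x)) -> C1 f.
Proof.
by move=> fp dfc fd; split=> //; rewrite (is_derive_derive1 fd).
Qed.

Lemma C1B f g : C1 f -> C1 g ->
  C1 (f \- g) /\ derive1 (f \- g) = (fun x => derive1 f x - derive1 g x).
Proof.
move=> fC gC; have D x : is_derive x 1 (f \- g) (derive1 f x - derive1 g x).
  by have ? := C1_is_derive x fC; have ? := C1_is_derive x gC; exact: is_deriveB.
split; last exact: is_derive_derive1.
case: fC gC => fp _ fc [gp _ gc]; apply: C1_build D => [x|].
  by rewrite /= fp gp.
exact: ctsB.
Qed.

Lemma le_C1_norm f : C1 f -> forall x, `|f x| <= C1_norm f /\ `|derive1 f x| <= C1_norm f.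
Proof.
move=> fC x; have fc := C1_continuous fC; have dp := derive1_periodic fC.
case: (fC) => fp _ dc.
have sup_ge (g : R -> R) : continuous g -> periodic g 1 ->
    forall x, `|g x| <= sup (range (fun x => `|g x|)).
  move=> gc gp z; have [M _ MP] := periodic_bounded gc gp.
  by apply: ub_le_sup; [exists M => _ [w _ <-]|exists z].
have h1 := sup_ge _ fc fp; have h2 := sup_ge _ dc dp.
have := h1 x; have := h2 x; have := normr_ge0 (f x); have := normr_ge0 (derive1 f x).
by rewrite /C1_norm; split; lra.
Qed.

Lemma C1_norm_le f a b : (forall x, `|f x| <= a) -> (forall x, `|derive1 f x| <= b) ->
  C1_norm f <= a + b.
Proof.
move=> fa fb; rewrite /C1_norm; apply: lerD; apply: ge_sup;
  by [exists `|f 0|, 0|exists `|derive1 f 0|, 0|move=> _ [x _ <-]].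
Qed.

Lemma C1_norm_ge0 f : C1 f -> 0 <= C1_norm f.
Proof. by move=> fC; have [+ _] := le_C1_norm fC 0; have := normr_ge0 (f 0); lra. Qed.

End norms.

(** * Solutions as classical functions *)

Section classical_solutions.
Context {R : realType}.
Variables (q : nat) (x0 : R).
Implicit Types (f g : R -> R) (a b d e s t x T M : R).
Local Notation mu := (circle_measure R).

Lemma nbhs_withinP t (D P : set R) : (\forall s \near within D (nbhs t), P s) <->
  exists2 d : R, 0 < d & forall s, D s -> `|s - t| < d -> P s.
Proof.
rewrite near_withinE; split=> [/nearRP[d d0 dP]|[d d0 dP]].
  by exists d => // s Ds st; exact: dP.
by apply/nearRP; exists d => // s st Ds; exact: dP.
Qed.

Lemma dnbhs_withinP t (D P : set R) : (\forall s \near within D t^', P s) <->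
  exists2 d : R, 0 < d & forall s, D s -> s != t -> `|s - t| < d -> P s.
Proof.
rewrite near_withinE /dnbhs near_withinE; split=> [/nearRP[d d0 dP]|[d d0 dP]].
  by exists d => // s Ds st sd; exact: dP.
by apply/nearRP; exists d => // s st sn Ds; exact: dP.
Qed.

Lemma cvg_ereal0P (F : set_system R) {FF : Filter F} (f : R -> \bar R) :
  (forall s, (0 <= f s)%E) -> f @ F --> 0%E <->
  forall e, 0 < e -> \forall s \near F, (f s <= e%:E)%E.
Proof.
move=> f0; split=> [/fine_cvgP[fin /cvgrPdist_le H] e e0|H].
  have {}H := H e e0; near=> s.
  have sf : f s \is a fin_num by near: s.
  rewrite -(fineK sf) lee_fin; have : `|0 - (fine \o f) s| <= e by near: s.
  by rewrite sub0r normrN /= => /(le_trans (ler_norm _)).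
have fin e s : (f s <= e%:E)%E -> f s \is a fin_num.
  by move=> fe; rewrite ge0_fin_numE // (le_lt_trans fe) ?ltry.
apply/fine_cvgP; split.
  by apply: filterS (H 1 ltr01) => s; exact: fin.
apply/cvgrPdist_le => e e0; apply: filterS (H e e0) => s fs.
have sf := fin _ _ fs; rewrite sub0r normrN /= ger0_norm ?fine_ge0 //.
by rewrite -lee_fin fineK.
Unshelve. all: by end_near. Qed.

Definition power_source f df x := q.+1%:R * f x ^+ q * df x ^+ 2.

Lemma power_sourceE f df : (forall x, is_derive x 1 f (df x)) ->
  (fun y => derive1 (fun z => f z ^+ q.+1) y * derive1 f y) = power_source f df.
Proof.
move=> fd; rewrite (is_derive_derive1 fd).
have -> := is_derive_derive1 (fun x => is_derive_pow q (fd x)).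
by apply/funext => x; rewrite /power_source; ring.
Qed.

Theorem classical_mHS T (v0 : R -> R) (u ux ut : R -> R -> R) :
  jcont u -> jcont ux -> jcont ut -> xperiodic u -> xperiodic ux -> xperiodic ut ->
  (forall t x, is_derive x 1 (u t) (ux t x)) ->
  (forall t e, 0 <= t < T -> 0 < e -> exists2 d : R, 0 < d &
    forall s x, 0 <= s < T -> `|s - t| < d ->
    `|u s x - u t x - (s - t) * ut t x| <= e * `|s - t|) ->
  (forall t x, 0 <= t < T -> ut t x + u t x ^+ q.+1 * ux t x =
     2^-1 * dx_inv x0 (power_source (u t) (ux t)) x) ->
  u 0 =1 v0 -> mHS_solution q.+1 x0 T v0 u ut.
Proof.
move=> uc uxc utc up uxp utp ud udt ueq u0.
have uC t : C1 (u t) by exact: C1_build (up t) (jcont2 t uxc) (ud t).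
have du t : derive1 (u t) = ux t := is_derive_derive1 (ud t).
split=> //.
- move=> t; rewrite in_itv /= => tT; split=> //.
  apply/cvgrPdist_le => e e0; have e2 : 0 < e / 2 by lra.
  have [d1 d10 P1] := @jcont_near1_per _ _ t _ uc up e2.
  have [d2 d20 P2] := @jcont_near1_per _ _ t _ uxc uxp e2.
  apply/nbhs_withinP; exists (Num.min d1 d2) => [|s _]; first by rewrite lt_min d10.
  rewrite lt_min => /andP[s1 s2]; have [cB dB] := C1B (uC s) (uC t).
  rewrite sub0r normrN ger0_norm ?C1_norm_ge0 //.
  have -> : e = e / 2 + e / 2 by lra.
  apply: C1_norm_le => x; first exact: P1.
  by rewrite dB !du; exact: P2.
- move=> t; rewrite in_itv /= => tT; split.
  + exact: Linfty_continuous (jcont2 t uc) (up t).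
  + exact: Linfty_continuous (jcont2 t utc) (utp t).
  + apply/cvg_ereal0P => [s|e e0]; first exact: Linfty_norm_ge0.
    have [d d0 dP] := udt t e tT e0.
    apply/dnbhs_withinP; exists d => // s; rewrite /= in_itv /= => sT st sd.
    apply: Linfty_norm_le => x; have st0 : s - t != 0 by rewrite subr_eq0.
    have -> : (s - t)^-1 * (u s x - u t x) - ut t x =
      (s - t)^-1 * (u s x - u t x - (s - t) * ut t x) by field.
    by rewrite normrM normfV mulrC ler_pdivrMr ?normr_gt0 //; exact: dP.
  + apply/cvg_ereal0P => [s|e e0]; first exact: Linfty_norm_ge0.
    have [d d0 dP] := @jcont_near1_per _ _ t _ utc utp e0.
    apply/nbhs_withinP; exists d => // s _ sd.
    by apply: Linfty_norm_le => x; exact: dP.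
- move=> t; rewrite in_itv /= => tT; apply: aeW => x.
  by rewrite power_sourceE // du; exact: ueq.
Qed.

Lemma jcont_dx_inv (f : R -> R -> R) : jcont f -> jcont (fun t => dx_inv x0 (f t)).
Proof.
move=> fc; have mc : continuous (fun t => prim (f t) 1) := jcont1 1 (jcont_prim fc).
have gc : jcont (fun t x => f t x - prim (f t) 1) := ctsB fc (jcont_t mc).
have pc := jcont_prim gc; have c1 := jcont1 1 (jcont_prim pc).
rewrite /jcont; have -> : (fun z : R * R => dx_inv x0 (f z.1) z.2) = (fun z =>
    prim (fun y => f z.1 y - prim (f z.1) 1) z.2 -
    prim (prim (fun y => f z.1 y - prim (f z.1) 1)) 1).
  by apply/funext => -[t x] /=; rewrite dx_inv_prim //; exact: (jcont2 t fc).
exact: (ctsB pc (jcont_t c1)).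
Qed.

Section from_mHS.
Variables (T T1 : R) (v0 : R -> R) (w wt : R -> R -> R).
Hypotheses (T10 : 0 < T1) (T1T : T1 < T) (wS : mHS_solution q.+1 x0 T v0 w wt).

(** Solutions are frozen outside [0, T1] in order to work with functions
    defined for all times. *)
Definition frozen t := w (clamp T1 t).
Definition frozen_dx t := derive1 (frozen t).
Definition frozen_F t := dx_inv x0 (power_source (frozen t) (frozen_dx t)).
Definition frozen_dt t x := 2^-1 * frozen_F t x - frozen t x ^+ q.+1 * frozen_dx t x.

Let cT t : 0 <= clamp T1 t < T.
Proof.
by have /andP[h1 h2] := clamp_itv t (ltW T10); rewrite h1 (le_lt_trans h2).
Qed.

Let wC t : 0 <= t < T -> C1 (w t).
Proof. by move=> tT; case: wS => /(_ t); rewrite in_itv /= => /(_ tT) []. Qed.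

Let wcvg t e : 0 <= t < T -> 0 < e -> exists2 d : R, 0 < d & forall s x, 0 <= s < T ->
  `|s - t| < d -> `|w s x - w t x| <= e /\ `|derive1 (w s) x - derive1 (w t) x| <= e.
Proof.
move=> tT e0; case: wS => /(_ t); rewrite in_itv /= => /(_ tT) [_ H] _ _ _.
move: H => /cvgrPdist_le /(_ e e0) /nbhs_withinP [d d0 dP].
exists d => // s x sT st; have := dP s _ st; rewrite /= in_itv /= => /(_ sT).
have [cB dB] := C1B (wC sT) (wC tT).
rewrite sub0r normrN ger0_norm ?C1_norm_ge0 // => ne.
have [h1 h2] := le_C1_norm cB x.
by rewrite dB in h2; split; [exact: le_trans h1 ne|exact: le_trans h2 ne].
Qed.

Lemma is_derive_frozen t x : is_derive x 1 (frozen t) (frozen_dx t x).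
Proof. by apply: C1_is_derive; exact: wC. Qed.

Lemma frozen_periodic : xperiodic frozen.
Proof. by move=> t; case: (wC (cT t)). Qed.

Lemma frozen_dx_periodic : xperiodic frozen_dx.
Proof. by move=> t; apply: derive1_periodic; exact: wC. Qed.

Let jcont_both : jcont frozen /\ jcont frozen_dx.
Proof.
have fc t : continuous (frozen t) by exact: C1_continuous (wC (cT t)).
have dc t : continuous (frozen_dx t) by case: (wC (cT t)).
have H t e : 0 < e -> exists2 d : R, 0 < d & forall s x, `|s - t| < d ->
    `|frozen s x - frozen t x| <= e /\ `|frozen_dx s x - frozen_dx t x| <= e.
  move=> e0; have [d d0 dP] := wcvg (cT t) e0; exists d => // s x st.
  by apply: dP => //; exact: le_lt_trans (clamp_lip T1 s t) st.
split; apply/jcontP => t x e e0; have e2 : 0 < e / 2 by lra.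
- have [d d0 dP] := H t _ e2; have [d' d'0 d'P] := (continuousRP _ x).1 (fc t x) _ e2.
  exists (Num.min d d') => [|s y]; first by rewrite lt_min d0.
  rewrite !lt_min => /andP[/dP st _] /andP[_ /d'P yx]; have [h _] := st y.
  have := ler_normD (frozen s y - frozen t y) (frozen t y - frozen t x).
  by rewrite addrA subrK; lra.
- have [d d0 dP] := H t _ e2; have [d' d'0 d'P] := (continuousRP _ x).1 (dc t x) _ e2.
  exists (Num.min d d') => [|s y]; first by rewrite lt_min d0.
  rewrite !lt_min => /andP[/dP st _] /andP[_ /d'P yx]; have [_ h] := st y.
  have := ler_normD (frozen_dx s y - frozen_dx t y) (frozen_dx t y - frozen_dx t x).
  by rewrite addrA subrK; lra.
Qed.

Lemma jcont_frozen : jcont frozen. Proof. by case: jcont_both. Qed.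
Lemma jcont_frozen_dx : jcont frozen_dx. Proof. by case: jcont_both. Qed.

Lemma jcont_frozen_source : jcont (fun t => power_source (frozen t) (frozen_dx t)).
Proof.
have jp : jcont (fun t x => frozen t x ^+ q) := ctsX (n:=q) jcont_frozen.
have jp2 : jcont (fun t x => frozen_dx t x ^+ 2) := ctsX (n:=2) jcont_frozen_dx.
exact: (ctsM (ctsM (@ctsC _ _ q.+1%:R) jp) jp2).
Qed.

Lemma frozen_source_periodic : xperiodic (fun t => power_source (frozen t) (frozen_dx t)).
Proof. by move=> t x; rewrite /power_source frozen_periodic frozen_dx_periodic. Qed.

Lemma jcont_frozen_F : jcont frozen_F.
Proof. exact: jcont_dx_inv jcont_frozen_source. Qed.

Lemma frozen_F_periodic : xperiodic frozen_F.
Proof.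
move=> t; apply: dx_inv_periodic; first exact: (jcont2 t jcont_frozen_source).
exact: frozen_source_periodic.
Qed.

Lemma jcont_frozen_dt : jcont frozen_dt.
Proof.
have jp : jcont (fun t x => frozen t x ^+ q.+1) := ctsX (n:=q.+1) jcont_frozen.
exact: (ctsB (ctsM (@ctsC _ _ 2^-1) jcont_frozen_F) (ctsM jp jcont_frozen_dx)).
Qed.

Lemma frozen_dt_periodic : xperiodic frozen_dt.
Proof.
by move=> t x; rewrite /frozen_dt frozen_F_periodic frozen_periodic frozen_dx_periodic.
Qed.

Lemma frozen_dt_ae t : 0 <= t <= T1 -> {ae mu, forall x, wt t x = frozen_dt t x}.
Proof.
move=> /andP[t0 tT]; case: wS => _ _ /(_ t) + _.
rewrite in_itv /= t0 (le_lt_trans tT T1T) => /(_ isT).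
apply: (@filterS _ _ (ae_filter_ringOfSetsType mu)) => x /=.
have ct : clamp T1 t = t by rewrite clamp_id // t0.
have wd (y : R) : is_derive y 1 (w t) (frozen_dx t y).
  by have := is_derive_frozen t y; rewrite /frozen ct.
rewrite (power_sourceE wd) (is_derive_derive1 wd).
by rewrite /frozen_dt /frozen_F /frozen ct => <-; lra.
Qed.

(** The L^oo difference quotients converge uniformly, since they differ from
    the right hand side of the equation by continuous functions. *)
Lemma is_derive_frozen_dt t x : 0 < t < T1 -> is_derive t 1 (frozen^~ x) (frozen_dt t x).
Proof.
move=> /andP[t0 tT]; apply/is_derive_epsP => e e0.
have tT1 : 0 <= t <= T1 by rewrite !ltW.
case: wS => _ /(_ t) + _ _; rewrite in_itv /= (ltW t0) (lt_trans tT T1T).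
move=> /(_ isT) [_ _ + _].
move=> /cvg_ereal0P -/(_ (fun s => Linfty_norm_ge0 _)) /(_ e e0) /dnbhs_withinP[d d0 dP].
exists (Num.min d (Num.min t (T1 - t))).
  by rewrite !lt_min d0 t0 subr_gt0.
move=> s; rewrite !lt_min => /andP[sd /andP[st sT]].
have [->|nst] := eqVneq s t; first by rewrite !subrr mul0r subr0 normr0 mulr0.
have sT1 : 0 <= s <= T1.
  by move: st sT; rewrite !ltr_norml => /andP[? ?] /andP[? ?]; apply/andP; split; lra.
have sI : [set` `[0, T[] s.
  case/andP: sT1 => h1 h2; rewrite /= in_itv /= h1; exact: le_lt_trans h2 T1T.
have /Linfty_normP H := dP s sI nst sd.
have st0 : s - t != 0 by rewrite subr_eq0.
pose g (y : R) := (s - t)^-1 * (frozen s y - frozen t y) - frozen_dt t y.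
have gb : {ae mu, forall y, `|g y| <= e}.
  have := frozen_dt_ae tT1; move: H.
  apply: (@filterS2 _ _ (ae_filter_ringOfSetsType mu)) => y /= H E.
  by rewrite /g -E /frozen !clamp_id.
have fc r := jcont2 r jcont_frozen; have dc := jcont2 t jcont_frozen_dt.
have gc : continuous g := ctsB (ctsM (@ctsC _ _ _) (ctsB (fc s) (fc t))) dc.
have gp : periodic g 1.
  by move=> y; rewrite /g frozen_dt_periodic !frozen_periodic.
have := ae_continuous_le gc gp gb x.
have -> : frozen s x - frozen t x - (s - t) * frozen_dt t x = (s - t) * g x.
  by rewrite /g; field.
by rewrite normrM mulrC => gx; rewrite ler_wpM2r.
Qed.

End from_mHS.
End classical_solutions.

(** * From the circle to the Lagrangian system *)

Section lagrangian_form.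
Context {R : realType}.
Variables (q : nat) (T : R) (w wx F : R -> R -> R).
Implicit Types (a b d e s t x M L : R).
Local Notation src t := (power_source q (w t) (wx t)).
Hypotheses (T0 : 0 < T).
Hypotheses (wc : jcont w) (wxc : jcont wx) (Fc : jcont F).
Hypotheses (wp : xperiodic w) (wxp : xperiodic wx) (Fp : xperiodic F).
Hypothesis wd : forall t x, is_derive x 1 (w t) (wx t x).
Hypothesis Fd : forall t x, is_derive x 1 (F t) (src t x - prim (src t) 1).
Hypothesis Fm : forall t, prim (F t) 1 = 0.
Hypothesis wt : forall t x, 0 < t < T ->
  is_derive t 1 (w^~ x) (2^-1 * F t x - w t x ^+ q.+1 * wx t x).
Hypotheses (wz : forall t, w t = w (clamp T t)) (wxz : forall t, wx t = wx (clamp T t)).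

Let cI t : 0 <= clamp T t <= T := clamp_itv t (ltW T0).
Let clampK t : clamp T (clamp T t) = clamp T t := clamp_id (cI t).

Lemma frozen_bounded (f : R -> R -> R) : jcont f -> xperiodic f ->
  (forall t, f t = f (clamp T t)) -> exists2 M : R, 0 < M & forall t x, `|f t x| <= M.
Proof.
move=> fc fp fz; have [M M0 MP] := @jcont_bounded_per R f 0 T fc fp.
by exists M => // t x; rewrite fz; exact: MP.
Qed.

Let b t x := w t x ^+ q.+1.
Let bx t x := q.+1%:R * w t x ^+ q * wx t x.

Let bc : jcont b := ctsX (n:=q.+1) wc.
Let bxc : jcont bx.
Proof.
have c1 : jcont (fun t x => w t x ^+ q) := ctsX (n:=q) wc.
exact: (ctsM (ctsM (@ctsC _ _ q.+1%:R) c1) wxc).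
Qed.
Let bp : xperiodic b. Proof. by move=> t x; rewrite /b wp. Qed.
Let bxp : xperiodic bx. Proof. by move=> t x; rewrite /bx wp wxp. Qed.
Let bd t x : is_derive x 1 (b t) (bx t x). Proof. exact: is_derive_pow. Qed.
Let bz t : b t = b (clamp T t). Proof. by rewrite /b -wz. Qed.
Let bxz t : bx t = bx (clamp T t). Proof. by rewrite /bx -wz -wxz. Qed.

Let srcc : jcont (fun t => src t).
Proof.
have c1 : jcont (fun t x => w t x ^+ q) := ctsX (n:=q) wc.
have c2 : jcont (fun t x => wx t x ^+ 2) := ctsX (n:=2) wxc.
exact: (ctsM (ctsM (@ctsC _ _ q.+1%:R) c1) c2).
Qed.
Let srcp : xperiodic (fun t => src t).
Proof. by move=> t x; rewrite /power_source wp wxp. Qed.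

Definition velocity_lip L := forall t x x', `|b t x' - b t x| <= L * `|x' - x|.

Let lip_ex : exists2 L : R, 0 < L & (forall t x, `|bx t x| <= L) /\ velocity_lip L.
Proof.
have [L L0 LP] := frozen_bounded bxc bxp bxz; exists L => //; split=> // t x x'.
by have [c _ ->] := mean_value x x' (bd t); rewrite normrM ler_wpM2r.
Qed.

(** Used for the Lipschitz dependence on the label and, for equal initial values,
    for uniqueness, hence periodicity, of trajectories. *)
Lemma trajectory_stable (f g : R -> R) L : 0 <= L -> velocity_lip L ->
  continuous f -> continuous g ->
  (forall t, 0 <= t <= T -> f t = f 0 + prim (fun s => b s (f s)) t) ->
  (forall t, 0 <= t <= T -> g t = g 0 + prim (fun s => b s (g s)) t) ->
  forall t, 0 <= t <= T -> `|f t - g t| <= 2 * `|f 0 - g 0| * weight L T.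
Proof.
move=> L0 Lb fc gc fE gE t tT.
have bfc : continuous (fun s => b s (f s)) := jcont_comp bc cts_id fc.
have bgc : continuous (fun s => b s (g s)) := jcont_comp bc cts_id gc.
have dc : jcont (fun s (_ : R) => f s - g s) := jcont_t (ctsB fc gc).
have [A _ AP] := @jcont_bounded R _ 0 T 0 0 dc.
have := @gronwall R unit (fun t _ => f t - g t) (fun s _ => b s (f s) - b s (g s))
  L 0 `|f 0 - g 0| A T L0 (lexx 0) (normr_ge0 _).
move=> H; have {}H : `|f t - g t| <= 2 * (`|f 0 - g 0| + 0 * T) * weight L t.
  apply: (H _ _ _ _ _ t tt tT) => //.
  - by move=> s _ sT; apply: (AP s 0) => //; rewrite lexx.
  - by move=> _; exact: ctsB.
  - by move=> s _ sT; rewrite fE // gE // primB // opprD addrACA.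
  - move=> s d sT sd _; rewrite addr0; apply: le_trans (Lb _ _ _) _.
    by rewrite ler_wpM2l // (sd tt).
apply: le_trans H _; rewrite mul0r addr0 ler_wpM2l ?mulr_ge0 // weight_le //.
by case/andP: tT.
Qed.

(** The field is bounded and Lipschitz on the whole line, so every state is
    admissible for the iteration and the trajectories exist up to time T. *)
Lemma trajectories_exist : exists eta : R -> R -> R, [/\ jcont eta,
  (forall t, eta t = eta (clamp T t)), (forall x, eta 0 x = x) &
  forall t x, 0 <= t <= T -> eta t x = x + prim (fun s => b s (eta s x)) t].
Proof.
have [M M0 MP] := frozen_bounded bc bp bz.
have [L L0 [_ LP]] := lip_ex.
have [|||||| y [_ yM] yE] := @picard R R (fun t y x => b t (y x)) setT (fun x => x) M L T
  (ltW M0) (ltW L0) (ltW T0) => //.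
- move=> y [_ yM] x.
  have yc : continuous (fun s => y s x).
    by apply: (jcont1 x (@jcont_lip R (fun t _ => y t x) M _ _)) => // t; exact: ctsC.
  exact: jcont_comp bc cts_id yc.
- move=> t y z d _ _ yz x; apply: le_trans (LP _ _ _) _.
  by rewrite ler_wpM2l // ltW.
pose eta t := y (clamp T t).
have etaM s t x : `|eta s x - eta t x| <= M * `|s - t|.
  apply: le_trans (yM _ _ _) _.
  by apply: ler_wpM2l; [exact: ltW|exact: clamp_lip].
have ec x : continuous (fun s => eta s x).
  by apply: (jcont1 x (@jcont_lip R (fun t _ => eta t x) M _ _)) => // t; exact: ctsC.
have yc x : continuous (fun s => y s x).
  by apply: (jcont1 x (@jcont_lip R (fun t _ => y t x) M _ _)) => // t; exact: ctsC.
have etaE t x : 0 <= t <= T -> eta t x = x + prim (fun s => b s (eta s x)) t.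
  move=> tT; rewrite {1}/eta clamp_id // yE //; congr (_ + _).
  have /andP[t0 tT'] := tT; apply: eq_prim_itv => //.
  - exact: jcont_comp bc cts_id (yc x).
  - exact: jcont_comp bc cts_id (ec x).
  - by move=> s /andP[s0 st]; rewrite /eta clamp_id // s0 (le_trans st).
have eta0 x : eta 0 x = x by rewrite etaE ?prim0 ?addr0 // lexx ltW.
exists eta; split=> //.
- apply: (@jcont_lip _ _ M) => // t x; apply/continuousRP => e e0.
  pose C := 2 * weight L T; have C0 : 0 < C by rewrite mulr_gt0 // expR_gt0.
  exists (e / C) => [|x' xx']; first by rewrite divr_gt0.
  rewrite /eta -clampK -/(eta _ _) -/(eta _ _).
  have E z s : 0 <= s <= T -> eta s z = eta 0 z + prim (fun s => b s (eta s z)) s.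
    by move=> sT; rewrite eta0 etaE.
  have := trajectory_stable (ltW L0) LP (ec x') (ec x) (E x') (E x) (cI t).
  rewrite !eta0 => /le_trans; apply; rewrite mulrAC -/C mulrC -ler_pdivlMr //.
  exact: ltW.
- by move=> t; rewrite /eta clampK.
Qed.

Section trajectories.
Variable eta : R -> R -> R.
Hypotheses (ec : jcont eta) (etaz : forall t, eta t = eta (clamp T t)).
Hypothesis eta0 : forall x, eta 0 x = x.
Hypothesis etaE : forall t x, 0 <= t <= T ->
  eta t x = x + prim (fun s => b s (eta s x)) t.

Let etaE' x t : 0 <= t <= T -> eta t x = eta 0 x + prim (fun s => b s (eta s x)) t.
Proof. by move=> tT; rewrite eta0 etaE. Qed.

Lemma eta1 t x : eta t (x + 1) = eta t x + 1.
Proof.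
have [L L0 [_ LP]] := lip_ex; apply/eqP; rewrite -subr_eq0 -normr_le0 etaz.
have c1 := jcont1 (x + 1) ec.
have c2 : continuous (fun t => eta t x + 1) := ctsD (jcont1 x ec) (@ctsC _ _ 1).
have E2 s : 0 <= s <= T -> eta s x + 1 = (eta 0 x + 1) +
    prim (fun s => b s (eta s x + 1)) s.
  move=> sT; rewrite etaE' // addrAC; congr (_ + prim _ _).
  by apply/funext => r; rewrite bp.
have := trajectory_stable (ltW L0) LP c1 c2 (etaE' (x + 1)) E2 (cI t).
by rewrite !eta0 subrr normr0 mulr0 mul0r.
Qed.

Definition jac t x := expR (prim (fun s => bx s (eta s x)) (clamp T t)).

Let bxec : jcont (fun s x => bx s (eta s x)) := jcont_comp2 bxc ec.

Lemma jcont_jac : jcont jac.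
Proof.
have c1 : jcont (fun t x => prim (fun s => bx s (eta s x)) (clamp T t)).
  exact: jcont_compl (jcont_prim_t bxec) (@continuous_clamp R T).
exact: (ctsF (@continuous_expR R) c1).
Qed.

Lemma jac_gt0 t x : 0 < jac t x. Proof. exact: expR_gt0. Qed.

Lemma jac0 x : jac 0 x = 1.
Proof. by rewrite /jac clamp_id ?lexx ?ltW // prim0 expR0. Qed.

Lemma jacz t : jac t = jac (clamp T t).
Proof. by rewrite /jac clampK. Qed.

Lemma jac1 t x : jac t (x + 1) = jac t x.
Proof. by congr expR; congr prim; apply/funext => s; rewrite eta1 bxp. Qed.

Lemma is_derive_jac t x : 0 < t < T ->
  is_derive t 1 (jac^~ x) (bx t (eta t x) * jac t x).
Proof.
move=> tT; have d1 := @is_derive_prim _ _ t (jcont1 x bxec).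
have d2 : is_derive t 1 (fun s => expR (prim (fun s => bx s (eta s x)) s))
    (expR (prim (fun s => bx s (eta s x)) t) * bx t (eta t x)).
  exact: (@is_derive1_comp R expR (fun s => prim (fun s => bx s (eta s x)) s)).
have tT' : 0 <= t <= T by case/andP: tT => ? ?; rewrite !ltW.
rewrite /jac (clamp_id tT') mulrC; apply: near_eq_is_derive d2.
case/andP: tT => t0 tT; apply/nearRP; exists (Num.min t (T - t)).
  by rewrite lt_min subr_gt0 t0.
move=> s; rewrite lt_min !ltr_norml => /andP[/andP[? ?] /andP[? ?]].
by rewrite clamp_id //; apply/andP; split; lra.
Qed.

Lemma jac_eq t x : 0 <= t <= T ->
  jac t x = 1 + prim (fun s => bx s (eta s x) * jac s x) t.
Proof.
move=> tT; rewrite -(jac0 x); apply: (prim_itv (jcont1 x jcont_jac) _ _ tT).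
  exact: ctsM (jcont1 x bxec) (jcont1 x jcont_jac).
by move=> s sT; exact: is_derive_jac.
Qed.

(** The flow is differentiable in the label although the velocity is only C^1:
    its remainder solves a linear equation whose forcing is controlled by the
    modulus of continuity of bx. *)
Lemma is_derive_eta t x : is_derive x 1 (eta t) (jac t x).
Proof.
apply/is_derive_epsP => e e0.
have [L L0 [bxL LP]] := lip_ex.
pose W := weight L T; have W0 : 0 < W := expR_gt0 _.
have [D D0 DP] := @jcont_bounded R jac 0 T x x jcont_jac.
have DP' s : 0 <= s <= T -> `|jac s x| <= D by move=> sT; apply: DP; rewrite ?lexx.
(* om makes the Gronwall bound 2 (D om T) W of the remainder equal to e. *)
pose om := e / (2 * (D * T) * W); have om0 : 0 < om by rewrite divr_gt0 // !mulr_gt0.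
have [r r0 rP] := @jcont_unif2_per R bx 0 T om bxc bxp om0.
exists (r / (2 * W)) => [|x' xx']; first by rewrite divr_gt0 // mulr_gt0.
have close s : 0 <= s <= T -> `|eta s x' - eta s x| < r.
  move=> sT; apply: le_lt_trans (trajectory_stable (ltW L0) LP (jcont1 x' ec)
    (jcont1 x ec) (etaE' x') (etaE' x) sT) _.
  by rewrite !eta0 mulrAC mulrC -ltr_pdivlMr ?mulr_gt0.
pose f s := eta s x' - eta s x - (x' - x) * jac s x.
pose h s := b s (eta s x') - b s (eta s x) - (x' - x) * (bx s (eta s x) * jac s x).
have bec z : continuous (fun s => b s (eta s z)) := jcont_comp bc cts_id (jcont1 z ec).
have jc := jcont1 x jcont_jac; have bxe := jcont1 x bxec.
have bjc : continuous (fun s => bx s (eta s x) * jac s x) := ctsM bxe jc.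
have hc : continuous h.
  exact: ctsB (ctsB (bec x') (bec x)) (ctsM (@ctsC _ _ (x' - x)) bjc).
have fc : continuous f.
  exact: ctsB (ctsB (jcont1 x' ec) (jcont1 x ec)) (ctsM (@ctsC _ _ (x' - x)) jc).
have f0 : f 0 = 0 by rewrite /f !eta0 jac0 mulr1 subrr.
have [A _ AP] := @jcont_bounded R _ 0 T 0 0 (jcont_t fc).
have c0 : 0 <= `|x' - x| * (D * om) by apply: mulr_ge0 => //; apply: mulr_ge0; exact: ltW.
rewrite etaz [in jac t x]jacz -/(f (clamp T t)).
have := @gronwall R unit (fun s _ => f s) (fun s _ => h s) L (`|x' - x| * (D * om)) 0 A T
  (ltW L0) c0 (lexx 0).
move=> H; have {}H : `|f (clamp T t)| <=
    2 * (0 + `|x' - x| * (D * om) * T) * weight L (clamp T t).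
  apply: (H _ _ _ _ _ _ tt (cI t)) => //.
  - by move=> s _ sT; apply: (AP s 0) => //; rewrite lexx.
  - move=> s _ sT; rewrite f0 add0r /f /h etaE // (etaE x sT) jac_eq //.
    rewrite primB //; [|exact: ctsB|exact: ctsM (@ctsC _ _ (x' - x)) bjc].
    by rewrite primB // primZ //; ring.
  - by move=> _; rewrite f0 normr0.
  - move=> s d sT /(_ tt) fd _; rewrite /h.
    have [c cx ->] := mean_value (eta s x) (eta s x') (bd s).
    have -> : bx s c * (eta s x' - eta s x) - (x' - x) * (bx s (eta s x) * jac s x) =
      bx s c * f s + (x' - x) * (jac s x * (bx s c - bx s (eta s x))).
      by rewrite /f; ring.
    apply: le_trans (ler_normD _ _) _.
    rewrite (normrM (bx s c)) (normrM (x' - x)) (normrM (jac s x)).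
    apply: lerD; first by apply: ler_pM.
    rewrite ler_wpM2l //; apply: ler_pM => //; first exact: DP'.
    by apply: rP => //; apply: le_lt_trans cx (close s sT).
apply: le_trans H _; rewrite add0r.
have Wc : weight L (clamp T t) <= W.
  by apply: weight_le; [exact: ltW|case/andP: (cI t)].
apply: (@le_trans _ _ (2 * (`|x' - x| * (D * om) * T) * W)).
  apply: ler_wpM2l Wc; apply: mulr_ge0 => //; apply: mulr_ge0 => //; exact: ltW.
suff -> : 2 * (`|x' - x| * (D * om) * T) * W = e * `|x' - x| by [].
by rewrite /om; field; rewrite !gt_eqF.
Qed.

Definition lag_of t (i : coord) : R := match i with
  | Lb => eta t 0
  | La => w t (eta t 0)
  | LQ x => wx t (eta t x) * jac t x
  | LJ x => jac t x
  | LE x => wx t (eta t x) ^+ 2 * jac t x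
  end.

Let wec : jcont (fun t x => w t (eta t x)) := jcont_comp2 wc ec.
Let wxec : jcont (fun t x => wx t (eta t x)) := jcont_comp2 wxc ec.
Let Fec : jcont (fun t x => F t (eta t x)) := jcont_comp2 Fc ec.
Let srcec : jcont (fun t x => src t (eta t x)) := jcont_comp2 srcc ec.
Let Qc : jcont (fun t x => wx t (eta t x) * jac t x) := ctsM wxec jcont_jac.
Let Ec : jcont (fun t x => wx t (eta t x) ^+ 2 * jac t x).
Proof.
have c1 : jcont (fun t x => wx t (eta t x) ^+ 2) := ctsX (n:=2) wxec.
exact: (ctsM c1 jcont_jac).
Qed.

Lemma lag_of_frozen t : lag_of t = lag_of (clamp T t).
Proof.
apply/funext => -[||x|x|x] /=; by rewrite -?etaz -?jacz -?wz -?wxz.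
Qed.

Lemma lag_of_U t x : lagU (lag_of t) x = w t (eta t x).
Proof.
rewrite /lagU /=; apply/esym.
apply: (@prim_unique _ (fun x => wx t (eta t x) * jac t x) (fun x => w t (eta t x))).
  exact: (jcont2 t Qc).
move=> z; have d1 := wd t (eta t z); have d2 := is_derive_eta t z.
exact: (@is_derive1_comp R (w t) (eta t)).
Qed.

Let eta01 t : eta t 1 = eta t 0 + 1. Proof. by rewrite -eta1 add0r. Qed.

Lemma lag_of_adm : exists2 K : R, 0 <= K & forall t, adm K (lag_of t).
Proof.
have P1 f : jcont f -> (forall t x, f t x = f (clamp T t) x) -> exists2 M : R, 0 < M &
    forall t, `|f t 0| <= M.
  move=> fc fz; have [M M0 MP] := @jcont_bounded R f 0 T 0 0 fc.
  by exists M => // t; rewrite fz; apply: MP => //; rewrite lexx.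
have P2 f : jcont f -> (forall t x, f t x = f (clamp T t) x) -> xperiodic f ->
    exists2 M : R, 0 < M & forall t x, `|f t x| <= M.
  by move=> fc fz fp; apply: frozen_bounded => // t; apply/funext => x; exact: fz.
have Z i t : lag_of t i = lag_of (clamp T t) i by rewrite -lag_of_frozen.
have pQ : xperiodic (fun t x => wx t (eta t x) * jac t x).
  by move=> t x; rewrite eta1 wxp jac1.
have pE : xperiodic (fun t x => wx t (eta t x) ^+ 2 * jac t x).
  by move=> t x; rewrite eta1 wxp jac1.
have [M1 M10 B1] := P1 eta ec (fun t x => congr1 (@^~ x) (etaz t)).
have wz' t x : w t (eta t x) = w (clamp T t) (eta (clamp T t) x) by rewrite -wz -etaz.
have [M2 M20 B2] := P1 _ wec wz'.
have [M3 M30 B3] := P2 _ Qc (fun t x => Z (LQ x) t) pQ.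
have [M4 M40 B4] := P2 _ jcont_jac (fun t x => Z (LJ x) t) jac1.
have [M5 M50 B5] := P2 _ Ec (fun t x => Z (LE x) t) pE.
exists (M1 + M2 + M3 + M4 + M5); first by lra.
move=> t; split => /=.
- case=> [||x|x|x] /=.
  + by have := B1 t; lra.
  + by have := B2 t; lra.
  + by have := B3 t x; lra.
  + by have := B4 t x; lra.
  + by have := B5 t x; lra.
- exact: (jcont2 t Qc).
- exact: (jcont2 t jcont_jac).
- exact: (jcont2 t Ec).
- exact: pQ.
- exact: jac1.
- exact: pE.
- have := lag_of_U t 1; rewrite /lagU /= eta01 wp; lra.
- have := @prim_unique _ (jac t) (eta t) 1 (jcont2 t jcont_jac) (is_derive_eta t).
  by rewrite eta01; lra.
Qed.

Local Notation mean t := (prim (src t) 1).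

Lemma lag_of_k t x : lagk q (lag_of t) x = q.+1%:R * w t (eta t x) ^+ q.
Proof. by rewrite /lagk lag_of_U. Qed.

Lemma lag_of_m t : lagm q (lag_of t) = mean t.
Proof.
rewrite /lagm -(prim_circle_map (jcont2 t srcc) (@srcp t) (jcont2 t jcont_jac)
  (is_derive_eta t) (eta01 t)).
congr prim; apply/funext => x.
by rewrite lag_of_k /= mulrA.
Qed.

Lemma lag_of_g t x : lagg q (lag_of t) x = (src t (eta t x) - mean t) * jac t x.
Proof. by rewrite /lagg lag_of_m lag_of_k /= /power_source; ring. Qed.

Lemma lag_of_G t x : lagG q (lag_of t) x = F t (eta t x) - F t (eta t 0).
Proof.
have c : continuous (fun x => (src t (eta t x) - mean t) * jac t x).
  exact: ctsM (ctsB (jcont2 t srcec) (@ctsC _ _ _)) (jcont2 t jcont_jac).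
have D (z : R) : is_derive z 1 (fun x => F t (eta t x)) ((src t (eta t z) - mean t) * jac t z).
  have d1 := Fd t (eta t z); have d2 := is_derive_eta t z.
  exact: (@is_derive1_comp R (F t) (eta t)).
have -> := prim_unique x c D.
rewrite /lagG addrC addKr; congr prim; apply/funext => z; exact: lag_of_g.
Qed.

(** F has zero mean on the circle, so F(eta) has zero mean for the density J. *)
Lemma lag_of_V t x : lagV q (lag_of t) x = 2^-1 * F t (eta t x).
Proof.
have Fcc := jcont2 t Fec; have jc := jcont2 t jcont_jac.
have c : continuous (fun x => F t (eta t x) * jac t x) := ctsM Fcc jc.
have E : prim (fun x => lagG q (lag_of t) x * jac t x) 1 = - F t (eta t 0).
  have -> : (fun x => lagG q (lag_of t) x * jac t x) =
      (fun x => F t (eta t x) * jac t x - F t (eta t 0) * jac t x).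
    by apply/funext => z; rewrite lag_of_G mulrBl.
  rewrite primB //; last exact: ctsM (@ctsC _ _ _) jc.
  rewrite primZ // (prim_circle_map (jcont2 t Fc) (@Fp t) jc (is_derive_eta t) (eta01 t)).
  have := @prim_unique _ (jac t) (eta t) 1 jc (is_derive_eta t); rewrite eta01 Fm.
  by move=> /addrI <-; rewrite mulr1 sub0r.
by rewrite /lagV /= E lag_of_G; congr (_ * _); lra.
Qed.

Lemma lag_of_eqU t x : 0 <= t <= T ->
  w t (eta t x) = w 0 x + prim (fun s => 2^-1 * F s (eta s x)) t.
Proof.
move=> tT; rewrite -{2}(eta0 x).
have c : continuous (fun s => 2^-1 * F s (eta s x)).
  exact: ctsM (@ctsC _ _ _) (jcont1 x Fec).
apply: (prim_itv (jcont1 x wec) c _ tT) => s sT.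
have bcx : continuous (fun s => b s (eta s x)) := jcont_comp bc cts_id (jcont1 x ec).
have de := is_derive_itv bcx (etaE' x) sT.
have := is_derive_along wxc wd (wt (eta s x) sT) de.
by congr is_derive; rewrite /b; ring.
Qed.

(** u_x has no derivative along a trajectory that could be computed directly,
    since u_xx need not exist.  Instead U - U(0) is written in two ways as a
    primitive in the label: of Q, and, after an exchange of integrals in its
    time equation, of the right hand side. *)
Lemma lag_of_eqQ t x : 0 <= t <= T ->
  wx t (eta t x) * jac t x = wx 0 x +
    prim (fun s => 2^-1 * ((src s (eta s x) - mean s) * jac s x)) t.
Proof.
move=> tT.
have mc : continuous (fun s => mean s) := jcont1 1 (jcont_prim srcc).
pose h s x := 2^-1 * ((src s (eta s x) - mean s) * jac s x).
have hc : jcont h.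
  exact: (ctsM (@ctsC _ _ 2^-1) (ctsM (ctsB srcec (jcont_t mc)) jcont_jac)).
pose r z := wx 0 z + prim (h^~ z) t.
have rc : continuous r := ctsD (jcont2 0 wxc) (jcont2 t (jcont_prim_t hc)).
have w0 z : prim (wx 0) z = w 0 z - w 0 0.
  by have := prim_unique z (jcont2 0 wxc) (fun z => wd 0 z); lra.
have hF s z : prim (h s) z = 2^-1 * F s (eta s z) - 2^-1 * F s (eta s 0).
  rewrite /h primZ; first by rewrite -mulrBr -lag_of_G; congr (_ * prim _ _);
    apply/funext => y; rewrite lag_of_g.
  exact: ctsM (ctsB (jcont2 s srcec) (@ctsC _ _ _)) (jcont2 s jcont_jac).
have Fcx y : continuous (fun s => 2^-1 * F s (eta s y)).
  exact: ctsM (@ctsC _ _ _) (jcont1 y Fec).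
have E z : w t (eta t z) = w t (eta t 0) + prim r z.
  rewrite /r primD; [|exact: (jcont2 0 wxc)|exact: (jcont2 t (jcont_prim_t hc))].
  rewrite prim_exchange // w0 !lag_of_eqU //.
  have -> : (fun s => prim (h s) z) =
      (fun s => 2^-1 * F s (eta s z) - 2^-1 * F s (eta s 0)).
    by apply/funext => s; exact: hF.
  rewrite (primB _ (@Fcx z) (@Fcx 0)); lra.
have D1 : is_derive x 1 (fun z => w t (eta t z)) (wx t (eta t x) * jac t x).
  have d1 := wd t (eta t x); have d2 := is_derive_eta t x.
  exact: (@is_derive1_comp R (w t) (eta t)).
have D2 : is_derive x 1 (fun z => w t (eta t z)) (r x).
  have -> : (fun z => w t (eta t z)) = (fun z => w t (eta t 0) + prim r z).
    by apply/funext => z; exact: E.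
  rewrite -[r x]add0r; have ? := @is_derive_prim _ _ x rc; exact: is_deriveD.
by case: D1 => _ E1; case: D2 => _ E2; exact: etrans (esym E1) E2.
Qed.

(** E = Q ^ 2 / J, and both Q and J are differentiable in time. *)
Lemma lag_of_eqE t x : 0 <= t <= T ->
  wx t (eta t x) ^+ 2 * jac t x = wx 0 x ^+ 2 +
    prim (fun s => - (mean s * (wx s (eta s x) * jac s x))) t.
Proof.
move=> tT.
have mc : continuous (fun s => mean s) := jcont1 1 (jcont_prim srcc).
have c : continuous (fun s => - (mean s * (wx s (eta s x) * jac s x))).
  exact: ctsN (ctsM mc (jcont1 x Qc)).
have -> : wx 0 x ^+ 2 = wx 0 (eta 0 x) ^+ 2 * jac 0 x by rewrite jac0 mulr1 eta0.
apply: (prim_itv (jcont1 x Ec) c _ tT) => s sT.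
pose Q s := wx s (eta s x) * jac s x.
have c2 : continuous (fun s => 2^-1 * ((src s (eta s x) - mean s) * jac s x)).
  apply: ctsM (@ctsC _ _ _) (ctsM (ctsB (jcont1 x srcec) mc) (jcont1 x jcont_jac)).
have Q0 : Q 0 = wx 0 x by rewrite /Q jac0 mulr1 eta0.
have dQ : is_derive s 1 Q (2^-1 * ((src s (eta s x) - mean s) * jac s x)).
  apply: (is_derive_itv c2 _ sT) => r rT; rewrite Q0; exact: lag_of_eqQ.
have dJ := is_derive_jac x sT.
have j0 r : jac r x != 0 by rewrite gt_eqF // jac_gt0.
have dV : is_derive s 1 (fun s => (jac s x)^-1)
    (- (jac s x) ^- 2 * (bx s (eta s x) * jac s x)).
  exact: (@is_deriveV R (jac^~ x) s _ 1 (j0 s) dJ).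
have d2 := is_derive_pow 1 dQ.
have d3 := is_derive_mul d2 dV.
have EQ : (fun s => wx s (eta s x) ^+ 2 * jac s x) =
    (fun s => Q s ^+ 2 * (jac s x)^-1).
  apply/funext => r; rewrite /Q; move: (jac r x) (j0 r) (wx r (eta r x)) => j j1 v.
  by field.
rewrite EQ.
apply: (@eq_rect _ _ (fun d => is_derive s 1 _ d) d3).
rewrite /Q /bx /power_source.
move: (jac s x) (j0 s) (wx s (eta s x)) (w s (eta s x) ^+ q) (mean s) => j j1 v k m.
by rewrite /GRing.scale /=; field.
Qed.

Theorem lag_of_sol : exists2 K : R, 0 <= K & lag_sol q K T lag_of.
Proof.
have [K K0 zK] := lag_of_adm; exists K => //.
have [C [C0 Cb _]] := lagN_constant q K0.
have mc : continuous (fun s => mean s) := jcont1 1 (jcont_prim srcc).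
have nc i : continuous (fun t => lagN q (lag_of t) i).
  have jk : jcont (fun t x => q.+1%:R * w t (eta t x) ^+ q).
    by have c1 : jcont (fun t x => w t (eta t x) ^+ q) := ctsX (n:=q) wec;
      exact: (ctsM (@ctsC _ _ q.+1%:R) c1).
  case: i => [||x|x|x] /=.
  - exact: ctsX (jcont1 0 wec).
  - under eq_fun do rewrite lag_of_V.
    exact: ctsM (@ctsC _ _ _) (jcont1 0 Fec).
  - under eq_fun do rewrite lag_of_g.
    exact: ctsM (@ctsC _ _ _) (ctsM (ctsB (jcont1 x srcec) mc) (jcont1 x jcont_jac)).
  - under eq_fun do rewrite lag_of_k.
    exact: ctsM (jcont1 x jk) (jcont1 x Qc).
  - under eq_fun do rewrite lag_of_m.
    exact: ctsN (ctsM mc (jcont1 x Qc)).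
have zE t i : 0 <= t <= T -> lag_of t i = lag_of 0 i + prim (fun s => lagN q (lag_of s) i) t.
  move=> tT; case: i => [||x|x|x] /=.
  - by rewrite etaE'.
  - rewrite lag_of_eqU // eta0; congr (_ + prim _ _); apply/funext => s.
    by rewrite lag_of_V.
  - rewrite lag_of_eqQ // eta0 jac0 mulr1; congr (_ + prim _ _); apply/funext => s.
    by rewrite lag_of_g.
  - rewrite jac_eq // jac0; congr (_ + prim _ _); apply/funext => s.
    by rewrite lag_of_k /bx; ring.
  - rewrite (lag_of_eqE x tT) eta0 jac0 mulr1.
    by under [in RHS]eq_fun do rewrite lag_of_m.
split=> //; exists C => s t i.
rewrite (lag_of_frozen s) (lag_of_frozen t) (zE _ i (cI s)) (zE _ i (cI t)).
rewrite opprD addrACA subrr add0r.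
apply: (@le_trans _ _ (C * `|clamp T s - clamp T t|)).
  by apply: prim_lip => // r _; exact: Cb.
by apply: ler_wpM2l => //; exact: clamp_lip.
Qed.

End trajectories.
End lagrangian_form.

(** * Comparison of solutions *)

Section well_posedness.
Context {R : realType}.
Variables (q : nat) (x0 : R).
Implicit Types (f : R -> R) (a b d e s t x M A C K T : R).

Definition lag_init f (i : coord) : R := match i with
  | Lb => 0
  | La => f 0
  | LQ x => derive1 f x
  | LJ x => 1
  | LE x => derive1 f x ^+ 2
  end.

Lemma lag_init_adm f A : C1 f -> (forall x, `|f x| <= A) ->
  (forall x, `|derive1 f x| <= A) -> adm (A + A ^+ 2 + 1) (lag_init f).
Proof.
move=> fC fA dA; have A0 : 0 <= A by apply: le_trans (fA 0).
have A2 : 0 <= A ^+ 2 by rewrite exprn_ge0.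
have dp := derive1_periodic fC; have fp : periodic f 1 by case: fC.
have dc : continuous (derive1 f) by case: fC.
split=> //=.
- case=> [||x|x|x] /=; first by rewrite normr0; lra.
  + by have := fA 0; lra.
  + by have := dA x; lra.
  + by rewrite normr1; lra.
  + rewrite normrX; have : `|derive1 f x| ^+ 2 <= A ^+ 2.
      by rewrite ler_pXn2r ?nnegrE.
    by lra.
- exact: ctsC.
- exact: ctsX.
- by move=> x; rewrite dp.
- have := prim_unique 1 dc (fun x => C1_is_derive x fC).
  by rewrite -{1}[1](add0r 1) fp; lra.
- by rewrite prim_cst mul1r.
Qed.

Lemma lag_init_dist f g A d : C1 f -> C1 g -> (forall x, `|derive1 f x| <= A) ->
  (forall x, `|derive1 g x| <= A) -> C1_norm (f \- g) <= d ->
  forall i, `|lag_init f i - lag_init g i| <= (1 + 2 * A) * d.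
Proof.
move=> fC gC fA gA fgd i; have A0 : 0 <= A by apply: le_trans (fA 0).
have [cB dB] := C1B fC gC; have d0 : 0 <= d := le_trans (C1_norm_ge0 cB) fgd.
have Ad : 0 <= A * d by rewrite mulr_ge0.
have H x : `|derive1 f x - derive1 g x| <= d.
  by have [_] := le_C1_norm cB x; rewrite dB; lra.
case: i => [||x|x|x] /=.
- by rewrite subrr normr0; lra.
- by have [] := le_C1_norm cB 0; rewrite /=; lra.
- by have := H x; lra.
- by rewrite subrr normr0; lra.
- rewrite subr_sqr normrM mulrC.
  have : `|derive1 f x + derive1 g x| <= 2 * A.
    by apply: le_trans (ler_normD _ _) _; have := fA x; have := gA x; lra.
  move=> h; apply: (@le_trans _ _ (2 * A * d)); last lra.
  exact: ler_pM.
Qed.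

Lemma lag_solW K K' T T' y : K <= K' -> T' <= T -> lag_sol q K T y -> lag_sol q K' T' y.
Proof.
move=> KK TT [yK yM yE]; split=> //.
  by move=> t; case: (yK t) => H *; split=> // i; exact: le_trans (H i) KK.
by move=> t i /andP[t0 tT]; apply: yE; rewrite t0 (le_trans tT).
Qed.

(** The bounds of w may blow up at T.  They are finite on [0, T1], which gives a
    constant K that depends on w and T1. *)
Lemma mHS_lagrangian T T1 v0 (w wt : R -> R -> R) : 0 < T1 -> T1 < T ->
  mHS_solution q.+1 x0 T v0 w wt -> exists (z : R -> state) (K : R), [/\ 0 <= K, lag_sol q K T1 z,
    z 0 = lag_init v0 &
    forall t x, 0 <= t <= T1 -> w t (flow z t x) = lagU (z t) x].
Proof.
move=> T10 T1T wS; pose W := frozen T1 w; pose Wx := frozen_dx T1 w.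
pose F := frozen_F q x0 T1 w.
have Wc : jcont W := jcont_frozen T10 T1T wS.
have Wxc : jcont Wx := jcont_frozen_dx T10 T1T wS.
have Fc : jcont F := jcont_frozen_F T10 T1T wS.
have Wp : xperiodic W := frozen_periodic T10 T1T wS.
have Wxp : xperiodic Wx := frozen_dx_periodic T10 T1T wS.
have Fp : xperiodic F := frozen_F_periodic T10 T1T wS.
have Wd t x : is_derive x 1 (W t) (Wx t x) := is_derive_frozen T10 T1T wS t x.
have srcc : jcont (fun t => power_source q (W t) (Wx t)) := jcont_frozen_source T10 T1T wS.
have Fd t x : is_derive x 1 (F t)
    (power_source q (W t) (Wx t) x - prim (power_source q (W t) (Wx t)) 1).
  by apply: is_derive_dx_inv; exact: (jcont2 t srcc).
have Fm t : prim (F t) 1 = 0 by apply: prim_dx_inv; exact: (jcont2 t srcc).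
have Wt t x : 0 < t < T1 ->
    is_derive t 1 (W^~ x) (2^-1 * F t x - W t x ^+ q.+1 * Wx t x).
  exact: (is_derive_frozen_dt T10 T1T wS).
have cc t : clamp T1 (clamp T1 t) = clamp T1 t := clamp_id (clamp_itv t (ltW T10)).
have Wz t : W t = W (clamp T1 t) by rewrite /W /frozen cc.
have Wxz t : Wx t = Wx (clamp T1 t) by rewrite /Wx /frozen_dx /frozen cc.
have [eta [ec etaz eta0 etaE]] := trajectories_exist q T10 Wc Wxc Wp Wxp Wd Wz Wxz.
have [K K0 zS] := lag_of_sol T10 Wc Wxc Fc Wp Wxp Fp Wd Fd Fm Wt Wz Wxz ec etaz eta0 etaE.
pose z := lag_of q T1 W Wx eta.
have zU := lag_of_U T10 Wc Wxc Wp Wxp Wd Wz Wxz ec etaz eta0 etaE.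
have etad := is_derive_eta T10 Wc Wxc Wp Wxp Wd Wz Wxz ec etaz eta0 etaE.
have zF t x : flow z t x = eta t x.
  rewrite /flow (prim_unique x _ (etad t)) //.
  exact: (adm_cJ (lag_adm zS t)).
have w0 : W 0 = v0.
  apply/funext => x; rewrite /W /frozen clamp_id ?lexx ?ltW //.
  by case: wS => _ _ _ ->.
exists z, K; split=> //.
- have wx0 : Wx 0 = derive1 v0 by rewrite -w0.
  by apply/funext => -[||x|x|x] /=; rewrite ?eta0 ?w0 ?wx0 ?(jac0 q W Wx T10) ?mulr1.
- by move=> t x tT; rewrite zF /z zU /W /frozen clamp_id.
Qed.

(** The comparison of two Eulerian fields goes through their Lagrangian forms:
    the second field has to be uniformly continuous, because the two flows send
    a label to different points. *)
Lemma eulerian_close K T (y : R -> state) (H : R -> R -> R)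
    (K0 : 0 <= K) (yS : lag_sol q K T y) (yJ : forall t x, 2^-1 <= y t (LJ x)) e :
  jcont H -> xperiodic H -> 0 < e -> exists2 r : R, 0 < r &
  forall (z : R -> state) (G : R -> R -> R) (zS : lag_sol q K T z)
    (zJ : forall t x, 2^-1 <= z t (LJ x)) t, 0 <= t <= T ->
    (forall i, `|z t i - y t i| <= r) -> (forall x, `|G t x - H t x| <= e / 2) ->
    forall x, `|eulerian K0 zS zJ G t x - eulerian K0 yS yJ H t x| <= e.
Proof.
move=> Hc Hp e0; have e2 : 0 < e / 2 by lra.
have hc : jcont (eulerian K0 yS yJ H) by exact: jcont_eulerian.
have hp : xperiodic (eulerian K0 yS yJ H) by exact: eulerian_periodic.
have [r r0 rP] := @jcont_unif2_per _ _ 0 T _ hc hp e2.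
exists (r / 3) => [|z G zS zJ t tT zy GH x]; first lra.
pose X := label K0 zS zJ t x; have xX : flow z t X = x := flowK K0 zS zJ t x.
have yK := lag_adm yS t; have zK := lag_adm zS t.
have r30 : 0 <= r / 3 by lra.
have fl : `|flow z t X - flow y t X| < r.
  have cz := adm_cJ zK; have cy := adm_cJ yK.
  have : `|prim (fun x => z t (LJ x)) X - prim (fun x => y t (LJ x)) X| <= r / 3.
    rewrite -primB //; apply: (@prim_mean0_bound _ (fun x => z t (LJ x) - y t (LJ x))).
    + exact: ctsB.
    + by move=> v; rewrite (adm_pJ zK) (adm_pJ yK).
    + by rewrite primB // (adm_mJ zK) (adm_mJ yK) subrr.
    + by move=> v; exact: zy.
  have := zy Lb; rewrite /flow.
  have := ler_normD (z t Lb - y t Lb)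
    (prim (fun x => z t (LJ x)) X - prim (fun x => y t (LJ x)) X).
  by rewrite addrACA -opprD; lra.
have h1 := GH X.
have h2 := rP t _ _ tT fl.
have E1 : eulerian K0 yS yJ H t (flow y t X) = H t X by rewrite /eulerian labelK.
have E2 : eulerian K0 zS zJ G t x = G t X by [].
rewrite xX E1 in h2; rewrite E2.
have := ler_normB (G t X - H t X) (eulerian K0 yS yJ H t x - H t X).
rewrite opprB addrA subrK; lra.
Qed.

(** J is at least 1/2, so that the division in W = Q / J is harmless. *)
Lemma eulerian_lip K : 0 <= K -> exists2 C : R, 0 <= C &
  forall (y z : R -> state) t d, adm K (y t) -> adm K (z t) ->
    (forall x, 2^-1 <= y t (LJ x)) -> (forall x, 2^-1 <= z t (LJ x)) ->
    (forall i, `|y t i - z t i| <= d) -> forall x,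
    [/\ `|lagU (y t) x - lagU (z t) x| <= C * d,
        `|lagW y t x - lagW z t x| <= C * d &
        `|lagA q y t x - lagA q z t x| <= C * d].
Proof.
move=> K0; have [CU UT] := tame_U K0; have [CV VT] := tame_V q K0.
have [CP PT] := tameX q.+1 UT.
have U0 := tame_ge0 UT; have V0 := tame_ge0 VT; have P0 := tame_ge0 PT.
pose CW := 2 + 4 * K; have W0 : 0 <= CW by rewrite /CW; lra.
have PK0 : 0 <= CP * (2 * K) by rewrite !mulr_ge0.
have PW0 : 0 <= CP * CW by rewrite mulr_ge0.
exists (CU + CW + CV + CP * (2 * K) + CP * CW); first by lra.
move=> y z t d yK zK yJ zJ yz x; have d0 : 0 <= d := le_trans (normr_ge0 _) (yz La).
have hU := tame_lip UT yK zK yz x; have hV := tame_lip VT yK zK yz x.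
have hP := tame_lip PT yK zK yz x.
have inv (s : R) : 2^-1 <= s -> `|s^-1| <= 2.
  move=> s2; have s0 : 0 < s by apply: lt_le_trans s2; rewrite invr_gt0.
  rewrite ger0_norm; last by rewrite invr_ge0 ltW.
  by rewrite -[leRHS]invrK lef_pV2 ?posrE // invr_gt0.
have nz (s : R) : 2^-1 <= s -> s != 0.
  by move=> s2; rewrite gt_eqF // (lt_le_trans _ s2) // invr_gt0.
have hW : `|lagW y t x - lagW z t x| <= CW * d.
  have -> : lagW y t x - lagW z t x = (y t (LQ x) - z t (LQ x)) * (y t (LJ x))^-1
      + z t (LQ x) * (y t (LJ x))^-1 * (z t (LJ x))^-1 * (z t (LJ x) - y t (LJ x)).
    by rewrite /lagW; field; rewrite !nz.
  apply: le_trans (ler_normD _ _) _; rewrite !normrM [`|z t _ - y t _|]distrC.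
  have i1 := inv _ (yJ x); have i2 := inv _ (zJ x).
  have -> : CW * d = d * 2 + K * 2 * 2 * d by rewrite /CW; ring.
  apply: lerD; first by apply: ler_pM.
  apply: ler_pM => //; apply: ler_pM => //; apply: ler_pM => //.
  exact: adm_le.
have bW : `|lagW y t x| <= 2 * K.
  rewrite /lagW normrM mulrC; apply: ler_pM => //; [exact: inv|exact: adm_le].
have hA : `|lagA q y t x - lagA q z t x| <= (CV + CP * (2 * K) + CP * CW) * d.
  have -> : lagA q y t x - lagA q z t x = (lagV q (y t) x - lagV q (z t) x)
      - ((lagU (y t) x ^+ q.+1 - lagU (z t) x ^+ q.+1) * lagW y t x
      + lagU (z t) x ^+ q.+1 * (lagW y t x - lagW z t x)).
    by rewrite /lagA; ring.
  have -> : (CV + CP * (2 * K) + CP * CW) * d =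
      CV * d + (CP * d * (2 * K) + CP * (CW * d)) by ring.
  apply: le_trans (ler_normB _ _) _; apply: lerD => //.
  apply: le_trans (ler_normD _ _) _; rewrite (normrM (_ - _)) (normrM (_ ^+ _)).
  apply: lerD; apply: ler_pM => //; exact: (tame_le PT).
have Ud : 0 <= CU * d by rewrite mulr_ge0.
have Vd : 0 <= CV * d by rewrite mulr_ge0.
have Wd : 0 <= CW * d by rewrite mulr_ge0.
have PKd : 0 <= CP * (2 * K) * d by rewrite mulr_ge0.
have PWd : 0 <= CP * CW * d by rewrite mulr_ge0.
have {}hA := le_trans hA (_ : _ <= CV * d + CP * (2 * K) * d + CP * CW * d).
have -> : (CU + CW + CV + CP * (2 * K) + CP * CW) * d =
  CU * d + CW * d + (CV * d + CP * (2 * K) * d + CP * CW * d) by ring.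
by split; [lra|lra|apply: le_trans (hA _) _; [rewrite -!mulrDl|lra]].
Qed.

End well_posedness.

(** * The solution map *)

Section solution_map.
Context {R : realType}.
Variables (q : nat) (x0 K T : R).
Hypotheses (K0 : 0 <= K) (T0 : 0 < T).
Implicit Types (a b d e s t x M A C : R).

Section one_solution.
Variables (v0 : R -> R) (y : R -> state (R := R)).
Hypotheses (v0C : C1 v0) (yS : lag_sol q K T y) (y0 : y 0 = lag_init v0).
Hypothesis yJ : forall t x, 2^-1 <= y t (LJ x).
Local Notation u := (eulerian K0 yS yJ (fun t => lagU (y t))).
Local Notation ux := (eulerian K0 yS yJ (lagW y)).
Local Notation ut := (eulerian K0 yS yJ (lagA q y)).

Let yE x : y 0 (LE x) * y 0 (LJ x) = y 0 (LQ x) ^+ 2.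
Proof. by rewrite y0 /= mulr1. Qed.

Let tW t : 0 <= t < T -> 0 <= t <= T.
Proof. by move=> /andP[-> /ltW]. Qed.

Lemma eulerian_init : u 0 =1 v0.
Proof.
move=> x; have dc : continuous (derive1 v0) by case: v0C.
have fl z : flow y 0 z = z by rewrite /flow y0 /= prim_cst mul1r add0r.
have lab : label K0 yS yJ 0 x = x by rewrite -{1}(fl x) labelK.
rewrite /eulerian lab y0 /lagU /=.
by rewrite [RHS](prim_unique x dc (fun z => C1_is_derive z v0C)).
Qed.

Lemma eulerian_mHS : mHS_solution q.+1 x0 T v0 u ut.
Proof.
apply: (@classical_mHS _ _ _ _ _ _ ux).
- exact: jcont_u.
- exact: jcont_ux.
- exact: jcont_ut.
- exact: u_periodic.
- exact: ux_periodic.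
- exact: ut_periodic.
- by move=> t x; exact: is_derive_u.
- move=> t e tT e0; have [d d0 dP] := u_time_derivative K0 yS yJ (tW tT) e0.
  by exists d => // s x sT; apply: dP; exact: tW.
- by move=> t x tT; exact: eulerian_equation yE _ _ _ (tW tT).
- exact: eulerian_init.
Qed.

(** No bound on w is known in advance: stability of the Lagrangian system is
    applied on [0, T1] with a constant M that bounds both curves. *)
Lemma mHS_eulerian w wt t : mHS_solution q.+1 x0 T v0 w wt -> 0 <= t < T ->
  w t = u t.
Proof.
move=> wS /andP[t0 tT]; pose T1 := (t + T) / 2.
have T10 : 0 < T1 by rewrite /T1; lra.
have T1T : T1 < T by rewrite /T1; lra.
have tT1 : 0 <= t <= T1 by rewrite t0 /= /T1; lra.
have [z [K' [K'0 zS z0 zw]]] := mHS_lagrangian T10 T1T wS.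
pose M := K + K'; have M0 : 0 <= M by rewrite /M addr_ge0.
have KM : K <= M by rewrite /M lerDl.
have KM' : K' <= M by rewrite /M lerDr.
have yS' := lag_solW KM (ltW T1T) yS.
have zS' := lag_solW KM' (lexx T1) zS.
have [C C0 CP] := lag_stable q M0 (ltW T10).
have yz : y t = z t.
  apply/funext => i; apply/eqP; rewrite -subr_eq0 -normr_le0.
  have := CP y z 0 T1 (lexx _) yS' zS' (lexx 0) _ t i tT1; rewrite mulr0; apply.
  by move=> j; rewrite y0 z0 subrr normr0.
apply/funext => x; rewrite /eulerian -[in LHS](flowK K0 yS yJ t x).
have -> : flow y t (label K0 yS yJ t x) = flow z t (label K0 yS yJ t x).
  by rewrite /flow yz.
by rewrite zw // yz.
Qed.

Lemma mHS_eulerian_dt w wt t : mHS_solution q.+1 x0 T v0 w wt -> 0 <= t < T ->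
  {ae circle_measure R, forall x, wt t x = ut t x}.
Proof.
move=> wS tT; have wu := mHS_eulerian wS tT; case: wS => _ _ /(_ t) + _.
rewrite in_itv /= => /(_ tT); rewrite wu.
have du := is_derive_derive1 (is_derive_u K0 yS yJ t).
apply: (@filterS _ _ (ae_filter_ringOfSetsType _)) => x /=.
rewrite (power_sourceE q (is_derive_u K0 yS yJ t)) du.
have := eulerian_equation K0 yS yJ yE x0 x (tW tT).
by rewrite /source => <- /addIr.
Qed.

End one_solution.

(** The curves depend on the data in a Lipschitz way; delta is not proportional
    to e because the Eulerian fields of y enter with their modulus of
    continuity. *)
Lemma solution_map_continuous v0 (y : R -> state) (yS : lag_sol q K T y)
    (yJ : forall t x, 2^-1 <= y t (LJ x)) A e : C1 v0 -> y 0 = lag_init v0 ->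
  (forall x, `|derive1 v0 x| <= A) -> 0 < e -> exists2 delta : R, 0 < delta &
  forall w0 (z : R -> state) (zS : lag_sol q K T z)
    (zJ : forall t x, 2^-1 <= z t (LJ x)), C1 w0 -> z 0 = lag_init w0 ->
    (forall x, `|derive1 w0 x| <= A) -> C1_norm (w0 \- v0) < delta ->
    forall t x, 0 <= t <= T ->
    [/\ `|eulerian K0 zS zJ (fun t => lagU (z t)) t x -
          eulerian K0 yS yJ (fun t => lagU (y t)) t x| <= e,
        `|eulerian K0 zS zJ (lagW z) t x - eulerian K0 yS yJ (lagW y) t x| <= e &
        `|eulerian K0 zS zJ (lagA q z) t x - eulerian K0 yS yJ (lagA q y) t x| <= e].
Proof.
move=> v0C y0 vA e0; have A0 : 0 <= A by apply: le_trans (vA 0).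
have jU : jcont (fun t => lagU (y t)).
  by case: (lag_lip yS) => M; exact: tame_jcont (tame_U K0) (lag_adm yS).
have pU : xperiodic (fun t => lagU (y t)).
  by move=> t; exact: (lagU_periodic K0 (lag_adm yS t)).
have jW := jcont_W K0 yS yJ; have pW := W_periodic yS.
have jA := jcont_A K0 yS yJ; have pA := A_periodic K0 yS.
have [r1 r10 P1] := eulerian_close K0 yS yJ jU pU e0.
have [r2 r20 P2] := eulerian_close K0 yS yJ jW pW e0.
have [r3 r30 P3] := eulerian_close K0 yS yJ jA pA e0.
have [C C0 CP] := lag_stable q K0 (ltW T0); have [L L0 LP] := eulerian_lip q K0.
(* D is the Lipschitz constant from data to states, L from states to fields. *)
pose D := C * (1 + 2 * A); have D0 : 0 <= D by rewrite mulr_ge0 //; lra.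
pose r := Num.min (Num.min r1 r2) r3; have rp : 0 < r by rewrite !lt_min r10 r20.
pose r' := Num.min r (e / 2 / (L + 1)).
have r'0 : 0 < r' by rewrite lt_min rp !divr_gt0 //; lra.
exists (r' / (D + 1)) => [|w0 z zS zJ w0C z0 wA wv t x tT].
  by rewrite divr_gt0 //; lra.
have dist i : `|z t i - y t i| <= r'.
  have d0 : 0 <= C1_norm (w0 \- v0) by apply: C1_norm_ge0; case: (C1B w0C v0C).
  have := CP z y ((1 + 2 * A) * C1_norm (w0 \- v0)) T (lexx _) zS yS _ _ t i tT.
  move=> H; apply: le_trans (H _ _) _.
  - by rewrite mulr_ge0 //; lra.
  - by move=> j; rewrite z0 y0; exact: lag_init_dist.
  rewrite mulrA -/D; apply: (@le_trans _ _ ((D + 1) * C1_norm (w0 \- v0))).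
    by rewrite ler_wpM2r // lerDl.
  by rewrite mulrC -ler_pdivlMr ?ltW //; lra.
have rr : r' <= r /\ r' <= e / 2 / (L + 1) by split; rewrite ge_min lexx ?orbT.
have Lr : L * r' <= e / 2.
  apply: (@le_trans _ _ ((L + 1) * r')).
    by rewrite ler_wpM2r ?ltW //; lra.
  by rewrite mulrC -ler_pdivlMr; [case: rr|lra].
have dr s : r <= s -> forall i, `|z t i - y t i| <= s.
  by move=> rs i; apply: le_trans (dist i) (le_trans _ rs); case: rr.
have Lag := LP z y t r' (lag_adm zS t) (lag_adm yS t) (zJ t) (yJ t) dist.
have [m1 m2 m3] : [/\ r <= r1, r <= r2 & r <= r3].
  by split; rewrite /r !ge_min lexx ?orbT.
split.
- apply: (P1 z _ zS zJ t tT (dr _ m1)) => v; case: (Lag v) => h _ _.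
  exact: le_trans h Lr.
- apply: (P2 z _ zS zJ t tT (dr _ m2)) => v; case: (Lag v) => _ h _.
  exact: le_trans h Lr.
- apply: (P3 z _ zS zJ t tT (dr _ m3)) => v; case: (Lag v) => _ _ h.
  exact: le_trans h Lr.
Qed.

End solution_map.

Lemma C1_ball_bound (R : realType) (u0 v0 : R -> R) : C1 u0 -> C1 v0 ->
  C1_norm (v0 \- u0) < 1 -> (forall x, `|v0 x| <= C1_norm u0 + 1) /\
  (forall x, `|derive1 v0 x| <= C1_norm u0 + 1).
Proof.
move=> u0C v0C vu; have [cB dB] := C1B v0C u0C.
have tri (a b c d : R) : `|a - b| <= c -> c < 1 -> `|b| <= d -> `|a| <= d + 1.
  by have := ler_normD (a - b) b; rewrite subrK; lra.
split=> x; have [h1 h2] := le_C1_norm cB x; have [h3 h4] := le_C1_norm u0C x.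
  exact: tri h1 vu h3.
by apply: tri _ vu h4; rewrite dB in h2.
Qed.

Theorem theorem2 (R : realType) (p : nat) (p_ge1 : (1 <= p)%N) (x0 : R)
    (u0 : R -> R) (u0_C1 : C1 u0) :
  exists T r : R, [/\ 0 < T, 0 < r,
    (* existence and uniqueness on [0, T), with T uniform near u0 *)
    forall v0 : R -> R, C1 v0 -> C1_norm (v0 \- u0) < r ->
      exists v vt : R -> R -> R, mHS_solution p x0 T v0 v vt /\
        forall w wt : R -> R -> R, mHS_solution p x0 T v0 w wt ->
          forall t : R, t \in `[0, T[ -> w t =1 v t &
    (* continuity of the data-to-solution map *)
    forall (v0 : R -> R) (v vt : R -> R -> R),
      C1 v0 -> C1_norm (v0 \- u0) < r -> mHS_solution p x0 T v0 v vt ->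
      forall T1 eps : R, 0 < T1 < T -> 0 < eps ->
      exists2 delta : R, 0 < delta &
        forall (w0 : R -> R) (w wt : R -> R -> R),
          C1 w0 -> C1_norm (w0 \- u0) < r -> C1_norm (w0 \- v0) < delta ->
          mHS_solution p x0 T w0 w wt ->
          forall t : R, t \in `[0, T1] ->
            C1_norm (w t \- v t) <= eps /\
            (Linfty_norm (wt t \- vt t)%R <= eps%:E)%E].
Proof.
(* All data in the unit ball around u0 obey the bound A, so that they share one
   lifespan T. *)
case: p p_ge1 => // q _; pose A := C1_norm u0 + 1.
have A0 : 0 <= A by have := C1_norm_ge0 u0_C1; rewrite /A; lra.
have K00 : 0 <= A + A ^+ 2 + 1 by have := exprn_ge0 2 A0; lra.
have [T [K [T0 K0 ex]]] := lag_exists q K00.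
have curve v0 : C1 v0 -> C1_norm (v0 \- u0) < 1 -> exists y : R -> state,
    [/\ lag_sol q K T y, y 0 = lag_init v0 & forall t x, 2^-1 <= y t (LJ x)].
  move=> v0C vu; have [b1 b2] := C1_ball_bound u0_C1 v0C vu.
  by apply: ex => //; exact: lag_init_adm.
exists T, 1; split=> //.
  move=> v0 v0C vu; have [y [yS y0 yJ]] := curve v0 v0C vu.
  exists (eulerian K0 yS yJ (fun t => lagU (y t))), (eulerian K0 yS yJ (lagA q y)).
  split; first exact: eulerian_mHS.
  move=> w wt wS t; rewrite in_itv /= => tT.
  by rewrite (mHS_eulerian K0 yS y0 yJ wS tT).
move=> v0 v vt v0C vu vS T1 eps /andP[T10 T1T] eps0.
have [y [yS y0 yJ]] := curve v0 v0C vu; have [_ vA] := C1_ball_bound u0_C1 v0C vu.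
have e2 : 0 < eps / 2 by lra.
have [delta d0 dP] := solution_map_continuous K0 T0 yS yJ v0C y0 vA e2.
exists delta => // w0 w wt w0C wu wv wS t; rewrite in_itv /= => /andP[t0 tT1].
have [z [zS z0 zJ]] := curve w0 w0C wu; have [_ wA] := C1_ball_bound u0_C1 w0C wu.
have tT : 0 <= t < T by rewrite t0 (le_lt_trans tT1).
have tT' : 0 <= t <= T by rewrite t0 ltW //; case/andP: tT.
have D x := dP w0 z zS zJ w0C z0 wA wv t x tT'.
have wE := mHS_eulerian K0 zS z0 zJ wS tT.
have vE := mHS_eulerian K0 yS y0 yJ vS tT.
split.
  have dw := is_derive_derive1 (is_derive_u K0 zS zJ t).
  have dv := is_derive_derive1 (is_derive_u K0 yS yJ t).
  have wC : C1 (w t) by case: wS => /(_ t); rewrite in_itv /= => /(_ tT) [].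
  have vC : C1 (v t) by case: vS => /(_ t); rewrite in_itv /= => /(_ tT) [].
  have [_ dB] := C1B wC vC; rewrite [eps]splitr.
  apply: C1_norm_le => x; first by rewrite wE vE /=; case: (D x).
  by rewrite dB wE vE dw dv; case: (D x).
apply/Linfty_normP.
have := mHS_eulerian_dt K0 yS y0 yJ vS tT.
have := mHS_eulerian_dt K0 zS z0 zJ wS tT.
apply: (@filterS2 _ _ (ae_filter_ringOfSetsType _)) => x /= -> ->.
by case: (D x) => _ _ h; apply: le_trans h _; rewrite ler_pdivrMr // ler_peMr ?ltW ?ltr1n.
Qed.
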